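(* Let $\mathfrak g=(\mathfrak g_0\oplus\mathfrak g_{-1},d,[\cdot,\cdot],l_3)$ be a Lie $2$-algebra. Then $(\mathrm{SAut}^{-1}(\mathfrak g),\mathrm{SAut}^0(\mathfrak g),\partial,\triangleright)$ is a sub-crossed module of Lie groups of $\mathrm{Aut}(\mathfrak g)=(\mathrm{Aut}^{-1}(\mathfrak g),\mathrm{Aut}^0(\mathfrak g),\partial,\triangleright)$. Moreover, the differentiation of $\mathrm{SAut}(\mathfrak g)$ is the crossed module of Lie algebras $(\mathrm{SDer}^{-1}(\mathfrak g),\mathrm{SDer}^0(\mathfrak g),\bar d,\phi)$, which is a sub-crossed module of $\mathrm{Der}(\mathfrak g)=(\mathrm{Der}^{-1}(\mathfrak g),\mathrm{Der}^0(\mathfrak g),\bar d,\phi)$.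
   Context: All vector spaces are real and finite-dimensional. A Lie $2$-algebra $\mathfrak g=(\mathfrak g_0\oplus\mathfrak g_{-1},d,[\cdot,\cdot],l_3)$ consists of vector spaces $\mathfrak g_0,\mathfrak g_{-1}$, a linear map $d:\mathfrak g_{-1}\to\mathfrak g_0$, a skew-symmetric bilinear bracket with $[x,y]\in\mathfrak g_0$, $[x,a]=-[a,x]\in\mathfrak g_{-1}$, $[a,b]=0$ for $x,y\in\mathfrak g_0$, $a,b\in\mathfrak g_{-1}$, and a skew-symmetric trilinear map $l_3:\wedge^3\mathfrak g_0\to\mathfrak g_{-1}$ such that for all $x,y,z,x_i\in\mathfrak g_0$, $a,b\in\mathfrak g_{-1}$: (a) $d[x,a]=[x,da]$, $[da,b]=[a,db]$; (b) $[[x,y],z]+[[y,z],x]+[[z,x],y]=-dl_3(x,y,z)$, $[[x,y],a]+[[y,a],x]+[[a,x],y]=-l_3(x,y,da)$; (c) $\sum_{i=1}^4(-1)^{i+1}[x_i,l_3(x_1,\dots,\hat x_i,\dots,x_4)]+\sum_{i<j}(-1)^{i+j}l_3([x_i,x_j],x_1,\dots,\hat x_i,\dots,\hat x_j,\dots,x_4)=0$. $\mathrm{Aut}(\mathfrak g)$: $\mathrm{Aut}^0(\mathfrak g)$ is the Lie group of triples $(A_0,A_1,A_2)$, $A_0\in GL(\mathfrak g_0)$, $A_1\in GL(\mathfrak g_{-1})$, $A_0d=dA_1$, $A_2:\wedge^2\mathfrak g_0\to\mathfrak g_{-1}$, with $A_0[x,y]-[A_0x,A_0y]=dA_2(x,y)$,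 $A_1[x,a]-[A_0x,A_1a]=A_2(x,da)$, $[A_0x,A_2(y,z)]+c.p.+l_3(A_0x,A_0y,A_0z)=A_2([x,y],z)+c.p.+A_1l_3(x,y,z)$ ($c.p.$: remaining cyclic permutations of $x,y,z$), under $(B\diamond A)_0=B_0A_0$, $(B\diamond A)_1=B_1A_1$, $(B\diamond A)_2=B_2\circ(A_0\times A_0)+B_1\circ A_2$. $\mathrm{Aut}^{-1}(\mathfrak g)$ is the Lie group of units of $\mathrm{Hom}(\mathfrak g_0,\mathfrak g_{-1})$ with product $\tau\star\tau'=\tau+\tau'+\tau\circ d\circ\tau'$. $\partial(\tau)=(I+d\circ\tau,I+\tau\circ d,l_\tau)$ with $l_\tau(x,y)=\tau[x,y]-[x,\tau y]-[\tau x,y]-[\tau x,d\tau y]$, and $A\triangleright\tau=A_1\circ\tau\circ A_0^{-1}$; this is a crossed module of Lie groups. $\mathrm{Der}(\mathfrak g)$: $\mathrm{Der}^0(\mathfrak g)$ is the set of triples $(X_0,X_1,l_X)$ with $X_0\in\mathrm{End}(\mathfrak g_0)$, $X_1\in\mathrm{End}(\mathfrak g_{-1})$, $X_0d=dX_1$, $l_X:\wedge^2\mathfrak g_0\to\mathfrak g_{-1}$, $dl_X(x,y)=X_0[x,y]-[X_0x,y]-[x,X_0y]$, $l_X(x,da)=X_1[x,a]-[X_0x,a]-[x,X_1a]$, $X_1l_3(x,y,z)=\big(l_X(x,[y,z])+[x,l_X(y,z)]+l_3(X_0x,y,z)\big)+c.p.$, with bracket $\{(X,l_X),(Y,l_Y)\}=([X_0,Y_0],[X_1,Y_1],L_Xl_Y-L_Yl_X)$,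 $L_X\omega(x,y)=X_1\omega(x,y)-\omega(X_0x,y)-\omega(x,X_0y)$. $\mathrm{Der}^{-1}(\mathfrak g)=\mathrm{Hom}(\mathfrak g_0,\mathfrak g_{-1})$ with bracket $\{\Theta,\Theta'\}=\Theta d\Theta'-\Theta'd\Theta$; $\bar d(\Theta)=(d\circ\Theta,\Theta\circ d,l_{\delta(\Theta)})$, $l_{\delta(\Theta)}(x,y)=\Theta[x,y]-[x,\Theta y]-[\Theta x,y]$; $\phi_{(X,l_X)}\Theta=X_1\Theta-\Theta X_0$. This is a crossed module of Lie algebras. Strict versions: $\mathrm{SAut}^0(\mathfrak g)=\{(A_0,A_1):(A_0,A_1,0)\in\mathrm{Aut}^0(\mathfrak g)\}$, regarded inside $\mathrm{Aut}^0(\mathfrak g)$; $\mathrm{SAut}^{-1}(\mathfrak g)=\{\tau\in\mathrm{Aut}^{-1}(\mathfrak g):\tau[x,y]=[x,\tau y]+[\tau x,y]+[\tau x,d\tau y]\ \forall x,y\in\mathfrak g_0\}$; $\mathrm{SDer}^0(\mathfrak g)=\{X=(X_0,X_1):(X_0,X_1,0)\in\mathrm{Der}^0(\mathfrak g)\}$, regarded inside $\mathrm{Der}^0(\mathfrak g)$; $\mathrm{SDer}^{-1}(\mathfrak g)=\{\Theta\in\mathrm{Hom}(\mathfrak g_0,\mathfrak g_{-1}):\Theta[x,y]=[x,\Theta y]+[\Theta x,y]\ \forall x,y\in\mathfrak g_0\}$. Structure maps are the restrictions of those above. The differentiation of a crossed module of Lie groups $(H_1,H_0,\partial,\triangleright)$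 is $(\mathrm{Lie}(H_1),\mathrm{Lie}(H_0),\partial_*,\phi)$ with $\phi_x(a)=\frac{d}{dt}\frac{d}{ds}\big|_{t=s=0}\exp(tx)\triangleright\exp(sa)$. *)

(* Defs.v *)
From HB Require Import structures.
From mathcomp Require Import all_boot all_order all_algebra.
From mathcomp Require Import all_classical all_reals all_analysis.

Set Implicit Arguments.
Unset Strict Implicit.
Unset Printing Implicit Defensive.

Import Order.TTheory GRing.Theory Num.Theory.
Import numFieldNormedType.Exports VectorInternalTheory.

Local Open Scope classical_set_scope.
Local Open Scope ring_scope.

(* A finite-dimensional vector space [V : vectType R] gets its canonical
   topology and smooth structure from the coordinates [v2r], with inverse
   [r2v]; the choice of linear coordinates does not matter. *)

(* For [A] open in a finite-dimensional space this is the usual class C^k. *)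
Fixpoint Ck (R : realType) (U W : normedModType R) (k : nat) (f : U -> W)
    (A : set U) : Prop :=
  if k is k'.+1 then
    (forall x, A x -> differentiable f x) /\
    (forall v : U, Ck k' (fun x => 'D_v f x) A)
  else forall x, A x -> {for x, continuous f}.

Definition vopen (R : realType) (V : vectType R) (U : set V) : Prop :=
  open [set x : 'rV[R]_(dim V) | U (r2v x)].

Definition smooth_on (R : realType) (V W : vectType R) (U : set V)
    (f : V -> W) : Prop :=
  forall k, Ck k (fun x : 'rV[R]_(dim V) => v2r (f (r2v x)))
                 [set x | U (r2v x)].

(* Slice charts; the one model space [L] forces constant dimension [\dim L]. *)
Definition is_submanifold (R : realType) (V : vectType R) (M : set V) : Prop :=
  exists L : {vspace V}, forall p, M p ->
    exists (U U' : set V) (Phi Psi : V -> V),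
      [/\ U p, vopen U & vopen U'] /\
      [/\ smooth_on U Phi, smooth_on U' Psi,
          forall x, U x -> U' (Phi x) /\ Psi (Phi x) = x
        & forall y, U' y -> U (Psi y) /\ Phi (Psi y) = y] /\
      (forall x, U x -> (M x <-> Phi x \in L)).

Definition smooth_on_submanifold (R : realType) (V W : vectType R)
    (M : set V) (f : V -> W) : Prop :=
  forall p, M p -> exists (U : set V) (F : V -> W),
    [/\ vopen U, U p, smooth_on U F & forall x, U x -> M x -> F x = f x].

Definition is_vderive (R : realType) (V : vectType R) (c : R -> V) (t : R)
    (v : V) : Prop :=
  is_derive t (1 : R) (fun s : R => v2r (c s)) (v2r v).

(* [d/dt d/ds f t s] at [t = s = 0] exists and equals [v]. *)
Definition is_vderive2 (R : realType) (V : vectType R) (f : R -> R -> V)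
    (v : V) : Prop :=
  exists D : R -> V,
    (\forall t \near (0 : R), is_vderive (f t) 0 (D t)) /\ is_vderive D 0 v.

Definition smooth_curve_in (R : realType) (V : vectType R) (M : set V) (p : V)
    (c : R -> V) : Prop :=
  c 0 = p /\
  exists2 e : R, 0 < e &
    (forall k, Ck k (fun t : R => v2r (c t)) (ball (0 : R) e)) /\
    (forall t, ball (0 : R) e t -> M (c t)).

Definition tangent_space (R : realType) (V : vectType R) (M : set V) (p : V) :
    set V :=
  [set v | exists2 c : R -> V, smooth_curve_in M p c & is_vderive c 0 v].

(* Groups are carried by subsets of a vector space [V]; [gmul] is only
   meaningful on the carrier. *)

Record group_data (R : realType) (V : vectType R) := GroupData {
  gset : set V;
  gmul : V -> V -> V;
  gone : V }.

Definition ginv (R : realType) (V : vectType R) (G : group_data V) (x : V) : V :=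
  xget (gone G)
    [set y | [/\ gset G y, gmul G x y = gone G & gmul G y x = gone G]].

Definition is_group (R : realType) (V : vectType R) (G : group_data V) : Prop :=
  [/\ gset G (gone G),
      forall x y, gset G x -> gset G y -> gset G (gmul G x y),
      forall x y z, gset G x -> gset G y -> gset G z ->
        gmul G x (gmul G y z) = gmul G (gmul G x y) z,
      forall x, gset G x -> gmul G (gone G) x = x /\ gmul G x (gone G) = x
    & forall x, gset G x ->
        exists y, [/\ gset G y, gmul G x y = gone G & gmul G y x = gone G]].

Definition is_lie_group (R : realType) (V : vectType R) (G : group_data V) :
    Prop :=
  [/\ is_group G, is_submanifold (gset G),
      smooth_on_submanifold (gset G `*` gset G)
        (fun p : (V * V)%type => gmul G p.1 p.2)
    & smooth_on_submanifold (gset G) (ginv G)].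

Definition is_one_parameter_subgroup (R : realType) (V : vectType R)
    (G : group_data V) (X : V) (c : R -> V) : Prop :=
  [/\ forall t, gset G (c t),
      forall s t, c (s + t) = gmul G (c s) (c t),
      forall k, Ck k (fun t : R => v2r (c t)) setT
    & is_vderive c 0 X].

(* On a Lie group there is exactly one such [c] for [X] tangent at [gone G]. *)
Definition lexp (R : realType) (V : vectType R) (G : group_data V) (X : V) : V :=
  xget (gone G)
    [set x | exists2 c, is_one_parameter_subgroup G X c & x = c 1].

Record xmod_data (R : realType) (V1 V0 : vectType R) := XmodData {
  xg1 : group_data V1;
  xg0 : group_data V0;
  xbd : V1 -> V0;
  xact : V0 -> V1 -> V1 }.

Definition is_lie_xmod (R : realType) (V1 V0 : vectType R)
    (H : xmod_data V1 V0) : Prop :=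
  let G1 := xg1 H in let G0 := xg0 H in
  [/\ is_lie_group G1, is_lie_group G0,
      [/\ forall a, gset G1 a -> gset G0 (xbd H a),
          forall a b, gset G1 a -> gset G1 b ->
            xbd H (gmul G1 a b) = gmul G0 (xbd H a) (xbd H b)
        & smooth_on_submanifold (gset G1) (xbd H)],
      [/\ forall x a, gset G0 x -> gset G1 a -> gset G1 (xact H x a),
          forall a, gset G1 a -> xact H (gone G0) a = a,
          forall x y a, gset G0 x -> gset G0 y -> gset G1 a ->
            xact H (gmul G0 x y) a = xact H x (xact H y a),
          forall x a b, gset G0 x -> gset G1 a -> gset G1 b ->
            xact H x (gmul G1 a b) = gmul G1 (xact H x a) (xact H x b)
        & smooth_on_submanifold (gset G0 `*` gset G1)
            (fun p : (V0 * V1)%type => xact H p.1 p.2)]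
    & (forall x a, gset G0 x -> gset G1 a ->
         xbd H (xact H x a) = gmul G0 (gmul G0 x (xbd H a)) (ginv G0 x)) /\
      (forall a b, gset G1 a -> gset G1 b ->
         xact H (xbd H a) b = gmul G1 (gmul G1 a b) (ginv G1 a))].

Definition is_subgroup (R : realType) (V : vectType R) (K G : group_data V) :
    Prop :=
  [/\ gset K `<=` gset G, gone K = gone G
    & forall x y, gset K x -> gset K y -> gmul K x y = gmul G x y].

(* The groups of [K] and [H] are embedded submanifolds of the same vector
   spaces, so those of [K] are embedded Lie subgroups of those of [H]. *)
Definition is_sub_lie_xmod (R : realType) (V1 V0 : vectType R)
    (K H : xmod_data V1 V0) : Prop :=
  [/\ is_lie_xmod K, is_lie_xmod H,
      is_subgroup (xg1 K) (xg1 H), is_subgroup (xg0 K) (xg0 H)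
    & (forall a, gset (xg1 K) a -> xbd K a = xbd H a) /\
      (forall x a, gset (xg0 K) x -> gset (xg1 K) a -> xact K x a = xact H x a)].

Record lie_data (R : realType) (V : vectType R) := LieData {
  lset : set V;
  lbr : V -> V -> V }.

Definition is_lie_algebra (R : realType) (V : vectType R) (L : lie_data V) :
    Prop :=
  [/\ lset L 0 /\
      (forall (k : R) x y, lset L x -> lset L y -> lset L (k *: x + y)),
      forall x y, lset L x -> lset L y -> lset L (lbr L x y),
      forall (k : R) x y z, lset L x -> lset L y -> lset L z ->
        lbr L (k *: x + y) z = k *: lbr L x z + lbr L y z /\
        lbr L z (k *: x + y) = k *: lbr L z x + lbr L z y,
      forall x, lset L x -> lbr L x x = 0
    & forall x y z, lset L x -> lset L y -> lset L z ->
        lbr L x (lbr L y z) + lbr L y (lbr L z x) + lbr L z (lbr L x y) = 0].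

Record lie_xmod_data (R : realType) (V1 V0 : vectType R) := LieXmodData {
  xl1 : lie_data V1;
  xl0 : lie_data V0;
  xlbd : V1 -> V0;
  xlact : V0 -> V1 -> V1 }.

Definition is_lie_algebra_xmod (R : realType) (V1 V0 : vectType R)
    (M : lie_xmod_data V1 V0) : Prop :=
  let L1 := xl1 M in let L0 := xl0 M in
  [/\ is_lie_algebra L1, is_lie_algebra L0,
      [/\ forall a, lset L1 a -> lset L0 (xlbd M a),
          forall (k : R) a b, lset L1 a -> lset L1 b ->
            xlbd M (k *: a + b) = k *: xlbd M a + xlbd M b
        & forall a b, lset L1 a -> lset L1 b ->
            xlbd M (lbr L1 a b) = lbr L0 (xlbd M a) (xlbd M b)],
      [/\ forall x a, lset L0 x -> lset L1 a -> lset L1 (xlact M x a),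
          forall (k : R) x a b, lset L0 x -> lset L1 a -> lset L1 b ->
            xlact M x (k *: a + b) = k *: xlact M x a + xlact M x b,
          forall (k : R) x y a, lset L0 x -> lset L0 y -> lset L1 a ->
            xlact M (k *: x + y) a = k *: xlact M x a + xlact M y a,
          forall x a b, lset L0 x -> lset L1 a -> lset L1 b ->
            xlact M x (lbr L1 a b) =
              lbr L1 (xlact M x a) b + lbr L1 a (xlact M x b)
        & forall x y a, lset L0 x -> lset L0 y -> lset L1 a ->
            xlact M (lbr L0 x y) a =
              xlact M x (xlact M y a) - xlact M y (xlact M x a)]
    & (forall x a, lset L0 x -> lset L1 a ->
         xlbd M (xlact M x a) = lbr L0 x (xlbd M a)) /\
      (forall a b, lset L1 a -> lset L1 b ->
         xlact M (xlbd M a) b = lbr L1 a b)].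

Definition is_lie_subalgebra (R : realType) (V : vectType R) (K L : lie_data V) :
    Prop :=
  lset K `<=` lset L /\
  (forall x y, lset K x -> lset K y -> lbr K x y = lbr L x y).

Definition is_sub_lie_algebra_xmod (R : realType) (V1 V0 : vectType R)
    (N M : lie_xmod_data V1 V0) : Prop :=
  [/\ is_lie_algebra_xmod N, is_lie_algebra_xmod M,
      is_lie_subalgebra (xl1 N) (xl1 M), is_lie_subalgebra (xl0 N) (xl0 M)
    & (forall a, lset (xl1 N) a -> xlbd N a = xlbd M a) /\
      (forall x a, lset (xl0 N) x -> lset (xl1 N) a ->
         xlact N x a = xlact M x a)].

(* The bracket of Lie(G) is ad, the differential of Ad. *)
Definition is_lie_algebra_of (R : realType) (V : vectType R)
    (G : group_data V) (L : lie_data V) : Prop :=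
  lset L = tangent_space (gset G) (gone G) /\
  (forall X Y, lset L X -> lset L Y ->
     is_vderive2 (fun t s : R =>
         gmul G (gmul G (lexp G (t *: X)) (lexp G (s *: Y)))
                (ginv G (lexp G (t *: X))))
       (lbr L X Y)).

Definition is_differentiation_of (R : realType) (V1 V0 : vectType R)
    (H : xmod_data V1 V0) (M : lie_xmod_data V1 V0) : Prop :=
  [/\ is_lie_algebra_of (xg1 H) (xl1 M),
      is_lie_algebra_of (xg0 H) (xl0 M),
      forall a c, smooth_curve_in (gset (xg1 H)) (gone (xg1 H)) c ->
        is_vderive c 0 a -> is_vderive (fun t => xbd H (c t)) 0 (xlbd M a)
    & forall x a, lset (xl0 M) x -> lset (xl1 M) a ->
        is_vderive2 (fun t s : R =>
            xact H (lexp (xg0 H) (t *: x)) (lexp (xg1 H) (s *: a)))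
          (xlact M x a)].

(* [br00] and [br01] are the brackets [x, y] and [x, a] for x, y in degree 0
   and a in degree -1; the bracket vanishes on two elements of degree -1. *)
Record lie2_algebra (R : realType) (g0 g1 : vectType R) := Lie2Algebra {
  gdiff : 'Hom(g1, g0);
  br00 : 'Hom(g0, 'Hom(g0, g0));
  br01 : 'Hom(g0, 'Hom(g1, g1));
  l3 : 'Hom(g0, 'Hom(g0, 'Hom(g0, g1)));
  br10 := fun (a : g1) (x : g0) => - br01 x a;
  br00_skew : forall x y, br00 x y = - br00 y x;
  l3_skew12 : forall x y z, l3 x y z = - l3 y x z;
  l3_skew23 : forall x y z, l3 x y z = - l3 x z y;
  gdiff_br : forall x a, gdiff (br01 x a) = br00 x (gdiff a);
  gdiff_peiffer : forall a b, br01 (gdiff a) b = br10 a (gdiff b);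
  jacobi000 : forall x y z,
    br00 (br00 x y) z + br00 (br00 y z) x + br00 (br00 z x) y
      = - gdiff (l3 x y z);
  jacobi001 : forall x y a,
    br01 (br00 x y) a + br10 (br01 y a) x + br10 (br10 a x) y
      = - l3 x y (gdiff a);
  jacobiator : forall x1 x2 x3 x4,
    (br01 x1 (l3 x2 x3 x4) - br01 x2 (l3 x1 x3 x4)
     + br01 x3 (l3 x1 x2 x4) - br01 x4 (l3 x1 x2 x3))
    + (- l3 (br00 x1 x2) x3 x4 + l3 (br00 x1 x3) x2 x4 - l3 (br00 x1 x4) x2 x3
       - l3 (br00 x2 x3) x1 x4 + l3 (br00 x2 x4) x1 x3 - l3 (br00 x3 x4) x1 x2)
    = 0 }.

(* The bilinear map given by [f]; see [bilinE]. *)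
Definition bilin (R : realType) (U V W : vectType R) (f : U -> V -> W) :
    'Hom(U, 'Hom(V, W)) :=
  linfun (fun x => linfun (f x)).

Lemma bilinE (R : realType) (U V W : vectType R) (f : U -> V -> W) :
  (forall x, linear (f x)) -> (forall y, linear (f ^~ y)) ->
  forall x y, bilin f x y = f x y.
Proof.
move=> fr fl x y.
have E z : linfun (f z) =1 f z.
  pose h := GRing.isLinear.Build _ _ _ _ (f z) (fr z).
  pose F : {linear V -> W} := HB.pack (f z) h.
  exact: (lfunE F).
have lin : linear (fun z => linfun (f z)).
  by move=> k u v; apply/lfunP => w; rewrite add_lfunE scale_lfunE !E fl.
pose h := GRing.isLinear.Build _ _ _ _ (fun z => linfun (f z)) lin.
pose F : {linear U -> 'Hom(V, W)} := HB.pack (fun z => linfun (f z)) h.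
by rewrite /bilin (lfunE F) E.
Qed.

Definition skew2 (R : realType) (g0 g1 : vectType R)
    (w : 'Hom(g0, 'Hom(g0, g1))) : Prop :=
  forall x y, w x y = - w y x.

Definition cyc (R : realType) (g0 g1 : vectType R) (f : g0 -> g0 -> g0 -> g1)
    (x y z : g0) : g1 :=
  f x y z + f y z x + f z x y.

(* [A = (A_0, A_1, A_2)], accessed as [A.1.1], [A.1.2], [A.2]. *)
Definition triple (R : realType) (g0 g1 : vectType R) : vectType R :=
  ('End(g0) * 'End(g1) * 'Hom(g0, 'Hom(g0, g1)))%type.

Definition aut0_set (R : realType) (g0 g1 : vectType R)
    (g : lie2_algebra g0 g1) : set (triple g0 g1) :=
  [set A : triple g0 g1 | let A0 := A.1.1 in let A1 := A.1.2 in let A2 := A.2 in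
    [/\ bijective A0, bijective A1, skew2 A2,
        (A0 \o gdiff g = gdiff g \o A1)%VF
      & [/\ forall x y,
              A0 (br00 g x y) - br00 g (A0 x) (A0 y) = gdiff g (A2 x y),
            forall x a,
              A1 (br01 g x a) - br01 g (A0 x) (A1 a) = A2 x (gdiff g a)
          & forall x y z,
              cyc (fun x y z => br01 g (A0 x) (A2 y z)) x y z
                + l3 g (A0 x) (A0 y) (A0 z)
              = cyc (fun x y z => A2 (br00 g x y) z) x y z
                + A1 (l3 g x y z)]]].

Definition aut0_mul (R : realType) (g0 g1 : vectType R) (B A : triple g0 g1) :
    triple g0 g1 :=
  ((B.1.1 \o A.1.1)%VF, (B.1.2 \o A.1.2)%VF,
   bilin (fun x y => B.2 (A.1.1 x) (A.1.1 y) + B.1.2 (A.2 x y))).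

Definition aut0_one (R : realType) (g0 g1 : vectType R) : triple g0 g1 :=
  (\1%VF, \1%VF, 0).

Definition aut1_mul (R : realType) (g0 g1 : vectType R)
    (g : lie2_algebra g0 g1) (s t : 'Hom(g0, g1)) : 'Hom(g0, g1) :=
  s + t + (s \o (gdiff g \o t))%VF.

(* The neutral element of the product [aut1_mul] is 0. *)
Definition aut1_set (R : realType) (g0 g1 : vectType R)
    (g : lie2_algebra g0 g1) : set 'Hom(g0, g1) :=
  [set t : 'Hom(g0, g1) | exists s, aut1_mul g t s = 0 /\ aut1_mul g s t = 0].

Definition aut_bd (R : realType) (g0 g1 : vectType R)
    (g : lie2_algebra g0 g1) (t : 'Hom(g0, g1)) : triple g0 g1 :=
  (\1%VF + (gdiff g \o t)%VF, \1%VF + (t \o gdiff g)%VF,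
   bilin (fun x y => t (br00 g x y) - br01 g x (t y) - br10 g (t x) y
                     - br10 g (t x) (gdiff g (t y)))).

Definition aut_act (R : realType) (g0 g1 : vectType R) (A : triple g0 g1)
    (t : 'Hom(g0, g1)) : 'Hom(g0, g1) :=
  (A.1.2 \o t \o A.1.1^-1)%VF.

Definition Aut0 (R : realType) (g0 g1 : vectType R) (g : lie2_algebra g0 g1) :
    group_data (triple g0 g1) :=
  GroupData (aut0_set g) (@aut0_mul R g0 g1) (aut0_one g0 g1).

Definition Aut1 (R : realType) (g0 g1 : vectType R) (g : lie2_algebra g0 g1) :
    group_data 'Hom(g0, g1) :=
  GroupData (aut1_set g) (aut1_mul g) 0.

Definition Aut (R : realType) (g0 g1 : vectType R) (g : lie2_algebra g0 g1) :
    xmod_data 'Hom(g0, g1) (triple g0 g1) :=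
  XmodData (Aut1 g) (Aut0 g) (aut_bd g) (@aut_act R g0 g1).

Definition SAut0 (R : realType) (g0 g1 : vectType R) (g : lie2_algebra g0 g1) :
    group_data (triple g0 g1) :=
  GroupData [set A : triple g0 g1 | aut0_set g A /\ A.2 = 0] (@aut0_mul R g0 g1)
    (aut0_one g0 g1).

Definition SAut1 (R : realType) (g0 g1 : vectType R) (g : lie2_algebra g0 g1) :
    group_data 'Hom(g0, g1) :=
  GroupData
    [set t : 'Hom(g0, g1) | aut1_set g t /\
       forall x y, t (br00 g x y) =
         br01 g x (t y) + br10 g (t x) y + br10 g (t x) (gdiff g (t y))]
    (aut1_mul g) 0.

Definition SAut (R : realType) (g0 g1 : vectType R) (g : lie2_algebra g0 g1) :
    xmod_data 'Hom(g0, g1) (triple g0 g1) :=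
  XmodData (SAut1 g) (SAut0 g) (aut_bd g) (@aut_act R g0 g1).

Definition der0_set (R : realType) (g0 g1 : vectType R)
    (g : lie2_algebra g0 g1) : set (triple g0 g1) :=
  [set X : triple g0 g1 | let X0 := X.1.1 in let X1 := X.1.2 in let lX := X.2 in
    [/\ skew2 lX,
        (X0 \o gdiff g = gdiff g \o X1)%VF,
        forall x y, gdiff g (lX x y) =
          X0 (br00 g x y) - br00 g (X0 x) y - br00 g x (X0 y),
        forall x a, lX x (gdiff g a) =
          X1 (br01 g x a) - br01 g (X0 x) a - br01 g x (X1 a)
      & forall x y z, X1 (l3 g x y z) =
          cyc (fun x y z => lX x (br00 g y z) + br01 g x (lX y z)
                            + l3 g (X0 x) y z) x y z]].

Definition lie_der (R : realType) (g0 g1 : vectType R) (X : triple g0 g1)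
    (w : 'Hom(g0, 'Hom(g0, g1))) : 'Hom(g0, 'Hom(g0, g1)) :=
  bilin (fun x y => X.1.2 (w x y) - w (X.1.1 x) y - w x (X.1.1 y)).

Definition der0_br (R : realType) (g0 g1 : vectType R) (X Y : triple g0 g1) :
    triple g0 g1 :=
  ((X.1.1 \o Y.1.1)%VF - (Y.1.1 \o X.1.1)%VF,
   (X.1.2 \o Y.1.2)%VF - (Y.1.2 \o X.1.2)%VF,
   lie_der X Y.2 - lie_der Y X.2).

Definition der1_br (R : realType) (g0 g1 : vectType R)
    (g : lie2_algebra g0 g1) (s t : 'Hom(g0, g1)) : 'Hom(g0, g1) :=
  (s \o (gdiff g \o t))%VF - (t \o (gdiff g \o s))%VF.

Definition der_bd (R : realType) (g0 g1 : vectType R)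
    (g : lie2_algebra g0 g1) (t : 'Hom(g0, g1)) : triple g0 g1 :=
  ((gdiff g \o t)%VF, (t \o gdiff g)%VF,
   bilin (fun x y => t (br00 g x y) - br01 g x (t y) - br10 g (t x) y)).

Definition der_act (R : realType) (g0 g1 : vectType R) (X : triple g0 g1)
    (t : 'Hom(g0, g1)) : 'Hom(g0, g1) :=
  (X.1.2 \o t)%VF - (t \o X.1.1)%VF.

Definition Der (R : realType) (g0 g1 : vectType R) (g : lie2_algebra g0 g1) :
    lie_xmod_data 'Hom(g0, g1) (triple g0 g1) :=
  LieXmodData (LieData setT (der1_br g))
    (LieData (der0_set g) (@der0_br R g0 g1))
    (der_bd g) (@der_act R g0 g1).

Definition SDer (R : realType) (g0 g1 : vectType R) (g : lie2_algebra g0 g1) :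
    lie_xmod_data 'Hom(g0, g1) (triple g0 g1) :=
  LieXmodData
    (LieData [set t : 'Hom(g0, g1) | forall x y,
                t (br00 g x y) = br01 g x (t y) + br10 g (t x) y]
       (der1_br g))
    (LieData [set X : triple g0 g1 | der0_set g X /\ X.2 = 0] (@der0_br R g0 g1))
    (der_bd g) (@der_act R g0 g1).

(* Main.v *)
Require Import Defs.
From HB Require Import structures.
From mathcomp Require Import all_boot all_order all_algebra.
From mathcomp Require Import ring lra zify.
From mathcomp Require Import all_classical all_reals all_analysis.

(* Aut^0 is the stabiliser of the structure maps (d, [.,.], l_3) and of the
   skewness of A_2 under the right action "pull back along A", and SAut^0 and
   SAut^{-1} are cut out in the same way: each of these groups is the zero set
   of a map F on an open set of invertible elements satisfying a cocycle
   identity F(ab) = rho_b F(a) + F(b). Differentiating it in a at 1 shows that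
   right translation by b maps ker DF_1 injectively into ker DF_b, even for b
   outside the group; so F has constant rank near 1, which by the inverse
   function theorem gives a slice chart at 1, and right translations carry it
   to the other points.

   SAut^{-1} is the preimage of SAut^0 under the boundary, and SDer^{-1} that of
   SDer^0, so the closure properties of the strict crossed modules follow from
   the equivariance of the boundary and of the action.

   One-parameter subgroups solve linear or affine ordinary differential
   equations. The quantities measuring the failure of such a curve to preserve
   the structure solve a homogeneous linear equation with zero initial value,
   hence vanish: this shows that tangent vectors satisfying the infinitesimal
   equations exponentiate into the strict groups. The bracket and the action
   are then computed by differentiating twice. *)

Set Implicit Arguments.
Unset Strict Implicit.
Unset Printing Implicit Defensive.

Import Order.TTheory GRing.Theory Num.Theory.
Import numFieldNormedType.Exports VectorInternalTheory.

Local Open Scope classical_set_scope.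
Local Open Scope ring_scope.

(** The values of [F] lie in a space far larger than the image of its derivative, so [F] is not a
    submersion and its rank at 1 is never computed. Transport of kernels only bounds the rank at [b]
    by the rank at 1. The opposite bound near 1 comes from the chart map itself, whose derivative is
    invertible there. No dimension count and no description of the tangent space enters the
    construction of charts.

    Both group products are affine in the left factor and associative on the whole ambient vector
    space. Right translations are therefore affine maps defined everywhere, and they carry lines
    through the unit to lines through [b]. Kernels of [DF] can thus be tested along straight lines
    by one-variable calculus.

    Inverses and exponentials are given by a choice operator. Each of them has to be identified with
    an explicit curve or formula by a uniqueness argument before anything can be differentiated. *)

Section Differentiability.
Variable R : realType.
Implicit Types U W : normedModType R.

(** The epsilon form of the little-o condition. It identifies the differential along with proving
    differentiability, which is how the derivative of the local inverse is found in
    [inverse_function]. *)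
Lemma differentiable_linear_approx U W (f : U -> W) (x : U)
    (df : {linear U -> W}) :
  continuous df ->
  (forall e : R, 0 < e ->
     \forall h \near (0 : U), `|f (h + x) - f x - df h| <= e * `|h|) ->
  differentiable f x /\ 'd f x = df :> (U -> W).
Proof.
move=> dfc H.
have E : f \o shift x = cst (f x) + df +o_ (0 : U) id.
  apply/eqaddoP => e e0; move: (H e e0); apply: filterS => h.
  rewrite !fctE /=.
  by rewrite opprD addrA.
by split; [apply/diff_locallyP; rewrite (diff_unique dfc E)|apply: diff_unique].
Qed.

Lemma differentiable_near_eq U W (f g : U -> W) (x : U) :
  (\near x, f x = g x) -> differentiable f x -> differentiable g x.
Proof.
move=> fg df.
have [dfc _] := diff_locallyxP x f; have {dfc}[dfc E] := dfc df.
have [] // := @differentiable_linear_approx U W g x ('d f x) dfc.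
move=> e e0; have fgx := nbhs_singleton fg.
have /eqaddoP /(_ e e0) H := diff_locally df.
rewrite -fgx.
have : \forall h \near (0 : U), f (h + x) = g (h + x).
  by move: fg; rewrite (near_shift 0) subr0.
move: H; apply: filterS2 => h H fgh.
by move: H; rewrite !fctE /= opprD addrA fgh.
Qed.

Lemma differentiable_row U n (f : U -> 'rV[R]_n) (x : U) :
  (forall i, differentiable (fun x => f x ord0 i) x) -> differentiable f x.
Proof.
move=> H; have -> : f = \sum_(i < n) (fun x => f x ord0 i *: delta_mx ord0 i).
  by apply/funext => y; rewrite fct_sumE; exact: row_sum_delta.
by apply: differentiable_sum => i; exact: differentiableZl.
Qed.

Lemma differentiable_entry U n (f : U -> 'rV[R]_n) (x : U) i :
  differentiable f x -> differentiable (fun x => f x ord0 i) x.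
Proof.
move=> df; rewrite (_ : (fun _ => _) = (fun M : 'rV[R]_n => M ord0 i) \o f)//.
by apply: differentiable_comp => //; exact: differentiable_coord.
Qed.

Lemma derive_entry U n (f : U -> 'rV[R]_n) (x v : U) i :
  differentiable f x -> 'D_v (fun x => f x ord0 i) x = ('D_v f x) ord0 i.
Proof. by move=> df; rewrite derive_mx ?mxE//; exact: diff_derivable. Qed.

(** Written through the partial derivatives of [f], because [Ck] speaks of derivatives in fixed
    directions: each summand is then a product of functions whose class an induction on [k]
    controls. *)
Lemma derive_comp_row U W n (f : 'rV[R]_n -> W) (g : U -> 'rV[R]_n) (x v : U) :
  differentiable g x -> differentiable f (g x) ->
  'D_v (f \o g) x =
    \sum_(j < n) ('D_v g x) ord0 j *: ('D_(delta_mx ord0 j) f (g x)).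
Proof.
move=> dg df; rewrite deriveE; last exact: differentiable_comp.
rewrite diff_comp//= -(deriveE v dg); set w := derive g x v.
transitivity ('d f (g x) (\sum_j w ord0 j *: delta_mx ord0 j)).
  by rewrite -row_sum_delta.
by rewrite linear_sum; apply: eq_bigr => j _; rewrite linearZ deriveE.
Qed.

End Differentiability.

(** * Functions of class C^k and the inverse function theorem *)

Section CkTheory.
Variable R : realType.
Implicit Types U W : normedModType R.

Lemma near_open U (A P : set U) (x : U) : open A -> A x -> A `<=` P ->
  \forall y \near x, P y.
Proof. by move=> oA Ax AP; apply: filterS AP _; exact: open_nbhs_nbhs. Qed.

(** On an open set, agreement on [A] is agreement near each of its points, hence agreement of all
    iterated derivatives. The closure properties below use this to replace a derivative by the
    formula that a differentiation rule gives only on [A]. *)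
Lemma Ck_ext U W k (f g : U -> W) (A : set U) : open A ->
  (forall x, A x -> f x = g x) -> Ck k f A -> Ck k g A.
Proof.
move=> oA; elim: k f g => [|k IH] f g fg /=.
  move=> H x Ax; have := H x Ax; rewrite /prop_for /continuous_at -(fg x Ax).
  apply: cvg_trans; apply: near_eq_cvg.
  by apply: near_open Ax _ => // y /fg /esym.
move=> [df Df]; split.
  move=> x Ax; apply: differentiable_near_eq (df x Ax).
  exact: near_open Ax fg.
move=> v; apply: IH (Df v) => x Ax; apply: near_eq_derive.
exact: near_open Ax fg.
Qed.

Lemma Ck_sub U W k (f : U -> W) (A B : set U) : A `<=` B -> Ck k f B -> Ck k f A.
Proof.
move=> AB; elim: k f => [|k IH] f /=; first by move=> H x /AB; exact: H.
by move=> [df Df]; split=> [x /AB|v]; [exact: df|exact/IH/Df].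
Qed.

Lemma Ck_pred U W k (f : U -> W) (A : set U) : Ck k.+1 f A -> Ck k f A.
Proof.
elim: k f => [|k IH] f.
  by move=> [df _] x /df; exact: differentiable_continuous.
by move=> [df Df]; split=> // v; apply: IH; exact: Df.
Qed.

Lemma Ck_cst U W k (c : W) (A : set U) : Ck k (fun=> c) A.
Proof.
elim: k c => [|k IH] c /=; first by move=> x _; exact: cst_continuous.
split=> [x _|v]; first exact: differentiable_cst.
have -> : (fun x : U => derive (fun=> c) x v) = fun=> 0 :> W => //.
by apply/funext => x; exact: (derive_cst c x v).
Qed.

Lemma CkD U W k (f g : U -> W) (A : set U) : open A ->
  Ck k f A -> Ck k g A -> Ck k (fun x => f x + g x) A.
Proof.
move=> oA; elim: k f g => [|k IH] f g /=.
  by move=> cf cg x Ax; apply: continuousD; [exact: cf|exact: cg].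
move=> [df Df] [dg Dg]; split.
  by move=> x Ax; apply: differentiableD; [exact: df|exact: dg].
move=> v; apply: Ck_ext (IH _ _ (Df v) (Dg v)) => // x Ax.
by apply/esym/deriveD; apply: diff_derivable; [exact: df|exact: dg].
Qed.

Lemma CkZ U W k (c : R) (f : U -> W) (A : set U) : open A ->
  Ck k f A -> Ck k (fun x => c *: f x) A.
Proof.
move=> oA; elim: k f => [|k IH] f /=.
  by move=> cf x Ax; apply: continuousZl_tmp; exact: cf.
move=> [df Df]; split.
  by move=> x Ax; apply: differentiableZ; exact: df.
move=> v; apply: Ck_ext (IH _ (Df v)) => // x Ax.
by apply/esym/deriveZ; apply: diff_derivable; exact: df.
Qed.

Lemma CkM U k (f g : U -> R) (A : set U) : open A ->
  Ck k f A -> Ck k g A -> Ck k (fun x => f x * g x) A.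
Proof.
move=> oA; elim: k f g => [|k IH] f g.
  by move=> cf cg x Ax; apply: continuousM; [exact: cf|exact: cg].
move=> Cf Cg; have cf := Ck_pred Cf; have cg := Ck_pred Cg.
case: Cf Cg => df Df [dg Dg]; split.
  by move=> x Ax; apply: differentiableM; [exact: df|exact: dg].
move=> v; apply: Ck_ext (CkD oA (IH _ _ cf (Dg v)) (IH _ _ cg (Df v))) => // x Ax.
by apply/esym; apply: deriveM; apply: diff_derivable; [exact: df|exact: dg].
Qed.

Lemma Ck_sum U W k (I : Type) (r : seq I) (P : pred I) (f : I -> U -> W)
    (A : set U) : open A ->
  (forall i, P i -> Ck k (f i) A) -> Ck k (fun x => \sum_(i <- r | P i) f i x) A.
Proof.
move=> oA H; elim: r => [|i r IH].
  by apply: Ck_ext (Ck_cst k 0 A) => // x _; rewrite big_nil.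
case: (boolP (P i)) => Pi.
  apply: Ck_ext (CkD oA (H i Pi) IH) => // x _.
  by rewrite big_cons Pi.
by apply: Ck_ext IH => // x _; rewrite big_cons (negbTE Pi).
Qed.

Lemma Ck_prod U k (I : Type) (r : seq I) (f : I -> U -> R) (A : set U) :
  open A ->
  (forall i, Ck k (f i) A) -> Ck k (fun x => \prod_(i <- r) f i x) A.
Proof.
move=> oA H; elim: r => [|i r IH].
  by apply: Ck_ext (Ck_cst k (1 : R) A) => // x _; rewrite big_nil.
by apply: Ck_ext (CkM oA (H i) IH) => // x _; rewrite big_cons.
Qed.

(** The derivative is [- f^-2] times that of [f], so one more order for [f^-1] needs only the order
    of [f^-1] already obtained. *)
Lemma CkV U k (f : U -> R) (A : set U) : open A ->
  (forall x, A x -> f x != 0) -> Ck k f A -> Ck k (fun x => (f x)^-1) A.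
Proof.
move=> oA f0; elim: k => [|k IH].
  by move=> cf x Ax; apply: continuousV; [exact: f0|exact: cf].
move=> Cf; have cf := IH (Ck_pred Cf); case: Cf => df Df; split.
  by move=> x Ax; apply: differentiableV; [exact: df|exact: f0].
move=> v; have H := CkZ (-1) oA (CkM oA (CkM oA cf cf) (Df v)).
apply: Ck_ext H => // x Ax.
rewrite [RHS](@deriveV _ _ f x v (f0 x Ax)); last exact/diff_derivable/df.
by rewrite scaleN1r -mulNr -invfM -expr2.
Qed.

Lemma Ck_row U n k (f : U -> 'rV[R]_n) (A : set U) : open A ->
  (forall i, Ck k (fun x => f x ord0 i) A) -> Ck k f A.
Proof.
move=> oA; elim: k f => [|k IH] f H.
  move=> x Ax; apply/cvgrPdist_lt => e e0.
  have K i : \forall y \near x, `|f x ord0 i - f y ord0 i| < e.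
    by have /cvgrPdist_lt/(_ e e0) := H i x Ax.
  have : \forall y \near x, forall i, `|f x ord0 i - f y ord0 i| < e.
    exact: filter_forall.
  apply: filterS => y K2.
  rewrite [ltLHS]/Num.Def.normr/= mx_normrE; apply: bigmax_lt => // -[i j] _ /=.
  by rewrite !mxE (ord1 i); exact: K2.
split=> [x Ax|v].
  by apply: differentiable_row => i; case: (H i) => + _; exact.
apply: IH => i; case: (H i) => _ /(_ v); apply: Ck_ext => // x Ax.
rewrite derive_entry//; apply: differentiable_row => j.
by case: (H j) => + _; exact.
Qed.

Lemma Ck_entry U n k (f : U -> 'rV[R]_n) (A : set U) i : open A ->
  Ck k f A -> Ck k (fun x => f x ord0 i) A.
Proof.
move=> oA; elim: k f => [|k IH] f.
  move=> cf x Ax; apply: (@continuous_comp _ _ _ f (fun y => y ord0 i)).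
    exact: cf.
  exact: coord_continuous.
move=> [df Df]; split=> [x Ax|v]; first exact/differentiable_entry/df.
by apply: Ck_ext (IH _ (Df v)) => // x Ax; rewrite derive_entry//; exact: df.
Qed.

(** By the chain rule the derivative is a sum of products of entries of ['D_v g] with partial
    derivatives of [f] composed with the same [g]; the induction therefore ranges over all [f] while
    [g] stays fixed. *)
Lemma Ck_comp U n k (f : 'rV[R]_n -> R) (g : U -> 'rV[R]_n)
    (A : set U) (B : set 'rV[R]_n) : open A ->
  (forall x, A x -> B (g x)) ->
  Ck k f B -> Ck k g A -> Ck k (f \o g) A.
Proof.
move=> oA AB; elim: k f => [|k IH] f.
  move=> cf cg x Ax; apply: continuous_comp; first exact: cg.
  exact: cf (AB _ Ax).
move=> [df Df] Cg; have cg := Ck_pred Cg; case: Cg => dg Dg; split=> [x Ax|v].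
  by apply: differentiable_comp; [exact: dg|exact: df (AB _ Ax)].
have H : Ck k (fun x => \sum_(j < n) ('D_v g x) ord0 j *
    ('D_(delta_mx ord0 j) f \o g) x) A.
  by apply: Ck_sum => // j _; apply: CkM => //; [exact: (Ck_entry j oA (Dg v))|exact: IH (Df _) cg].
apply: Ck_ext H => // x Ax; rewrite derive_comp_row//; first exact: dg.
exact: df (AB _ Ax).
Qed.

Lemma Ck_comp_row U m n k (f : 'rV[R]_n -> 'rV[R]_m) (g : U -> 'rV[R]_n)
    (A : set U) (B : set 'rV[R]_n) : open A -> open B ->
  (forall x, A x -> B (g x)) ->
  Ck k f B -> Ck k g A -> Ck k (f \o g) A.
Proof.
move=> oA oB AB Cf Cg; apply: Ck_row => // i.
by apply: (@Ck_comp _ _ _ (fun y => f y ord0 i) g A B) => //; exact: Ck_entry.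
Qed.

Lemma Ck_id_entry n k (A : set 'rV[R]_n) i : open A ->
  Ck k (fun x : 'rV[R]_n => x ord0 i) A.
Proof.
move=> oA; case: k => [|k]; first by move=> x _; exact: coord_continuous.
split=> [x _|v]; first exact: differentiable_coord.
apply: Ck_ext (Ck_cst k (v ord0 i) A) => // x _.
by rewrite (@derive_entry _ _ _ id)// derive_id.
Qed.

End CkTheory.

(** * Row vectors: sup norm, matrix inverses, mean value inequality *)

Section RowVectors.
Variable R : realType.

Lemma row_norm_le n (v : 'rV[R]_n) (c : R) : 0 <= c ->
  (forall i, `|v ord0 i| <= c) -> `|v| <= c.
Proof.
move=> c0 H; rewrite [leLHS]/Num.Def.normr/= mx_normrE; apply: bigmax_le => //.
by move=> [i j] _ /=; rewrite (ord1 i).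
Qed.

Lemma row_entry_norm n (v : 'rV[R]_n) i : `|v ord0 i| <= `|v|.
Proof.
rewrite [leRHS]/Num.Def.normr/= mx_normrE.
exact: (le_bigmax _ (fun ij : 'I_1 * 'I_n => `|v ij.1 ij.2|) (ord0, i)).
Qed.

Lemma linear_row_continuous n (W : normedModType R) (f : {linear 'rV[R]_n -> W}) :
  continuous f.
Proof.
move=> x; apply: differentiable_continuous.
have -> : (f : 'rV[R]_n -> W) =
    \sum_(i < n) (fun x : 'rV[R]_n => x ord0 i *: f (delta_mx ord0 i)).
  apply/funext => y; rewrite fct_sumE {1}[y]row_sum_delta linear_sum.
  by apply: eq_bigr => i _; rewrite linearZ.
apply: differentiable_sum => i; apply: differentiableZl.
exact: differentiable_coord.
Qed.

Lemma jacobian_entry m n (f : 'rV[R]_n -> 'rV[R]_m) x j i : differentiable f x ->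
  jacobian f x j i = ('D_(delta_mx ord0 j) f x) ord0 i.
Proof. by move=> df; rewrite deriveEjacobian// -rowE [RHS]mxE. Qed.

Lemma Ck_det (U : normedModType R) n k (M : U -> 'M[R]_n) (A : set U) : open A ->
  (forall i j, Ck k (fun x => M x i j) A) -> Ck k (fun x => \det (M x)) A.
Proof.
move=> oA H; apply: Ck_sum => // s _; apply: CkM => //; first exact: Ck_cst.
exact: Ck_prod.
Qed.

(** Cramer's rule: each entry is a cofactor divided by a determinant that does not vanish on [A]. *)
Lemma Ck_invmx (U : normedModType R) n k (M : U -> 'M[R]_n) (A : set U) : open A ->
  (forall i j, Ck k (fun x => M x i j) A) ->
  (forall x, A x -> M x \in unitmx) ->
  forall i j, Ck k (fun x => invmx (M x) i j) A.
Proof.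
move=> oA H Mu i j.
have K : Ck k (fun x => (\det (M x))^-1 * cofactor (M x) j i) A.
  apply: CkM => //.
    apply: CkV => //; first by move=> x /Mu; rewrite unitmxE unitfE.
    exact: Ck_det.
  apply: CkM => //; first exact: Ck_cst.
  apply: Ck_det => // a b; apply: Ck_ext (H (lift j a) (lift i b)) => // x _.
  by rewrite !mxE.
by apply: Ck_ext K => // x Ax; rewrite /invmx Mu// !mxE.
Qed.

(** The one-variable mean value theorem is applied to each coordinate along the segment from [y] to
    [x], which stays in the ball by convexity. In the sup norm each of the [n] partial derivatives
    contributes at most [c * |x - y|], whence the factor [n]. *)
Lemma derive_segment_bound m n (h : 'rV[R]_n -> 'rV[R]_m) (p : 'rV[R]_n)
    (d c : R) : 0 <= c ->
  (forall x, ball p d x -> differentiable h x) ->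
  (forall x, ball p d x ->
     forall (i : 'I_m) (j : 'I_n), `|('D_(delta_mx ord0 j) h x) ord0 i| <= c) ->
  forall x y, ball p d x -> ball p d y -> `|h x - h y| <= n%:R * c * `|x - y|.
Proof.
move=> c0 dh hc x y px py.
apply: row_norm_le => [|i]; first by rewrite !mulr_ge0.
pose g (t : R) : 'rV[R]_n := t *: (x - y) + y.
have gin (t : R) : 0 <= t <= 1 -> ball p d (g t).
  move=> /andP[t0 t1]; move: px py; rewrite -ball_normE /ball_ /= => px py.
  have -> : p - g t = t *: (p - x) + (1 - t) *: (p - y).
    by apply/rowP => j; rewrite /g !mxE; ring.
  apply: (le_lt_trans (ler_normD _ _)); rewrite !normrZ (ger0_norm t0).
  rewrite ger0_norm ?subr_ge0//; have [->|tn0] := eqVneq t 0.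
    by rewrite mul0r add0r subr0 mul1r.
  have tp : 0 < t by rewrite lt_def tn0.
  have /lt_le_trans : t * `|p - x| + (1 - t) * `|p - y| < t * d + (1 - t) * d.
    by rewrite ltr_leD// ?ltr_pM2l// ler_wpM2l ?subr_ge0// ltW.
  by apply; rewrite -mulrDl addrC subrK mul1r.
have dg t : is_diff t g ( *:%R^~ (x - y)).
  rewrite (_ : g = (fun t : R => t *: (x - y)) + cst y)//.
  by apply: is_diff_eq; rewrite addr0.
pose phi t := h (g t) ord0 i.
pose dphi t := \sum_(j < n) (x - y) ord0 j * ('D_(delta_mx ord0 j) h (g t)) ord0 i.
have Dphi (t : R) : 0 <= t <= 1 -> is_derive t (1 : R) phi (dphi t).
  move=> t01; have dhg : differentiable h (g t) by exact/dh/gin.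
  have dgt : differentiable g t by exact: ex_diff.
  have dc : differentiable (h \o g) t by exact: differentiable_comp.
  apply: DeriveDef.
    by apply: diff_derivable; exact: (differentiable_entry i dc).
  rewrite (derive_entry _ i dc) derive_comp_row// summxE; apply: eq_bigr => j _.
  by rewrite mxE deriveE// diff_val scale1r.
have [||t t01] := @MVT_segment _ phi dphi 0 1 ler01.
- by move=> t; rewrite in_itv /= => /andP[a b]; apply: Dphi; rewrite !ltW.
- apply: derivable_within_continuous => t; rewrite in_itv /= => t01.
  by case: (Dphi t t01).
rewrite subr0 mulr1 /phi /g scale1r subrK scale0r add0r => E.
have -> : (h x - h y) ord0 i = h x ord0 i - h y ord0 i by rewrite !mxE.
rewrite E /dphi; apply: (le_trans (ler_norm_sum _ _ _)).
have sumc (K : R) : n%:R * K = \sum_(j < n) K.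
  by rewrite sumr_const card_ord mulr_natl.
rewrite -mulrA sumc.
apply: ler_sum => j _; rewrite normrM mulrC ler_pM//; last exact: row_entry_norm.
by apply/hc/gin; move: t01; rewrite in_itv.
Qed.

End RowVectors.

(** * The inverse function theorem *)

Section InverseFunction.
Variable R : realType.

Lemma contraction_fixed_point n (p : 'rV[R]_n) (d : R) (T : 'rV[R]_n -> 'rV[R]_n) :
  0 < d ->
  (forall x, `|p - x| <= d -> `|p - T x| <= d) ->
  (forall x y, `|p - x| <= d -> `|p - y| <= d ->
     `|T x - T y| <= 2^-1 * `|x - y|) ->
  exists2 x, `|p - x| <= d & x = T x.
Proof.
move=> d0 TC Tc; pose C : set 'rV[R]_n := closed_ball_ Num.norm p d.
have TCf : set_fun C C T by move=> x; exact: TC.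
pose Tf : {fun C >-> C} := mkfun TCf.
have half0 : (0 : R) <= 2^-1 by rewrite invr_ge0.
pose X : completeNormedModType R := HB.pack 'rV[R]_n.
have [|||x Cx xE] := @banach_fixed_point R X C Tf; last by exists x.
- exists (NngNum half0); split => /=; first by rewrite invf_lt1 ?ltr1n.
  by move=> [x y] /= [Cx Cy]; exact: Tc.
- exact: closed_closed_ball_.
- by exists p; rewrite /C /closed_ball_ /= subrr normr0 ltW.
Qed.

(** With the derivative at [p] normalised to the identity, [h = f - id] has small derivative near
    [p], so [x |-> y - h x] is a contraction whose fixed point solves [f x = y]. The target is kept
    a ball because the level set theorem moves along segments in it, and invertibility of the
    Jacobian on all of [U] is recorded for the rank comparison there. *)
Lemma inverse_function n (f : 'rV[R]_n -> 'rV[R]_n) (A : set 'rV[R]_n)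
    (p : 'rV[R]_n) :
  open A -> A p -> (forall k, Ck k f A) -> (forall v, 'D_v f p = v) ->
  exists (r : R) (U : set 'rV[R]_n) (g : 'rV[R]_n -> 'rV[R]_n),
    [/\ 0 < r, open U, U p & U `<=` A] /\
    [/\ forall k, Ck k g (ball (f p) r),
        forall x, U x -> ball (f p) r (f x) /\ g (f x) = x,
        forall y, ball (f p) r y -> U (g y) /\ f (g y) = y
      & forall x, U x -> jacobian f x \in unitmx].
Proof.
move=> oA Ap Cf Dfp.
have df x : A x -> differentiable f x by have [+ _] := Cf 1%N; apply.
pose h x := f x - x.
have Ch k : Ck k h A.
  have Cid : Ck k (fun x : 'rV[R]_n => x) A.
    by apply: Ck_row => // i; exact: Ck_id_entry.
  apply: Ck_ext (CkD oA (Cf k) (CkZ (-1) oA Cid)) => //.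
  by move=> x _; rewrite scaleN1r.
have dh x : A x -> differentiable h x by have [+ _] := Ch 1%N; apply.
have Dh x v : A x -> 'D_v h x = 'D_v f x - v.
  move=> Ax; rewrite /h.
  have -> : (fun x => f x - x) = f - id by [].
  have dfv : derivable f x v by exact: diff_derivable (df x Ax).
  have div : derivable (id : 'rV[R]_n -> 'rV[R]_n) x v by exact: derivable_id.
  have E := deriveB dfv div.
  by rewrite [LHS]E derive_id.
(* Chosen so that [n * c <= 1/2], the Lipschitz constant wanted for [h]; [n.+1] keeps the
   denominator nonzero when [n = 0]. *)
pose c : R := (2 * n.+1%:R)^-1.
have c0 : 0 < c by rewrite invr_gt0 mulr_gt0.
have nc : n%:R * c <= 2^-1.
  rewrite /c invfM mulrCA -[leRHS]mulr1 ler_wpM2l ?invr_ge0//.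
  by rewrite ler_pdivrMr ?mul1r ?ler_nat.
have [d d0 [dA dc]] : exists2 d : R, 0 < d & ball p d `<=` A /\
    forall x, ball p d x -> forall i j : 'I_n, `|('D_(delta_mx ord0 j) h x) ord0 i| <= c.
  have H1 : \forall x \near p, A x by apply: open_nbhs_nbhs.
  have H2 (i j : 'I_n) : \forall x \near p, `|('D_(delta_mx ord0 j) h x) ord0 i| <= c.
    have /(Ck_entry i oA) : Ck 0 ('D_(delta_mx ord0 j) h) A.
      by case: (Ch 1%N) => _ /(_ (delta_mx ord0 j)).
    move=> /(_ p Ap) /cvgrPdist_le /(_ c c0); apply: filterS => x.
    by rewrite Dh// Dfp subrr mxE sub0r normrN.
  have H3 : \forall x \near p, forall i j : 'I_n,
      `|('D_(delta_mx ord0 j) h x) ord0 i| <= c.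
    have H2' i := filter_forall (nbhs_filter p) (H2 i).
    exact: (filter_forall (nbhs_filter p) H2').
  have H4 : \forall x \near p, A x /\ forall i j : 'I_n,
      `|('D_(delta_mx ord0 j) h x) ord0 i| <= c by exact: filterI.
  have [d d0 Hd] := (nbhs_ballP _ _).1 H4.
  by exists d => //; split=> x /Hd [].
have lip x y : ball p d x -> ball p d y -> `|h x - h y| <= 2^-1 * `|x - y|.
  move=> px py; apply: le_trans (_ : n%:R * c * `|x - y| <= _).
    apply: derive_segment_bound px py => //; first exact: ltW.
    by move=> z /dA; exact: dh.
  by rewrite ler_wpM2r.
have fE x : f x = h x + x by rewrite /h subrK.
(* Since [f = h + id] with [h] 1/2-Lipschitz, [f] shrinks distances by at most a factor 2. This
   gives injectivity, and later the Lipschitz bound for the inverse. *)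
have expand x y : ball p d x -> ball p d y -> `|x - y| <= 2 * `|f x - f y|.
  move=> px py; have /= H := lip x y px py.
  have : `|x - y| <= `|f x - f y| + `|h x - h y|.
    have E : x - y = (f x - f y) - (h x - h y).
      by rewrite !fE; apply/rowP => j; rewrite !mxE; ring.
    by rewrite [in leLHS]E; exact: ler_normB.
  move: H; set a := `|x - y|; set b := `|_|; set e := `|_|; lra.
have bE (q x : 'rV[R]_n) e : ball q e x = (`|q - x| < e) by rewrite -ball_normE.
have d2 : d / 2 < d by rewrite ltr_pdivrMr// ltr_pMr// ltr1n.
have d20 : 0 < d / 2 by rewrite divr_gt0.
(* With this radius [T] sends the closed ball of radius [d / 2] into the open one: the distance to
   [p] is less than [d / 4 + (d / 2) / 2]. *)
pose r := d / 4; have r0 : 0 < r by rewrite divr_gt0.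
have surj y : ball (f p) r y -> exists2 x, ball p (d / 2) x & f x = y.
  rewrite bE => yr; pose T x := y - h x.
  have TC x : `|p - x| <= d / 2 -> `|p - T x| < d / 2.
    move=> px; have px' : ball p d x by rewrite bE (le_lt_trans px).
    have pp : ball p d p by exact: ballxx.
    have -> : p - T x = (f p - y) - (h p - h x).
      by rewrite /T fE; apply/rowP => j; rewrite !mxE; ring.
    apply: (le_lt_trans (ler_normB _ _)).
    have := lip _ _ pp px'; move: yr px; rewrite /r.
    set a := `|_|; set b := `|_|; set e := `|_|; lra.
  have [||x px xE] := @contraction_fixed_point n p (d / 2) T d20.
  - by move=> x /TC /ltW.
  - move=> x z px pz; rewrite distrC.
    have -> : T z - T x = h x - h z by rewrite /T; apply/rowP => j; rewrite !mxE; ring.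
    by apply: lip; rewrite bE; [exact: le_lt_trans px _|exact: le_lt_trans pz _].
  exists x; first by rewrite bE xE; exact: TC.
  by rewrite fE {2}xE /T addrC subrK.
pose U := [set x | ball p (d / 2) x /\ ball (f p) r (f x)].
have Ud x : U x -> ball p d x by rewrite /U /= bE => -[px _]; rewrite bE (lt_trans px).
have UA x : U x -> A x by move=> /Ud /dA.
pose g y := xget p [set x | U x /\ f x = y].
have gP y : ball (f p) r y -> U (g y) /\ f (g y) = y.
  move=> yr; have [x px xE] := surj y yr.
  by have := @xgetPex _ p [set x | U x /\ f x = y]; apply; exists x; rewrite /= /U /= xE.
have fU x : U x -> ball (f p) r (f x) /\ g (f x) = x.
  move=> Ux; have Ux2 := Ux.2; split => //; have [Ug fg] := gP _ Ux2.
  have := expand _ _ (Ud _ Ug) (Ud _ Ux); rewrite fg subrr normr0 mulr0.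
  by rewrite normr_le0 subr_eq0 => /eqP.
have oU : open U.
  rewrite openE => x Ux; rewrite /interior; have [U1 U2] := Ux.
  apply: filterI.
    by apply: open_nbhs_nbhs; split => //; exact: ball_open.
  have cfx : {for x, continuous f} by exact: differentiable_continuous (df _ (UA _ Ux)).
  by apply: cfx; apply: open_nbhs_nbhs; split => //; exact: ball_open.
(* A vector [v] killed by the Jacobian of [f] satisfies ['D_v h x = - v], while the bound on the
   partial derivatives gives [|'D_v h x| <= |v| / 2]; hence [v = 0]. *)
have Ju x : U x -> jacobian f x \in unitmx.
  move=> Ux; have Ax := UA _ Ux; rewrite -row_free_unit -kermx_eq0.
  apply/eqP/row_matrixP => i; rewrite row0; apply/eqP; rewrite -normr_le0.
  set v := row i _; have vJ : v *m jacobian f x = 0.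
    by rewrite /v -row_mul mulmx_ker row0.
  have Dv : 'D_v h x = - v by rewrite Dh// deriveEjacobian ?vJ ?sub0r//; exact: df.
  have : `|'D_v h x| <= 2^-1 * `|v|.
    apply: le_trans (_ : n%:R * c * `|v| <= _); last by rewrite ler_wpM2r.
    have c0' := ltW c0.
    apply: row_norm_le => [|k]; first by rewrite !mulr_ge0.
    have dhx := dh x Ax.
    rewrite (deriveEjacobian v dhx) mxE; apply: (le_trans (ler_norm_sum _ _ _)).
    have sumc (K : R) : n%:R * K = \sum_(j < n) K.
      by rewrite sumr_const card_ord mulr_natl.
    rewrite -mulrA sumc; apply: ler_sum => j _; rewrite normrM mulrC.
    apply: ler_pM => //; last exact: row_entry_norm.
    by rewrite (jacobian_entry j k dhx); apply: dc; exact: Ud.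
  by rewrite Dv normrN; set a := `|_|; lra.
have oB : open (ball (f p) r) by exact: ball_open.
have dg y : ball (f p) r y -> differentiable g y /\
    'd g y = mulmxr (invmx (jacobian f (g y))) :> ('rV[R]_n -> 'rV[R]_n).
  move=> yr; have [Ug fg] := gP y yr; set x := g y; set B := invmx _.
  have cB : continuous (mulmxr B : {linear 'rV[R]_n -> 'rV[R]_n}).
    exact: linear_row_continuous.
  apply: (@differentiable_linear_approx _ _ _ g y _ cB) => e e0.
  have [K K0 HK] : exists2 K : R, 0 < K & forall v : 'rV[R]_n, `|v *m B| <= K * `|v|.
    have [K [K0 HK]] := (linear_boundedP (mulmxr B : {linear 'rV[R]_n -> 'rV[R]_n})).1
       (continuous_linear_bounded 0 (cB 0)).
    exists (`|K| + 1); first by rewrite ltr_wpDl.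
    by move=> v; apply: HK; rewrite (le_lt_trans (ler_norm _))// ltrDl.
  (* [K] bounds multiplication by [B], and the 2 will absorb the Lipschitz constant of [g] coming
     from [expand]. *)
  have e1 : 0 < e / (2 * K) by rewrite divr_gt0// mulr_gt0.
  have /eqaddoP /(_ _ e1) Hx := diff_locally (df _ (UA _ Ug)).
  have Hx' : \forall z \near x, `|f z - f x - 'd f x (z - x)| <= e / (2 * K) * `|z - x|.
    rewrite (near_shift 0) subr0; apply: filterS Hx => z.
    by rewrite !fctE /= opprD addrA addrK.
  have [s s0 Hs] := (nbhs_ballP _ _).1 Hx'.
  have yB : \forall k \near (0 : 'rV[R]_n), ball (f p) r (k + y).
    have : \forall z \near y, ball (f p) r z by apply: open_nbhs_nbhs.
    by rewrite (near_shift 0) subr0.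
  have sB : \forall k \near (0 : 'rV[R]_n), `|k| < s / 2.
    apply/nbhs_ballP; exists (s / 2); first by rewrite /= divr_gt0.
    by move=> k; rewrite bE sub0r normrN.
  move: yB sB; apply: filterS2 => k ky ks.
  have [Ug' fg'] := gP _ ky; set x' := g (k + y) in Ug' fg' *.
  have xx' : `|x' - x| <= 2 * `|k|.
    by apply: le_trans (expand _ _ (Ud _ Ug') (Ud _ Ug)) _; rewrite fg fg' addrK.
  have Bx' : ball x s x'.
    rewrite bE distrC; apply: (le_lt_trans xx').
    by rewrite -ltr_pdivlMl// mulrC.
  have := Hs _ Bx'; rewrite /= fg fg' addrK => H.
  have Jx : 'd f x (x' - x) = (x' - x) *m jacobian f x.
    by rewrite -deriveE; [exact: deriveEjacobian (df _ (UA _ Ug))|exact: df (UA _ Ug)].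
  rewrite Jx in H.
  (* The remainder of [g] at [y] is, up to sign, the remainder of [f] at [x] multiplied by [B]. *)
  have -> : x' - x - mulmxr B k = - ((k - (x' - x) *m jacobian f x) *m B).
    by rewrite mulmxBl mulmxK ?Ju// opprB.
  rewrite normrN; apply: (le_trans (HK _)); apply: (le_trans (ler_wpM2l (ltW K0) H)).
  apply: (le_trans (ler_wpM2l _ (ler_wpM2l _ xx'))); rewrite ?(ltW K0) ?(ltW e1)//.
  by rewrite le_eqVlt; apply/orP; left; apply/eqP; field; rewrite gt_eqF.
have Up : U p by split; exact: ballxx.
exists r, U, g; split; split => //.
(* Bootstrapping: the derivative of [g] is the inverse Jacobian of [f] evaluated along [g], so it
   inherits whatever class [g] is already known to have. *)
elim=> [|k IH].
  by move=> y /dg [dgy _]; exact: differentiable_continuous.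
split=> [y /dg[]//|v].
have gA y : ball (f p) r y -> A (g y) by move=> /gP[/UA].
have Cinv : forall j i, Ck k (fun y => invmx (jacobian f (g y)) j i) (ball (f p) r).
  apply: Ck_invmx => // [j i|y /gP[/Ju]//].
  have CD : Ck k (fun x => ('D_(delta_mx ord0 j) f x) ord0 i) A.
    by have [_ Df] := Cf k.+1; exact: Ck_entry (Df _).
  have := @Ck_comp _ _ _ _ _ g _ _ oB gA CD IH.
  by apply: Ck_ext => // y /gA /df dfy /=; rewrite jacobian_entry.
have CDg : Ck k (fun y => v *m invmx (jacobian f (g y))) (ball (f p) r).
  apply: Ck_row => // i.
  have := @Ck_sum _ _ _ k _ (index_enum 'I_n) xpredT
    (fun j y => v ord0 j * invmx (jacobian f (g y)) j i) _ oB
    (fun j _ => CkM oB (Ck_cst k (v ord0 j : R) _) (Cinv j i)).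
  by apply: Ck_ext => // y _; rewrite mxE.
by apply: Ck_ext CDg => // y /dg[dgy dgE]; rewrite deriveE// dgE.
Qed.

End InverseFunction.

(** * Level sets of maps of constant rank *)

Section LevelSet.
Variable R : realType.

Lemma constant_on_unit_segment m (phi : R -> 'rV[R]_m) :
  (forall t : R, 0 <= t <= 1 -> differentiable phi t /\ 'D_1 phi t = 0) ->
  phi 1 = phi 0.
Proof.
move=> H; apply/rowP => i.
have D (t : R) : 0 <= t <= 1 -> is_derive t (1 : R) (fun s => phi s ord0 i) 0.
  move=> /H[df D0]; apply: DeriveDef.
    by apply: diff_derivable; exact: differentiable_entry.
  by rewrite derive_entry// D0 mxE.
have [||t _] := @MVT_segment R (fun s => phi s ord0 i) (fun=> 0) 0 1 ler01.
- by move=> t; rewrite in_itv /= => /andP[a b]; apply: D; rewrite !ltW.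
- apply: derivable_within_continuous => t; rewrite in_itv /= => /D.
  by case.
by rewrite mul0r => /eqP; rewrite subr_eq0 => /eqP.
Qed.

Lemma derive_mulmxr (U : normedModType R) m n (F : U -> 'rV[R]_m) (Q : 'M[R]_(m, n))
    (x v : U) : differentiable F x ->
  differentiable (fun y => F y *m Q) x /\
  'D_v (fun y => F y *m Q) x = 'D_v F x *m Q.
Proof.
move=> dF; have cQ : continuous (mulmxr Q : 'rV[R]_m -> 'rV[R]_n).
  exact: linear_row_continuous.
have dQ : differentiable (mulmxr Q : 'rV[R]_m -> 'rV[R]_n) (F x).
  exact: linear_differentiable.
have dC : differentiable ((mulmxr Q : 'rV[R]_m -> 'rV[R]_n) \o F) x.
  exact: differentiable_comp.
split; first exact: dC.
have := deriveE v dC; rewrite diff_comp//= diff_lin//= => E.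
by rewrite [LHS]E deriveE.
Qed.

(** The left kernel of [A] lies in that of [A *m B], and the rank hypothesis forces equal
    dimensions. *)
Lemma kermx_ker_eq m n q (A : 'M[R]_(m, n)) (B : 'M[R]_(n, q)) (u : 'rV[R]_m) :
  (\rank A <= \rank (A *m B))%N -> u *m (A *m B) = 0 -> u *m A = 0.
Proof.
move=> AB uAB; have s : (kermx A <= kermx (A *m B))%MS.
  by apply/sub_kermxP; rewrite mulmxA mulmx_ker mul0mx.
have e : (kermx A == kermx (A *m B))%MS.
  by rewrite -mxrank_leqif_eq//; rewrite eqn_leq mxrankS//= !mxrank_ker leq_sub2l.
by apply/sub_kermxP; rewrite (eqmxP e); apply/sub_kermxP.
Qed.

(** [K] embeds the kernel of [T] into the kernel of [J], so the nullity of [J] is at least that of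
    [T]. *)
Lemma rank_le_ker_unitmx m n (T J : 'M[R]_(n, m)) (K : 'M[R]_n) :
  K \in unitmx -> (kermx T *m K <= kermx J)%MS -> (\rank J <= \rank T)%N.
Proof.
move=> Ku /mxrankS; rewrite mxrankMfree ?row_free_unit// !mxrank_ker.
have := rank_leq_row J; have := rank_leq_row T.
move: (\rank T) (\rank J) => a b; lia.
Qed.

(** The invertible [K], which may depend on [x], carries the kernel of [DF] at [p] into the kernel
    at [x]; this says that the rank at [x] does not exceed the rank at [p]. The opposite inequality
    holds on the chart domain because [DPhi *m T = DF *m (Q *m T)] with [DPhi] invertible. *)
Lemma constant_rank_level_set n m (F : 'rV[R]_n -> 'rV[R]_m) (A : set 'rV[R]_n)
    (p : 'rV[R]_n) :
  open A -> A p -> (forall k, Ck k F A) -> F p = 0 ->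
  (forall x, A x -> exists2 K : 'M[R]_n, K \in unitmx &
     forall u, 'D_u F p = 0 -> 'D_(u *m K) F x = 0) ->
  exists (U U' : set 'rV[R]_n) (Phi Psi : 'rV[R]_n -> 'rV[R]_n),
    [/\ U p, open U, open U' & U `<=` A] /\
    [/\ forall k, Ck k Phi U, forall k, Ck k Psi U',
        forall x, U x -> U' (Phi x) /\ Psi (Phi x) = x
      & forall y, U' y -> U (Psi y) /\ Phi (Psi y) = y] /\
    (forall x, U x -> (F x = 0 <-> Phi x *m jacobian F p = 0)).
Proof.
move=> oA Ap CF Fp HK.
have dF x : A x -> differentiable F x by have [+ _] := CF 1%N; apply.
(* [Phi] straightens the part [F Q] of [F] to a linear map. By the kernel
   hypothesis [D F] then has the same rank as [D (F Q T)], hence the same kernel,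
   so that [F \o Psi] is constant along the segments lying in [ker T]. *)
set T := jacobian F p; pose Q := pinvmx T.
have TQT : T *m Q *m T = T by rewrite mulmxKpV.
(* From [T Q T = T], [N] is the projection onto the left kernel of [T] along the image of [T Q].
   Hence the derivative of [Phi] at [p] is [v N + v T Q = v], the normalisation that
   [inverse_function] asks for. *)
pose N := 1%:M - T *m Q.
have Fm q (Z : 'M[R]_(m, q)) k : Ck k (fun x => F x *m Z) A.
  apply: Ck_row => // i.
  have := @Ck_sum _ _ _ k _ (index_enum 'I_m) xpredT
    (fun j y => F y ord0 j * Z j i) _ oA
    (fun j _ => CkM oA (Ck_entry j oA (CF k)) (Ck_cst k (Z j i : R) _)).
  by apply: Ck_ext => // y _; rewrite mxE.
have Lm q (Z : 'M[R]_(n, q)) k : Ck k (fun x : 'rV[R]_n => x *m Z) A.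
  apply: Ck_row => // i.
  have := @Ck_sum _ _ _ k _ (index_enum 'I_n) xpredT
    (fun j (y : 'rV[R]_n) => y ord0 j * Z j i) _ oA
    (fun j _ => CkM oA (Ck_id_entry k j oA) (Ck_cst k (Z j i : R) _)).
  by apply: Ck_ext => // y _; rewrite mxE.
pose Phi x := (x - p) *m N + F x *m Q.
have CPhi k : Ck k Phi A.
  have := CkD oA (CkD oA (Lm _ N k) (Ck_cst k (- (p *m N)) A)) (Fm _ Q k).
  by apply: Ck_ext => // y _; rewrite /Phi mulmxBl.
have DPhi x v : A x -> 'D_v Phi x = v *m N + 'D_v F x *m Q.
  move=> Ax.
  have did : differentiable (id : 'rV[R]_n -> 'rV[R]_n) x by exact: ex_diff.
  have [dl Dl] := derive_mulmxr N v did.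
  have [d2 D2] := @derive_mulmxr _ _ _ F Q x v (dF x Ax).
  have dc : derivable (cst (- (p *m N)) : 'rV[R]_n -> 'rV[R]_n) x v by exact: derivable_cst.
  have -> : Phi = (fun y => id y *m N) + cst (- (p *m N)) + (fun y => F y *m Q).
    by apply/funext => y; rewrite /Phi !fctE /= mulmxBl.
  have dlv : derivable (fun y : 'rV[R]_n => id y *m N) x v by exact: diff_derivable.
  have d2v : derivable (fun y => F y *m Q) x v by exact: diff_derivable.
  have E := deriveD (derivableD dlv dc) d2v.
  rewrite [LHS]E.
  have E2 := deriveD dlv dc.
  by rewrite E2 D2 [X in X + _ + _]Dl derive_id derive_cst addr0.
have DP v : 'D_v Phi p = v.
  rewrite DPhi// deriveEjacobian; last exact: dF.
  by rewrite /N mulmxBr mulmx1 -mulmxA subrK.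
have Phip : Phi p = 0 by rewrite /Phi subrr Fp !mul0mx addr0.
have [r [U [Psi [[r0 oU Up UA] [CPsi fU gB Ju]]]]] :=
  inverse_function oA Ap CPhi DP.
rewrite Phip in CPsi fU gB.
have NT : N *m T = 0 by rewrite /N mulmxBl mul1mx TQT subrr.
have PhiT x : A x -> jacobian Phi x *m T = jacobian F x *m (Q *m T).
  move=> Ax; apply/row_matrixP => i.
  have dPx : differentiable Phi x by have [+ _] := CPhi 1%N; apply.
  rewrite !row_mul !rowE -deriveEjacobian// DPhi// deriveEjacobian; last exact: dF.
  by rewrite mulmxDl -!mulmxA NT mulmx0 add0r.
exists U, (ball 0 r), Phi, Psi; split; first by split => //; exact: ball_open.
have CPU k : Ck k Phi U by apply: Ck_sub (CPhi k).
split; first by split.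
have oB : open (ball (0 : 'rV[R]_n) r) by exact: ball_open.
move=> x Ux; split=> [Fx|PT].
  by rewrite /Phi Fx mul0mx addr0 -mulmxA NT mulmx0.
have [By gx] := fU _ Ux; set y := Phi x in PT By gx.
pose s (t : R) := t *: y.
have sB (t : R) : 0 <= t <= 1 -> ball (0 : 'rV[R]_n) r (s t).
  move=> /andP[t0 t1]; move: By; rewrite -!ball_normE /ball_ /= !sub0r !normrN.
  by apply: le_lt_trans; rewrite normrZ ger0_norm// ler_piMl.
have -> : 0 = F (Psi (s 0)).
  by rewrite /s scale0r -Fp -Phip; have [_ ->] := fU _ Up.
have -> : x = Psi (s 1) by rewrite /s scale1r gx.
apply: (@constant_on_unit_segment m (fun t => F (Psi (s t)))) => t t01.
have st := sB t t01; have [Uz Pz] := gB _ st; set z := Psi (s t) in Uz Pz.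
have Az := UA _ Uz.
have ds : is_diff t s ( *:%R^~ y) by exact: is_diff_scalel.
have dPsi : differentiable Psi (s t) by have [+ _] := CPsi 1%N; apply.
have dPs : differentiable (Psi \o s) t by apply: differentiable_comp.
have dFz := dF _ Az.
have dFPs : differentiable (F \o (Psi \o s)) t by apply: differentiable_comp.
split; first exact: dFPs.
set u := 'D_1 (Psi \o s) t.
have DF : 'D_1 (F \o (Psi \o s)) t = u *m jacobian F z.
  rewrite deriveE// diff_comp//= -deriveEjacobian// deriveE// /u deriveE//.
rewrite [LHS]DF.
have dPhiz : differentiable Phi z by have [+ _] := CPhi 1%N; apply.
have uy : u *m jacobian Phi z = y.
  rewrite -deriveEjacobian// deriveE// /u deriveE//.
  have -> : 'd Phi z ('d (Psi \o s) t 1) = 'd (Phi \o (Psi \o s)) t 1.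
    by rewrite [in RHS]diff_comp.
  rewrite -deriveE; last by apply: differentiable_comp.
  have cs : {for t, continuous s} by exact: differentiable_continuous.
  have eqs : \forall w \near t, (Phi \o (Psi \o s)) w = s w.
    have : \forall w \near t, ball (0 : 'rV[R]_n) r (s w).
      by apply: cs; apply: open_nbhs_nbhs.
    by apply: filterS => w /gB[].
  by rewrite (near_eq_derive _ eqs) deriveE// diff_val scale1r.
(* After multiplication by [Q *m T] the velocity becomes [u *m jacobian Phi z *m T = y *m T = 0];
   the rank comparison below lets this factor be cancelled. *)
apply: (kermx_ker_eq (B := Q *m T)); last first.
  by rewrite -PhiT// mulmxA uy.
rewrite -PhiT//.
have [K Ku HKz] := HK z Az.
have sK : (kermx T *m K <= kermx (jacobian F z))%MS.
  apply/sub_kermxP; apply/row_matrixP => i; rewrite row0 row_mul -deriveEjacobian//.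
  rewrite row_mul; apply: HKz; rewrite deriveEjacobian; last exact: dF.
  by rewrite -row_mul mulmx_ker row0.
have JT : \rank (jacobian Phi z *m T) = \rank T.
  have Jf : row_full (jacobian Phi z) by rewrite row_full_unit; exact: Ju.
  exact: (eqmxMfull T Jf).1.
by rewrite JT; exact: rank_le_ker_unitmx Ku sK.
Qed.

End LevelSet.

(** * Smooth maps and curves in finite-dimensional spaces *)

Section Coordinates.
Variable R : realType.
Implicit Types V W : vectType R.

Definition vcoord V (v : V) i : R := v2r v ord0 i.
Definition vbase V (i : 'I_(dim V)) : V := r2v (delta_mx ord0 i).
Arguments vbase : clear implicits.

Lemma vcoordE V (v : V) : v = \sum_i vcoord v i *: vbase V i.
Proof.
rewrite -[LHS]v2rK [v2r v]row_sum_delta linear_sum.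
by apply: eq_bigr => i _; rewrite linearZ.
Qed.

Lemma vcoord_linear V i : linear (fun v : V => vcoord v i : R^o).
Proof. by move=> k u v; rewrite /vcoord linearP !mxE. Qed.

Lemma vcoordD V (u v : V) i : vcoord (u + v) i = vcoord u i + vcoord v i.
Proof. by rewrite /vcoord linearD mxE. Qed.

Lemma vcoordN V (u : V) i : vcoord (- u) i = - vcoord u i.
Proof. by rewrite /vcoord linearN mxE. Qed.

Lemma vcoordZ V (k : R) (u : V) i : vcoord (k *: u) i = k * vcoord u i.
Proof. by rewrite /vcoord linearZ mxE. Qed.

Lemma vcoord0 V i : vcoord (0 : V) i = 0.
Proof. by rewrite /vcoord linear0 mxE. Qed.

Lemma vcoord_sum V (I : Type) (r : seq I) (P : pred I) (F : I -> V) i :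
  vcoord (\sum_(j <- r | P j) F j) i = \sum_(j <- r | P j) vcoord (F j) i.
Proof. by rewrite /vcoord linear_sum summxE. Qed.

Lemma vcoordP V (u v : V) : (forall i, vcoord u i = vcoord v i) -> u = v.
Proof. by move=> H; apply: (can_inj v2rK); apply/rowP => i; exact: H. Qed.

(** This and the following facts take the predicate [linear] rather than a bundled map, so that they
    apply directly to abstractions such as [b ^~ y]. *)
Lemma linear_funD V W (f : V -> W) : linear f -> forall u v, f (u + v) = f u + f v.
Proof. by move=> lf u v; have := lf 1 u v; rewrite !scale1r. Qed.

Lemma linear_fun0 V W (f : V -> W) : linear f -> f 0 = 0.
Proof. by move=> lf; have := lf (-1) 0 0; rewrite scaler0 addr0 scaleN1r addNr. Qed.

Lemma linear_funZ V W (f : V -> W) : linear f -> forall k u, f (k *: u) = k *: f u.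
Proof. by move=> lf k u; have := lf k u 0; rewrite !addr0 (linear_fun0 lf) addr0. Qed.

Lemma linear_fun_sum V W (f : V -> W) (I : Type) (r : seq I) (P : pred I)
    (F : I -> V) : linear f ->
  f (\sum_(j <- r | P j) F j) = \sum_(j <- r | P j) f (F j).
Proof.
move=> lf; elim/big_rec2: _ => [|i y x _ <-]; first exact: linear_fun0.
by rewrite linear_funD.
Qed.

Lemma linear_fun_coord V W (f : V -> W) v : linear f ->
  f v = \sum_i vcoord v i *: f (vbase V i).
Proof.
move=> lf; rewrite {1}[v]vcoordE linear_fun_sum//.
by apply: eq_bigr => i _; rewrite linear_funZ.
Qed.

Lemma bilinear_fun_coord V1 V2 W (b : V1 -> V2 -> W) u v :
  (forall x, linear (b x)) -> (forall y, linear (b ^~ y)) ->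
  b u v = \sum_i \sum_j (vcoord u i * vcoord v j) *: b (vbase V1 i) (vbase V2 j).
Proof.
move=> br bl; rewrite (linear_fun_coord (f := b ^~ v))//.
apply: eq_bigr => i _; rewrite (linear_fun_coord v (br _)) scaler_sumr.
by apply: eq_bigr => j _; rewrite scalerA.
Qed.

End Coordinates.
Arguments vbase {R} V i.

(** * Smooth maps between finite-dimensional vector spaces *)

Section SmoothMaps.
Variable R : realType.
Implicit Types V W Z : vectType R.

Definition smooth_scalar V (U : set V) (f : V -> R) : Prop :=
  forall k, Ck k (fun x : 'rV[R]_(dim V) => f (r2v x)) [set x | U (r2v x)].

Lemma smooth_scalar_cst V (U : set V) (c : R) : smooth_scalar U (fun=> c).
Proof. by move=> k; exact: Ck_cst. Qed.

Lemma smooth_scalarM V (U : set V) f g : vopen U ->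
  smooth_scalar U f -> smooth_scalar U g -> smooth_scalar U (fun x => f x * g x).
Proof. by move=> oU Hf Hg k; exact: CkM. Qed.

Lemma smooth_scalar_sum V (U : set V) (I : finType) (f : I -> V -> R) : vopen U ->
  (forall i, smooth_scalar U (f i)) -> smooth_scalar U (fun x => \sum_i f i x).
Proof. by move=> oU H k; apply: Ck_sum => // i _; exact: H. Qed.

Lemma smooth_scalar_coord V (U : set V) i : vopen U ->
  smooth_scalar U (fun x => vcoord x i).
Proof.
move=> oU k; apply: Ck_ext (Ck_id_entry k i oU) => // x _.
by rewrite /vcoord r2vK.
Qed.

Lemma smooth_onP V W (U : set V) (f : V -> W) : vopen U ->
  smooth_on U f <-> forall i, smooth_scalar U (fun x => vcoord (f x) i).
Proof.
move=> oU; split=> [H i k|H k]; first exact: (Ck_entry i oU (H k)).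
by apply: Ck_row => // i; exact: H.
Qed.

Lemma smooth_scalar_linear V W (U : set V) (f : V -> W) (phi : W -> R^o) :
  vopen U -> linear phi -> smooth_on U f -> smooth_scalar U (fun x => phi (f x)).
Proof.
move=> oU lphi /(smooth_onP _ oU) H.
have : smooth_scalar U (fun x => \sum_i vcoord (f x) i * phi (vbase W i)).
  apply: smooth_scalar_sum => // i; apply: smooth_scalarM => //.
  exact: smooth_scalar_cst.
by move=> K k; apply: Ck_ext (K k) => // x _; rewrite (linear_fun_coord (f _) lphi).
Qed.

Lemma smooth_on_ext V W (U : set V) (f g : V -> W) : vopen U ->
  (forall x, U x -> f x = g x) -> smooth_on U f -> smooth_on U g.
Proof. by move=> oU fg H k; apply: Ck_ext (H k) => // x Ux; rewrite fg. Qed.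

Lemma smooth_on_sub V W (U U' : set V) (f : V -> W) :
  U `<=` U' -> smooth_on U' f -> smooth_on U f.
Proof. by move=> UU H k; apply: Ck_sub (H k) => x; exact: UU. Qed.

Lemma smooth_on_sumZ V W (U : set V) (I : finType) (a : I -> V -> R)
    (w : I -> W) : vopen U ->
  (forall i, smooth_scalar U (a i)) -> smooth_on U (fun x => \sum_i a i x *: w i).
Proof.
move=> oU H; apply/smooth_onP => // j.
have : smooth_scalar U (fun x => \sum_i a i x * vcoord (w i) j).
  apply: smooth_scalar_sum => // i; apply: smooth_scalarM => //.
  exact: smooth_scalar_cst.
move=> K k; apply: Ck_ext (K k) => // x _; rewrite vcoord_sum.
by apply: eq_bigr => i _; rewrite vcoordZ.
Qed.

Lemma smooth_on_linear V W Z (U : set V) (f : V -> W) (h : W -> Z) : vopen U ->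
  linear h -> smooth_on U f -> smooth_on U (fun x => h (f x)).
Proof.
move=> oU lh /(smooth_onP _ oU) H.
apply: smooth_on_ext (smooth_on_sumZ (fun i => h (vbase W i)) oU H) => // x _.
by rewrite -linear_fun_coord.
Qed.

Lemma smooth_on_id V (U : set V) : vopen U -> smooth_on U id.
Proof. by move=> oU; apply/smooth_onP => // i; exact: smooth_scalar_coord. Qed.

Lemma smooth_on_cst V W (U : set V) (w : W) : smooth_on U (fun=> w).
Proof. by move=> k; exact: Ck_cst. Qed.

Lemma smooth_onD V W (U : set V) (f g : V -> W) : vopen U ->
  smooth_on U f -> smooth_on U g -> smooth_on U (fun x => f x + g x).
Proof.
move=> oU Hf Hg k; apply: Ck_ext (CkD oU (Hf k) (Hg k)) => // x _.
by rewrite linearD.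
Qed.

Lemma smooth_onN V W (U : set V) (f : V -> W) : vopen U ->
  smooth_on U f -> smooth_on U (fun x => - f x).
Proof.
by move=> oU; apply: (smooth_on_linear (h := -%R)) => // k u v; rewrite linearP.
Qed.

(** In bases [b (f x) (g x)] is a finite sum of products of coordinates with constant vectors.
    Evaluation and composition of linear maps are the instances used throughout. *)
Lemma smooth_on_bilinear V W1 W2 Z (U : set V) (f : V -> W1) (g : V -> W2)
    (b : W1 -> W2 -> Z) : vopen U ->
  (forall x, linear (b x)) -> (forall y, linear (b ^~ y)) ->
  smooth_on U f -> smooth_on U g -> smooth_on U (fun x => b (f x) (g x)).
Proof.
move=> oU br bl /(smooth_onP _ oU) Hf /(smooth_onP _ oU) Hg.
have := @smooth_on_sumZ V Z U _ (fun ij x => vcoord (f x) ij.1 * vcoord (g x) ij.2)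
  (fun ij => b (vbase W1 ij.1) (vbase W2 ij.2)) oU
  (fun ij => smooth_scalarM oU (Hf ij.1) (Hg ij.2)).
apply: smooth_on_ext => // x _.
by rewrite (bilinear_fun_coord _ _ br bl) pair_bigA.
Qed.

Lemma smooth_on_comp V W Z (U : set V) (U' : set W) (f : V -> W) (h : W -> Z) :
  vopen U -> vopen U' -> (forall x, U x -> U' (f x)) ->
  smooth_on U' h -> smooth_on U f -> smooth_on U (fun x => h (f x)).
Proof.
move=> oU oU' UU Hh Hf k.
have fU x : U (r2v x) -> U' (r2v (v2r (f (r2v x)))) by rewrite v2rK; exact: UU.
have := @Ck_comp_row _ _ _ _ k _ _ _ _ oU oU' fU (Hh k) (Hf k).
by apply: Ck_ext => // x _ /=; rewrite v2rK.
Qed.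

Lemma vopenT V : vopen (setT : set V).
Proof. exact: openT. Qed.

Lemma vopen_preimage V W (U : set W) (f : V -> W) : vopen U ->
  smooth_on setT f -> vopen [set x | U (f x)].
Proof.
move=> oU Hf; rewrite /vopen.
have cf : continuous (fun x : 'rV[R]_(dim V) => v2r (f (r2v x))).
  by move=> x; exact: (Hf 0%N).
rewrite (_ : [set x | _] = (fun x : 'rV[R]_(dim V) => v2r (f (r2v x))) @^-1`
   [set x | U (r2v x)]).
  by apply: open_comp => // x _; exact: cf.
by apply/seteqP; split=> x /=; rewrite v2rK.
Qed.

Lemma vopen_neq0 V (phi : V -> R) : smooth_scalar setT phi ->
  vopen [set x | phi x != 0].
Proof.
move=> Hf; rewrite /vopen.
have cf : continuous (fun x : 'rV[R]_(dim V) => phi (r2v x)).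
  by move=> x; exact: (Hf 0%N).
rewrite (_ : [set x | _] = (fun x : 'rV[R]_(dim V) => phi (r2v x)) @^-1`
   [set x | x != 0]).
  by apply: open_comp => [x _|]; [exact: cf|exact: open_neq].
by [].
Qed.

Lemma smooth_on_pair V W1 W2 (U : set V) (f : V -> W1) (g : V -> W2) : vopen U ->
  smooth_on U f -> smooth_on U g -> smooth_on U (fun x => (f x, g x)).
Proof.
move=> oU Hf Hg.
have H1 : smooth_on U (fun x => (f x, 0 : W2)).
  apply: (smooth_on_linear (h := fun w => (w, 0 : W2))) => // k u v.
  by congr pair; rewrite /= scaler0 addr0.
have H2 : smooth_on U (fun x => (0 : W1, g x)).
  apply: (smooth_on_linear (h := fun w => (0 : W1, w))) => // k u v.
  by congr pair; rewrite /= scaler0 addr0.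
apply: smooth_on_ext (smooth_onD oU H1 H2) => // x _.
by congr pair; rewrite /= ?addr0 ?add0r.
Qed.

Lemma smooth_on_fst V W1 W2 (U : set V) (f : V -> W1 * W2) : vopen U ->
  smooth_on U f -> smooth_on U (fun x => (f x).1).
Proof. by move=> oU; exact: smooth_on_linear. Qed.

Lemma smooth_on_snd V W1 W2 (U : set V) (f : V -> W1 * W2) : vopen U ->
  smooth_on U f -> smooth_on U (fun x => (f x).2).
Proof. by move=> oU; exact: smooth_on_linear. Qed.

Lemma smooth_on_app V W Z (U : set V) (f : V -> 'Hom(W, Z)) (g : V -> W) :
  vopen U -> smooth_on U f -> smooth_on U g -> smooth_on U (fun x => f x (g x)).
Proof.
move=> oU; apply: (smooth_on_bilinear (b := fun (h : 'Hom(W, Z)) w => h w)) => //.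
  by move=> h k u v; rewrite linearP.
by move=> w k h1 h2; rewrite add_lfunE scale_lfunE.
Qed.

Lemma smooth_on_comp_lfun V W1 W2 W3 (U : set V) (f : V -> 'Hom(W2, W3))
    (g : V -> 'Hom(W1, W2)) :
  vopen U -> smooth_on U f -> smooth_on U g ->
  smooth_on U (fun x => (f x \o g x)%VF).
Proof.
move=> oU; apply: (smooth_on_bilinear (b := @comp_lfun R W1 W2 W3)) => //.
  by move=> h k u v; rewrite comp_lfunDr comp_lfunZr.
by move=> w k h1 h2; rewrite comp_lfunDl comp_lfunZl.
Qed.

(** The rank-one map [z] tensor the [i]-th dual basis vector. A linear map is the sum of these over
    its values on a basis, so smoothness and derivatives in a Hom space can be checked by evaluating
    at fixed vectors. *)
Definition unit_lfun W Z (i : 'I_(dim W)) (z : Z) : 'Hom(W, Z) :=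
  linfun (fun w => vcoord w i *: z).

Lemma unit_lfunE W Z i (z : Z) (w : W) : unit_lfun i z w = vcoord w i *: z.
Proof.
have lin : linear (fun w : W => vcoord w i *: z).
  by move=> k u v; rewrite vcoordD vcoordZ scalerDl scalerA.
pose h := GRing.isLinear.Build _ _ _ _ (fun w : W => vcoord w i *: z) lin.
pose F : {linear W -> Z} := HB.pack (fun w : W => vcoord w i *: z) h.
exact: (lfunE F).
Qed.

Lemma lfun_unitE W Z (f : 'Hom(W, Z)) : f = \sum_i unit_lfun i (f (vbase W i)).
Proof.
apply/lfunP => w; rewrite sum_lfunE {1}[w]vcoordE linear_sum.
by apply: eq_bigr => i _; rewrite linearZ unit_lfunE.
Qed.

Lemma smooth_on_sum V W (U : set V) (I : finType) (f : I -> V -> W) : vopen U ->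
  (forall i, smooth_on U (f i)) -> smooth_on U (fun x => \sum_i f i x).
Proof.
move=> oU H; apply/smooth_onP => // j.
have : smooth_scalar U (fun x => \sum_i vcoord (f i x) j).
  by apply: smooth_scalar_sum => // i; move: j; apply/smooth_onP.
by move=> K k; apply: Ck_ext (K k) => // x _; rewrite vcoord_sum.
Qed.

Lemma smooth_on_lfun V W Z (U : set V) (f : V -> 'Hom(W, Z)) : vopen U ->
  (forall w, smooth_on U (fun x => f x w)) -> smooth_on U f.
Proof.
move=> oU H.
have K : smooth_on U (fun x => \sum_i unit_lfun i (f x (vbase W i))).
  apply: smooth_on_sum => // i.
  apply: (smooth_on_linear (h := fun z => unit_lfun i z)) => // k u v.
  apply/lfunP => w; rewrite add_lfunE scale_lfunE !unit_lfunE.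
  by rewrite scalerDr !scalerA mulrC.
by apply: smooth_on_ext K => // x _; rewrite -lfun_unitE.
Qed.

End SmoothMaps.

(** * Invertible endomorphisms: openness, smoothness of inversion *)

Section LfunMatrix.
Variable R : realType.
Implicit Types V W : vectType R.

(** The matrix acting on row vectors from the right. The determinant makes invertibility an open
    condition, and Cramer's rule makes inversion smooth. *)
Definition end_mx V (f : 'End(V)) : 'M[R]_(dim V) :=
  \matrix_(i, j) vcoord (f (vbase V i)) j.

Lemma end_mxE V (f : 'End(V)) v : v2r (f v) = v2r v *m end_mx f.
Proof.
apply/rowP => j; rewrite mxE -[LHS]/(vcoord (f v) j) {1}[v]vcoordE linear_sum.
by rewrite vcoord_sum; apply: eq_bigr => i _; rewrite linearZ vcoordZ mxE.
Qed.

Lemma vcoord_base V i j : vcoord (vbase V i) j = (i == j)%:R.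
Proof. by rewrite /vcoord r2vK mxE eqxx eq_sym. Qed.

Lemma end_mx_unit V (f : 'End(V)) : (end_mx f \in unitmx) = (lker f == 0%VS).
Proof.
apply/idP/idP => [fu|f0].
  apply/lker0P => u v E; apply: (can_inj v2rK).
  by rewrite -[LHS](mulmxK fu) -[RHS](mulmxK fu) -!end_mxE E.
have E : end_mx f *m end_mx (f^-1)%VF = 1%:M.
  apply/row_matrixP => i; rewrite row_mul row1.
  have -> : row i (end_mx f) = v2r (f (vbase V i)).
    by apply/rowP => j; rewrite !mxE.
  by rewrite -end_mxE lker0_lfunK// r2vK.
by have [] := mulmx1_unit E.
Qed.

Lemma end_mx_inv V (f : 'End(V)) : lker f == 0%VS ->
  end_mx (f^-1)%VF = invmx (end_mx f).
Proof.
move=> f0; have fu : end_mx f \in unitmx by rewrite end_mx_unit.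
apply: (can_inj (mulKmx fu)); rewrite mulmxV//.
apply/row_matrixP => i; rewrite row_mul row1.
have -> : row i (end_mx f) = v2r (f (vbase V i)) by apply/rowP => j; rewrite !mxE.
by rewrite -end_mxE lker0_lfunK// r2vK.
Qed.

Lemma smooth_end_mx V W (U : set V) (f : V -> 'End(W)) i j : vopen U ->
  smooth_on U f -> smooth_scalar U (fun x => end_mx (f x) i j).
Proof.
move=> oU Hf.
have := @smooth_scalar_linear R V W U (fun x => f x (vbase W i))
  (fun w => vcoord w j) oU (vcoord_linear j).
move=> /(_ (smooth_on_app oU Hf (smooth_on_cst _ _))) H k.
by apply: Ck_ext (H k) => // x _; rewrite mxE.
Qed.

Lemma vopen_lker0 V W (f : V -> 'End(W)) : smooth_on setT f ->
  vopen [set x | lker (f x) == 0%VS].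
Proof.
move=> Hf; have : vopen [set x | \det (end_mx (f x)) != 0].
  apply: vopen_neq0 => k; apply: Ck_det; first exact: vopenT.
  by move=> i j; exact: (smooth_end_mx i j (@vopenT _ _) Hf).
by congr vopen; apply/seteqP; split => x; rewrite /= -unitfE -unitmxE end_mx_unit.
Qed.

Lemma smooth_on_inv_lfun V W (U : set V) (f : V -> 'End(W)) : vopen U ->
  (forall x, U x -> lker (f x) == 0%VS) ->
  smooth_on U f -> smooth_on U (fun x => (f x)^-1%VF).
Proof.
move=> oU f0 Hf; apply: smooth_on_lfun => // w.
apply/smooth_onP => // j.
have : smooth_scalar U (fun x => \sum_i vcoord w i * invmx (end_mx (f x)) i j).
  apply: smooth_scalar_sum => // i; apply: smooth_scalarM => //.
    exact: smooth_scalar_cst.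
  move=> k; apply: Ck_invmx => // [i' j'|x /f0].
    exact: (smooth_end_mx i' j' oU Hf).
  by rewrite end_mx_unit.
move=> H k; apply: Ck_ext (H k) => // x Ux.
by rewrite /vcoord end_mxE end_mx_inv ?f0// mxE.
Qed.

Lemma lker0_bijective V (f : 'End(V)) : bijective f <-> lker f == 0%VS.
Proof.
split=> [[h fK _]|f0]; first by apply/lker0P; exact: can_inj fK.
by exists (f^-1)%VF; [exact: lker0_lfunK|exact: lker0_lfunVK].
Qed.

End LfunMatrix.

(** * Derivatives of curves *)

Section CurveDerivatives.
Variable R : realType.
Implicit Types V W Z : vectType R.

Lemma is_vderiveP V (c : R -> V) t v :
  is_vderive c t v <->
  forall i, is_derive t (1 : R) (fun s => vcoord (c s) i) (vcoord v i).
Proof.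
split=> [[dc Dc] i|H].
  apply: DeriveDef; first by have /derivable_mxP := dc; exact.
  have := derive_mx dc; rewrite Dc => /rowP /(_ i) E.
  by rewrite /vcoord E mxE.
have dc : derivable (fun s => v2r (c s)) t 1.
  by apply/derivable_mxP => i j; rewrite (ord1 i); case: (H j).
apply: DeriveDef => //; rewrite derive_mx//; apply/rowP => j; rewrite mxE.
by case: (H j).
Qed.

Lemma is_vderive_unique V (c : R -> V) t v w :
  is_vderive c t v -> is_vderive c t w -> v = w.
Proof. by move=> [_ E1] [_ E2]; apply: (can_inj v2rK); rewrite -E1. Qed.

Lemma is_vderive_eq V (c : R -> V) t v w :
  is_vderive c t v -> v = w -> is_vderive c t w.
Proof. by move=> ? <-. Qed.

Lemma is_vderive_cst V (w : V) t : is_vderive (fun=> w) t 0.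
Proof. by apply/is_vderiveP => i; rewrite vcoord0; exact: is_derive_cst. Qed.

Lemma is_vderive_ext V (c c' : R -> V) t v : c =1 c' ->
  is_vderive c t v -> is_vderive c' t v.
Proof. by move=> /funext ->. Qed.

Lemma is_vderive_near V (c c' : R -> V) t v : (\near t, c t = c' t) ->
  is_vderive c t v -> is_vderive c' t v.
Proof.
move=> H; apply: near_eq_is_derive.
by apply: filterS H => s ->.
Qed.

Lemma is_derive_bigsum (I : Type) (r : seq I) (f : I -> R -> R) (df : I -> R) t :
  (forall i, is_derive t (1 : R) (f i) (df i)) ->
  is_derive t (1 : R) (fun s => \sum_(i <- r) f i s) (\sum_(i <- r) df i).
Proof.
move=> H; elim: r => [|i r IH].
  rewrite big_nil (_ : (fun _ => _) = cst 0); first exact: is_derive_cst.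
  by apply/funext => s; rewrite big_nil.
rewrite big_cons (_ : (fun _ => _) = f i + (fun s => \sum_(i <- r) f i s)).
  exact: is_deriveD.
by apply/funext => s; rewrite big_cons.
Qed.

Lemma is_vderive_sumZ V (I : Type) (r : seq I) (a : I -> R -> R) (da : I -> R)
    (w : I -> V) t :
  (forall i, is_derive t (1 : R) (a i) (da i)) ->
  is_vderive (fun s => \sum_(i <- r) a i s *: w i) t (\sum_(i <- r) da i *: w i).
Proof.
move=> H; apply/is_vderiveP => j; rewrite vcoord_sum.
rewrite (_ : (fun _ => _) = fun s => \sum_(i <- r) vcoord (w i) j * a i s).
  rewrite (eq_bigr (fun i => vcoord (w i) j * da i)); last first.
    by move=> i _; rewrite vcoordZ mulrC.
  by apply: is_derive_bigsum => i; exact: is_deriveZ.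
apply/funext => s; rewrite vcoord_sum; apply: eq_bigr => i _.
by rewrite vcoordZ mulrC.
Qed.

Lemma is_vderive_linear V W (f : V -> W) c t v : linear f ->
  is_vderive c t v -> is_vderive (fun s => f (c s)) t (f v).
Proof.
move=> lf /is_vderiveP H.
rewrite (linear_fun_coord v lf) (_ : (fun _ => _) =
   fun s => \sum_i vcoord (c s) i *: f (vbase V i)); first exact: is_vderive_sumZ.
by apply/funext => s; exact: linear_fun_coord.
Qed.

Lemma is_vderive_bilinear V1 V2 W (b : V1 -> V2 -> W) c1 c2 t v1 v2 :
  (forall x, linear (b x)) -> (forall y, linear (b ^~ y)) ->
  is_vderive c1 t v1 -> is_vderive c2 t v2 ->
  is_vderive (fun s => b (c1 s) (c2 s)) t (b v1 (c2 t) + b (c1 t) v2).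
Proof.
move=> br bl /is_vderiveP H1 /is_vderiveP H2.
have E u v : b u v = \sum_ij (vcoord u ij.1 * vcoord v ij.2) *:
    b (vbase V1 ij.1) (vbase V2 ij.2).
  by rewrite (bilinear_fun_coord _ _ br bl) pair_bigA.
have -> : b v1 (c2 t) + b (c1 t) v2 = \sum_ij
   (vcoord (c1 t) ij.1 *: vcoord v2 ij.2 + vcoord (c2 t) ij.2 *: vcoord v1 ij.1) *:
    b (vbase V1 ij.1) (vbase V2 ij.2).
  rewrite !E -big_split; apply: eq_bigr => ij _ /=.
  by rewrite -scalerDl addrC [X in _ + X]mulrC.
have -> : (fun s => b (c1 s) (c2 s)) = fun s =>
  \sum_ij (vcoord (c1 s) ij.1 * vcoord (c2 s) ij.2) *:
    b (vbase V1 ij.1) (vbase V2 ij.2) by apply/funext => s; exact: E.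
apply: is_vderive_sumZ => ij.
exact: is_deriveM.
Qed.

Lemma is_vderiveD V (c1 c2 : R -> V) t v1 v2 :
  is_vderive c1 t v1 -> is_vderive c2 t v2 ->
  is_vderive (fun s => c1 s + c2 s) t (v1 + v2).
Proof.
move=> /is_vderiveP H1 /is_vderiveP H2; apply/is_vderiveP => i.
rewrite vcoordD (_ : (fun _ => _) =
  (fun s => vcoord (c1 s) i) + (fun s => vcoord (c2 s) i)); first exact: is_deriveD.
by apply/funext => s; rewrite vcoordD.
Qed.

Lemma is_vderiveN V (c : R -> V) t v :
  is_vderive c t v -> is_vderive (fun s => - c s) t (- v).
Proof. by apply: is_vderive_linear => k u w; rewrite linearP. Qed.

Lemma is_vderiveB V (c1 c2 : R -> V) t v1 v2 :
  is_vderive c1 t v1 -> is_vderive c2 t v2 ->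
  is_vderive (fun s => c1 s - c2 s) t (v1 - v2).
Proof. by move=> H1 /is_vderiveN; exact: is_vderiveD. Qed.

Lemma is_vderive_id V (v : V) t : is_vderive (fun s => s *: v) t v.
Proof.
apply/is_vderiveP => i; rewrite (_ : (fun _ => _) = (fun s : R => vcoord v i *: id s)).
  by apply: is_derive_eq; rewrite scaler1.
by apply/funext => s; rewrite vcoordZ mulrC.
Qed.

Lemma is_vderive_app V W (f : R -> 'Hom(V, W)) c t df v :
  is_vderive f t df -> is_vderive c t v ->
  is_vderive (fun s => f s (c s)) t (df (c t) + f t v).
Proof.
apply: (is_vderive_bilinear (b := fun (h : 'Hom(V, W)) w => h w)).
  by move=> h k u w; rewrite linearP.
by move=> w k h1 h2; rewrite add_lfunE scale_lfunE.
Qed.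

Lemma is_vderive_app1 V W (f : R -> 'Hom(V, W)) (w : V) t df :
  is_vderive f t df -> is_vderive (fun s => f s w) t (df w).
Proof.
move=> Hf; apply: is_vderive_eq (is_vderive_app Hf (is_vderive_cst w t)) _.
by rewrite linear0 addr0.
Qed.

Lemma is_vderive_lfun V W (f : 'Hom(V, W)) c t v :
  is_vderive c t v -> is_vderive (fun s => f (c s)) t (f v).
Proof. by apply: is_vderive_linear => k u w; rewrite linearP. Qed.

Lemma is_vderive_comp V W Z (f : R -> 'Hom(W, Z)) (h : R -> 'Hom(V, W)) t df dh :
  is_vderive f t df -> is_vderive h t dh ->
  is_vderive (fun s => (f s \o h s)%VF) t ((df \o h t) + (f t \o dh))%VF.
Proof.
apply: (is_vderive_bilinear (b := @comp_lfun R V W Z)).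
  by move=> k a u w; rewrite comp_lfunDr comp_lfunZr.
by move=> w k u v; rewrite comp_lfunDl comp_lfunZl.
Qed.

Lemma is_vderive_pointwise V W (f : R -> 'Hom(V, W)) t (df : 'Hom(V, W)) :
  (forall w, is_vderive (fun s => f s w) t (df w)) -> is_vderive f t df.
Proof.
move=> H; rewrite (lfun_unitE df) (_ : f = fun s => \sum_i unit_lfun i (f s (vbase V i))).
  have : forall i, is_vderive (fun s => unit_lfun i (f s (vbase V i))) t
     (unit_lfun i (df (vbase V i))).
    move=> i; apply: (is_vderive_linear (f := unit_lfun i)) => // k u v.
    apply/lfunP => w; rewrite add_lfunE scale_lfunE !unit_lfunE.
    by rewrite scalerDr !scalerA mulrC.
  move=> K; elim: (index_enum _) => [|i r IH].
    rewrite big_nil; apply: is_vderive_ext (is_vderive_cst 0 t) => s.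
    by rewrite big_nil.
  rewrite big_cons; apply: is_vderive_ext (is_vderiveD (K i) IH) => s.
  by rewrite big_cons.
by apply/funext => s; exact: lfun_unitE.
Qed.

Lemma is_vderive_pair V W (c1 : R -> V) (c2 : R -> W) t v w :
  is_vderive c1 t v -> is_vderive c2 t w ->
  is_vderive (fun s => (c1 s, c2 s)) t (v, w).
Proof.
move=> H1 H2.
have K1 : is_vderive (fun s => (c1 s, 0 : W)) t (v, 0).
  apply: (is_vderive_linear (f := fun w => (w, 0 : W))) => // k u u'.
  by congr pair; rewrite /= scaler0 addr0.
have K2 : is_vderive (fun s => (0 : V, c2 s)) t (0, w).
  apply: (is_vderive_linear (f := fun w => (0 : V, w))) => // k u u'.
  by congr pair; rewrite /= scaler0 addr0.
apply: is_vderive_eq (is_vderive_ext _ (is_vderiveD K1 K2)) _ => [s|];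
  by congr pair; rewrite /= ?addr0 ?add0r.
Qed.

Lemma is_vderive_fst V W (c : R -> V * W) t v :
  is_vderive c t v -> is_vderive (fun s => (c s).1) t v.1.
Proof. exact: is_vderive_linear. Qed.

Lemma is_vderive_snd V W (c : R -> V * W) t v :
  is_vderive c t v -> is_vderive (fun s => (c s).2) t v.2.
Proof. exact: is_vderive_linear. Qed.

Lemma is_vderive_affine V (c : R -> V) (a b t : R) v :
  is_vderive c (a * t + b) v -> is_vderive (fun s => c (a * s + b)) t (a *: v).
Proof.
move=> /is_vderiveP H; apply/is_vderiveP => i; rewrite vcoordZ mulrC.
apply: (@is_derive1_comp _ (fun s => vcoord (c s) i) (fun s => a * s + b)).
rewrite (_ : (fun _ => _) = (a \*: id) + cst b)//.
by apply: is_derive_eq; rewrite addr0 scaler1.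
Qed.

Lemma is_vderive0_cst V (c : R -> V) : (forall t, is_vderive c t 0) ->
  forall s t, c s = c t.
Proof.
move=> H s t; apply: vcoordP => i.
apply: (@is_derive_0_is_cst _ (fun s => vcoord (c s) i)) => x.
by have /is_vderiveP/(_ i) := H x; rewrite vcoord0.
Qed.

(** Stated for an arbitrary linear observable [L] so that the induction closes: the derivative of
    [L (c t)] is a constant plus the observable [L (N (c t))]. *)
Lemma smooth_curve_linear_ode V W (c : R -> V) (N : V -> V) (w0 : V)
   (L : V -> W) (A : set R) k :
  linear N -> linear L -> open A ->
  (forall t, is_vderive c t (w0 + N (c t))) -> Ck k (fun t => v2r (L (c t))) A.
Proof.
move=> lN lL oA H.
have dc (M : V -> W) : linear M -> forall t, is_derive t (1 : R)
    (fun s => v2r (M (c s))) (v2r (M (w0 + N (c t)))).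
  by move=> lM t; exact: is_vderive_linear.
elim: k L lL => [|k IH] L lL.
  move=> t _; apply: differentiable_continuous; apply/derivable1_diffP.
  by case: (dc L lL t).
split=> [t _|v].
  by apply/derivable1_diffP; case: (dc L lL t).
have lLN : linear (fun u => L (N u)) by move=> a x y; rewrite lN lL.
have H1 := CkZ v oA (CkD oA (Ck_cst k (v2r (L w0)) A) (IH _ lLN)).
apply: Ck_ext H1 => // t _.
have [d1 D1] := dc L lL t.
have dif : differentiable (fun s => v2r (L (c s))) t by exact/derivable1_diffP.
have E : v2r (L w0) + v2r (L (N (c t))) = v2r (L (w0 + N (c t))).
  by rewrite (linear_funD lL) linearD.
rewrite E -D1 (deriveE _ dif) (deriveE _ dif).
by rewrite -[in RHS](mulr1 v) -[v * 1]/(v *: (1 : R)) linearZ.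
Qed.

End CurveDerivatives.

(** * Linear and affine differential equations *)

Section LinearODE.
Variable R : realType.
Implicit Types V W : vectType R.

Lemma cvgn_bigsumM (I : Type) (r : seq I) (a : I -> R) (s : I -> nat -> R) (l : I -> R) :
  (forall i, s i n @[n --> \oo] --> l i) ->
  (fun n => \sum_(i <- r) a i * s i n) @ \oo --> \sum_(i <- r) a i * l i.
Proof.
move=> H; elim: r => [|i r IH].
  rewrite big_nil (_ : (fun _ => _) = cst 0); first exact: cvg_cst.
  by apply/funext => n; rewrite big_nil.
rewrite big_cons (_ : (fun _ => _) =
  (fun n => a i * s i n) + (fun n => \sum_(i <- r) a i * s i n)).
  by apply: cvgD => //; apply: cvgM => //; exact: cvg_cst.
by apply/funext => n; rewrite big_cons.
Qed.

Lemma vcoord_lfun V W (N : 'Hom(V, W)) v j :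
  vcoord (N v) j = \sum_i vcoord v i * vcoord (N (vbase V i)) j.
Proof.
rewrite {1}[v]vcoordE linear_sum vcoord_sum.
by apply: eq_bigr => i _; rewrite linearZ vcoordZ.
Qed.

(** The l^1 norm in coordinates. It bounds every coordinate, and the factor in [coordsum_lfun] plays
    the role of an operator norm. *)
Definition coordsum V (v : V) : R := \sum_i `|vcoord v i|.

Lemma vcoord_le_coordsum V (v : V) i : `|vcoord v i| <= coordsum v.
Proof. by rewrite /coordsum (bigD1 i)//= lerDl sumr_ge0. Qed.

Lemma coordsum_ge0 V (v : V) : 0 <= coordsum v.
Proof. exact: sumr_ge0. Qed.

Lemma coordsum_lfun V (N : 'End(V)) v :
  coordsum (N v) <= (\sum_i coordsum (N (vbase V i))) * coordsum v.
Proof.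
rewrite {1}[v]vcoordE linear_sum /coordsum.
apply: le_trans (_ : \sum_j \sum_i `|vcoord v i| * `|vcoord (N (vbase V i)) j| <= _).
  apply: ler_sum => j _; rewrite vcoord_sum; apply: (le_trans (ler_norm_sum _ _ _)).
  by apply: ler_sum => i _; rewrite linearZ vcoordZ normrM.
rewrite exchange_big mulrC mulr_suml /=; apply: ler_sum => i _.
rewrite -mulr_sumr ler_wpM2l// [leRHS](bigD1 i)//= lerDl; apply: sumr_ge0 => k _.
exact: sumr_ge0.
Qed.

(** Taylor coefficients of the [i]-th coordinate of [exp (t N) v]; working coordinatewise reduces
    the exponential to real power series. *)
Definition lexp_coeff V (N : 'End(V)) (v : V) i (k : nat) : R :=
  vcoord (iter k N v) i / k`!%:R.

(** Domination by a multiple of the exponential series at [K * |t|], where [K] is the operator bound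
    from [coordsum_lfun]. *)
Lemma cvg_lexp_coeff V (N : 'End(V)) (v : V) i (t : R) :
  cvgn (pseries (lexp_coeff N v i) t).
Proof.
pose K := \sum_i coordsum (N (vbase V i)).
have K0 : 0 <= K by apply: sumr_ge0 => j _; exact: coordsum_ge0.
have b k : coordsum (iter k N v) <= K ^+ k * coordsum v.
  elim: k => [|k IH]; first by rewrite expr0 mul1r.
  rewrite iterS exprS -mulrA; apply: (le_trans (coordsum_lfun _ _)).
  by rewrite ler_wpM2l.
apply: normed_cvg.
have := @is_cvg_seriesZ _ _ (coordsum v) (is_cvg_series_exp_coeff (K * `|t|)).
apply: series_le_cvg => k.
- exact: normr_ge0.
- by rewrite mulr_ge0 ?coordsum_ge0// exp_coeff_ge0// mulr_ge0.
- change (`|vcoord (iter k N v) i / k`!%:R * t ^+ k| <=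
    coordsum v * ((K * `|t|) ^+ k / k`!%:R)).
  rewrite normrM normf_div (ger0_norm (x := k`!%:R))// normrX exprMn.
  rewrite [leLHS]mulrAC mulrA ler_wpM2r ?invr_ge0// mulrA ler_wpM2r ?exprn_ge0//.
  by rewrite mulrC; apply: le_trans (b k); exact: vcoord_le_coordsum.
Qed.

Definition linear_flow V (N : 'End(V)) (v : V) (t : R) : V :=
  \sum_i limn (pseries (lexp_coeff N v i) t) *: vbase V i.

Lemma vcoord_linear_flow V (N : 'End(V)) v t i :
  vcoord (linear_flow N v t) i = limn (pseries (lexp_coeff N v i) t).
Proof.
rewrite vcoord_sum (bigD1 i)//= big1 => [|j ji]; last first.
  by rewrite vcoordZ vcoord_base (negbTE ji) mulr0.
by rewrite vcoordZ vcoord_base eqxx mulr1 addr0.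
Qed.

(** Termwise differentiation cancels one factor of the factorial, leaving the series started at
    [N v]. *)
Lemma pseries_diffs_lexp V (N : 'End(V)) v i :
  pseries_diffs (lexp_coeff N v i) = lexp_coeff N (N v) i.
Proof.
apply/funext => k; rewrite /pseries_diffs /lexp_coeff -iterSr factS natrM invfM.
by rewrite mulrCA mulVKf// pnatr_eq0.
Qed.

Lemma linear_flow0 V (N : 'End(V)) v : linear_flow N v 0 = v.
Proof.
apply: vcoordP => i; rewrite vcoord_linear_flow; apply/cvg_lim => //.
(* The partial sum of length 0 is empty, so the sequence is constant only after a shift by one. *)
rewrite -cvg_shiftS /=.
rewrite (_ : (fun _ => _) = cst (vcoord v i)); first exact: cvg_cst.
apply/funext => n; rewrite /pseries /series /= big_nat_recl// big1 => [|k _].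
  by rewrite /lexp_coeff /= fact0 divr1 expr0 mulr1 addr0.
by rewrite expr0n /= mulr0.
Qed.

(** [N] commutes with every partial sum, and a finite linear combination of coordinates passes to
    the limit. Together with termwise differentiation this yields the equation satisfied by the
    flow. *)
Lemma linear_flow_lfun V (N : 'End(V)) v t :
  linear_flow N (N v) t = N (linear_flow N v t).
Proof.
apply: vcoordP => j.
rewrite vcoord_linear_flow (linear_fun_coord (linear_flow N v t) (linearP N)).
rewrite vcoord_sum; apply/cvg_lim => //.
rewrite (eq_bigr (fun i => vcoord (N (vbase V i)) j *
    limn (pseries (lexp_coeff N v i) t))); last first.
  by move=> i _; rewrite vcoordZ vcoord_linear_flow mulrC.
have := @cvgn_bigsumM _ (index_enum _) (fun i => vcoord (N (vbase V i)) j)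
  (fun i => pseries (lexp_coeff N v i) t) _ (fun i => @cvg_lexp_coeff V N v i t).
apply: cvg_trans; apply: near_eq_cvg; near=> n.
under eq_bigr do rewrite /pseries /series /= mulr_sumr.
rewrite exchange_big /pseries /series /=; apply: eq_bigr => k _.
rewrite /lexp_coeff -iterSr iterS vcoord_lfun !mulr_suml.
by apply: eq_bigr => i _; ring.
Unshelve. all: by end_near. Qed.

Lemma linear_flow_derive V (N : 'End(V)) v t :
  is_vderive (linear_flow N v) t (N (linear_flow N v t)).
Proof.
rewrite -linear_flow_lfun; apply/is_vderiveP => i.
rewrite vcoord_linear_flow -pseries_diffs_lexp.
rewrite (_ : (fun _ => _) = fun s => limn (pseries (lexp_coeff N v i) s)).
  (* Any radius beyond [|t|] serves, since the series converge everywhere. *)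
  apply: (@pseries_snd_diffs _ _ (`|t| + 1)); rewrite ?pseries_diffs_lexp;
    try exact: (@cvg_lexp_coeff V).
  by rewrite [ltRHS]ger0_norm ?addr_ge0// ltrDl.
by apply/funext => s; rewrite vcoord_linear_flow.
Qed.

Lemma lmul_linear V W Z (X : 'Hom(W, Z)) : linear (fun f : 'Hom(V, W) => (X \o f)%VF).
Proof. by move=> k f h; rewrite comp_lfunDr comp_lfunZr. Qed.

Lemma rmul_linear V W Z (X : 'Hom(V, W)) : linear (fun f : 'Hom(W, Z) => (f \o X)%VF).
Proof. by move=> k f h; rewrite comp_lfunDl comp_lfunZl. Qed.

Lemma linfunE V W (f : V -> W) : linear f -> linfun f =1 f.
Proof.
move=> lf; pose h := GRing.isLinear.Build _ _ _ _ f lf.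
pose F : {linear V -> W} := HB.pack f h.
exact: (lfunE F).
Qed.

Lemma linear_ode_unique0 V (N : 'End(V)) (c : R -> V) :
  (forall t, is_vderive c t (N (c t))) -> c 0 = 0 -> forall t, c t = 0.
Proof.
move=> Hc c0 t.
pose LN : 'End('End(V)) := linfun (fun f : 'End(V) => (N \o f)%VF).
pose RN : 'End('End(V)) := linfun (fun f : 'End(V) => - (f \o N)%VF).
have LE f : LN f = (N \o f)%VF by apply: linfunE; exact: lmul_linear.
have RE f : RN f = - (f \o N)%VF.
  by apply: linfunE => k u v; rewrite rmul_linear opprD scalerN.
(* [H t = exp (t N)] and [G t = exp (- t N)]; then [(G c)' = 0]. *)
pose H := linear_flow LN \1%VF; pose G := linear_flow RN \1%VF.
have dH s : is_vderive H s (N \o H s)%VF by rewrite -LE; exact: linear_flow_derive.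
have dG s : is_vderive G s (- (G s \o N)%VF) by rewrite -RE; exact: linear_flow_derive.
have GH : (G t \o H t)%VF = \1%VF.
  have <- : (G 0 \o H 0)%VF = \1%VF by rewrite /G /H !linear_flow0 comp_lfun1l.
  apply: (is_vderive0_cst (c := fun s => (G s \o H s)%VF)) => s.
  apply: is_vderive_eq (is_vderive_comp (dG s) (dH s)) _.
  by rewrite comp_lfunNl comp_lfunA addNr.
have Gc : G t (c t) = 0.
  have <- : G 0 (c 0) = 0 by rewrite c0 linear0.
  apply: (is_vderive0_cst (c := fun s => G s (c s))) => s.
  apply: is_vderive_eq (is_vderive_app (dG s) (Hc s)) _.
  by rewrite opp_lfunE comp_lfunE addNr.
(* In finite dimension the left inverse [G t] is also a right inverse, so [G t (c t) = 0] forces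
   [c t = 0]. *)
have HG : (H t \o G t)%VF = \1%VF.
  have H0 : lker (H t) == 0%VS.
    by apply/lker0P => u v E; rewrite -[u]id_lfunE -[v]id_lfunE -GH !comp_lfunE E.
  have -> : G t = (H t)^-1%VF.
    by rewrite -[LHS]comp_lfun1r -(lker0_compfV H0) comp_lfunA GH comp_lfun1l.
  exact: lker0_compfV.
by rewrite -[LHS]id_lfunE -HG comp_lfunE Gc linear0.
Qed.

Lemma linear_ode_unique V (N : 'End(V)) (w : V) (c c' : R -> V) :
  (forall t, is_vderive c t (w + N (c t))) ->
  (forall t, is_vderive c' t (w + N (c' t))) -> c 0 = c' 0 -> c =1 c'.
Proof.
move=> Hc Hc' E t; apply/eqP; rewrite -subr_eq0; apply/eqP.
apply: (@linear_ode_unique0 _ N (fun s => c s - c' s)); last by rewrite E subrr.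
move=> s; apply: is_vderive_eq (is_vderiveB (Hc s) (Hc' s)) _.
by rewrite linearB /= opprD addrACA subrr add0r.
Qed.

Lemma affine_ode_solution V (N : 'End(V)) (w v : V) :
  exists2 c : R -> V, c 0 = v & forall t, is_vderive c t (w + N (c t)).
Proof.
(* Homogenise with an extra coordinate that stays equal to [1]. *)
pose M (p : V * R^o) : V * R^o := (p.2 *: w + N p.1, 0).
have lM : linear M.
  move=> k p q; rewrite /M; congr pair; rewrite /= ?scaler0 ?addr0//.
  by rewrite scalerDl linearP scalerDr scalerA addrACA.
pose L := linfun M; have LE p : L p = M p by apply: linfunE.
pose c := linear_flow L (v, 1).
have dc t : is_vderive c t (M (c t)) by rewrite -LE; exact: linear_flow_derive.
have c0 : c 0 = (v, 1) by exact: linear_flow0.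
have c2 t : (c t).2 = 1.
  have <- : (c 0).2 = 1 by rewrite c0.
  by apply: (@is_vderive0_cst _ R^o (fun s => (c s).2)) => s; exact: is_vderive_snd (dc s).
exists (fun t => (c t).1); first by rewrite c0.
by move=> t; apply: is_vderive_eq (is_vderive_fst (dc t)) _; rewrite /M /= c2 scale1r.
Qed.

End LinearODE.

(** * Lie groups cut out by cocycles *)

Section LieGroups.
Variable R : realType.
Implicit Types V W : vectType R.

Lemma derive_line (U W : normedModType R) (f : U -> W) x v :
  'D_v f x = 'D_1 (fun h : R => f (h *: v + x)) 0.
Proof.
rewrite /derive; congr (lim _); apply/funext => A /=.
by congr (nbhs _ _); apply/funext => h /=; rewrite scale0r add0r addr0 [_%:A]mulr1.
Qed.

Lemma is_derive_line (U W : normedModType R) (f : U -> W) x v :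
  differentiable f x -> is_derive 0 (1 : R) (fun h : R => f (h *: v + x)) ('D_v f x).
Proof.
move=> df; apply: DeriveDef; last by rewrite -derive_line.
by apply/(derivable1P f x v); exact: diff_derivable.
Qed.

(** A direction lies in the kernel of [DF] when [F] is stationary along the corresponding line.
    Phrasing the kernel hypothesis this way lets it be verified with the calculus of curves, without
    computing [DF]. The model subspace is the kernel at [e]. *)
Lemma level_set_chart V W (Om : set V) (F : V -> W) (e : V) :
  vopen Om -> Om e -> smooth_on Om F -> F e = 0 ->
  (forall b, Om b -> exists2 r : 'End(V), lker r == 0%VS &
     forall X, is_vderive (fun s => F (s *: X + e)) 0 0 ->
       is_vderive (fun s => F (s *: r X + b)) 0 0) ->
  exists (L : {vspace V}) (U U' : set V) (Phi Psi : V -> V),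
    [/\ U e, vopen U, vopen U' & U `<=` Om] /\
    [/\ smooth_on U Phi, smooth_on U' Psi,
        forall x, U x -> U' (Phi x) /\ Psi (Phi x) = x
      & forall y, U' y -> U (Psi y) /\ Phi (Psi y) = y] /\
    (forall x, U x -> (F x = 0 <-> Phi x \in L)).
Proof.
move=> oOm Ome sF Fe HK.
pose f (x : 'rV[R]_(dim V)) : 'rV[R]_(dim W) := v2r (F (r2v x)).
pose A := [set x : 'rV[R]_(dim V) | Om (r2v x)].
pose p : 'rV[R]_(dim V) := v2r e.
have Ap : A p by rewrite /A /p /= v2rK.
have fp : f p = 0 by rewrite /f /p v2rK Fe linear0.
have Cf k : Ck k f A by exact: sF.
have df x : A x -> differentiable f x by have [+ _] := Cf 1%N; apply.
have Df x u : A x -> is_vderive (fun s => F (s *: r2v u + r2v x)) 0 (r2v ('D_u f x)).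
  move=> Ax; rewrite /is_vderive r2vK (_ : (fun _ => _) = fun s : R => f (s *: u + x)).
    exact: (is_derive_line u (df x Ax)).
  by apply/funext => s; rewrite /f linearD linearZ.
have HK' x : A x -> exists2 K : 'M[R]_(dim V), K \in unitmx &
     forall u, 'D_u f p = 0 -> 'D_(u *m K) f x = 0.
  move=> Ax; have [r r0 Hr] := HK _ Ax; exists (end_mx r); first by rewrite end_mx_unit.
  move=> u Du; have := Df p u Ap; rewrite Du linear0 {1}/p v2rK => /Hr H.
  have E : r (r2v u) = r2v (u *m end_mx r) by rewrite -[LHS]v2rK end_mxE r2vK.
  rewrite E in H; have := is_vderive_unique H (Df x _ Ax).
  by move=> /(congr1 v2r); rewrite r2vK linear0 => /esym.
have [U [U' [Phi [Psi [[Up oU oU' UA] [[CPhi CPsi UP PU] H]]]]]] :=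
  constant_rank_level_set oOm Ap Cf fp HK'.
have lT : linear (fun v : V => r2v (v2r v *m jacobian f p) : W).
  by move=> k u v; rewrite linearP mulmxDl -scalemxAl linearP.
exists (lker (linfun (fun v : V => r2v (v2r v *m jacobian f p) : W))).
exists [set x | U (v2r x)], [set x | U' (v2r x)].
exists (fun x => r2v (Phi (v2r x))), (fun x => r2v (Psi (v2r x))).
have vo (B : set 'rV[R]_(dim V)) : open B -> vopen [set x | B (v2r x)].
  move=> oB; rewrite /vopen (_ : [set x | _] = B)//.
  by apply/seteqP; split => x /=; rewrite r2vK.
have so (B : set 'rV[R]_(dim V)) (h : 'rV[R]_(dim V) -> 'rV[R]_(dim V)) :
    open B -> (forall k, Ck k h B) ->
    smooth_on [set x | B (v2r x)] (fun x => r2v (h (v2r x)) : V).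
  move=> oB Ch k; apply: Ck_sub (_ : Ck k _ B); first by move=> x /=; rewrite r2vK.
  by apply: Ck_ext (Ch k) => // x _; rewrite !r2vK.
split; first split; [by []|exact: vo|exact: vo| |split].
- by move=> x /= /UA; rewrite /A /= v2rK.
- split; [exact: so|exact: so| | ].
  + by move=> x /= /UP[a b]; rewrite !r2vK b v2rK.
  + by move=> y /= /PU[a b]; rewrite !r2vK b v2rK.
- move=> x /= /H; rewrite memv_ker linfunE// r2vK /f v2rK => E; split.
    move=> Fx; apply/eqP; have [+ _] := E; rewrite Fx linear0 => ->//.
    by rewrite linear0.
  move=> /eqP T0; apply: (can_inj v2rK); rewrite linear0; apply/E.
  by apply: (can_inj r2vK); rewrite T0 linear0.
Qed.

(** The chart at the unit is moved to [p] by right translation with the inverse of [p].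
    Associativity and the right unit are assumed on all of [V], because a chart domain also contains
    points outside the group, and these must be translated back and forth. *)
Lemma group_submanifold V W (G : group_data V) (Om : set V) (F : V -> W) :
  is_group G ->
  (forall x y z, gmul G x (gmul G y z) = gmul G (gmul G x y) z) ->
  (forall x, gmul G x (gone G) = x) ->
  (forall q, smooth_on setT (fun x => gmul G x q)) ->
  vopen Om -> smooth_on Om F ->
  (forall x, gset G x <-> Om x /\ F x = 0) ->
  (forall b, Om b -> exists2 r : 'End(V), lker r == 0%VS &
     forall X, is_vderive (fun s => F (s *: X + gone G)) 0 0 ->
       is_vderive (fun s => F (s *: r X + b)) 0 0) ->
  is_submanifold (gset G).
Proof.
move=> [G1 GM _ _ GV] mA m1 sm oOm sF GE HK.
have [Om1 F1] := (GE _).1 G1.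
have [L [U [U' [Phi [Psi [[Ue oU oU' UA] [[sPhi sPsi UP PU] H]]]]]]] :=
  level_set_chart oOm Om1 sF F1 HK.
exists L => p Gp; have [q [Gq pq qp]] := GV p Gp.
pose Up := [set x | U (gmul G x q)].
have oUp : vopen Up by exact: vopen_preimage.
have K1 x : gmul G (gmul G x q) p = x by rewrite -mA qp m1.
have K2 x : gmul G (gmul G x p) q = x by rewrite -mA pq m1.
exists Up, U', (fun x => Phi (gmul G x q)), (fun y => gmul G (Psi y) p).
split; first by split => //; rewrite /Up /= pq.
split.
  split.
  - apply: (smooth_on_comp (U' := U) (h := Phi) (f := fun x => gmul G x q)) => //.
    exact: smooth_on_sub (sm q).
  - apply: (smooth_on_comp (U' := setT) (h := fun x => gmul G x p) (f := Psi)) => //.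
    exact: vopenT.
  - by move=> x /UP[a b]; rewrite b K1.
  - by move=> y /PU[a b]; rewrite /Up /= K2.
(* Translation by a group element preserves and reflects membership, so it may be tested at the
   translated point. *)
move=> x Ux; have GxE : gset G x <-> gset G (gmul G x q).
  split=> Gx; first exact: GM.
  by rewrite -(K1 x); exact: GM.
rewrite GxE GE; rewrite -(H _ Ux); split=> [[]//|Fx]; split=> //; exact: UA.
Qed.

(** [ginv] chooses some inverse; uniqueness of inverses identifies it with any explicit one. *)
Lemma ginv_eq V (G : group_data V) x y : is_group G ->
  gset G x -> gset G y -> gmul G x y = gone G -> gmul G y x = gone G ->
  ginv G x = y.
Proof.
move=> [G1 GM GA GI GV] Gx Gy xy yx; rewrite /ginv.
set P := [set y | _]; have : P (xget (gone G) P) by apply: xgetPex; exists y.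
set w := xget _ _ => -[Gw xw wx].
have := GA w x y Gw Gx Gy; rewrite xy wx.
by rewrite (GI w Gw).2 (GI y Gy).1.
Qed.

End LieGroups.

(** * Equational calculus of linear and multilinear maps *)

Section LfunCalculus.
Variable R : realType.
Implicit Types V W Z : vectType R.

Lemma lfD V W (f : 'Hom(V, W)) u v : f (u + v) = f u + f v.
Proof. exact: linearD. Qed.
Lemma lfN V W (f : 'Hom(V, W)) u : f (- u) = - f u.
Proof. exact: linearN. Qed.
Lemma lfZ V W (f : 'Hom(V, W)) k u : f (k *: u) = k *: f u.
Proof. exact: linearZ. Qed.
Lemma lf0 V W (f : 'Hom(V, W)) : f 0 = 0.
Proof. exact: linear0. Qed.

Definition lfunEs := (lfD, lfN, lfZ, lf0, @add_lfunE, @opp_lfunE, @scale_lfunE,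
  @zero_lfunE, @comp_lfunE, @id_lfunE).

Lemma lfun2P U V W (f h : 'Hom(U, 'Hom(V, W))) :
  (forall x y, f x y = h x y) -> f = h.
Proof. by move=> H; apply/lfunP => x; apply/lfunP => y; exact: H. Qed.

Lemma comp_lfun_inv V W Z (f : 'Hom(V, V)) (h : 'End(V)) :
  lker f == 0%VS -> lker h == 0%VS -> (f \o h)^-1%VF = (h^-1 \o f^-1)%VF.
Proof.
move=> f0 h0; have fh0 : lker (f \o h)%VF == 0%VS.
  apply/lker0P => u v; rewrite !comp_lfunE => E.
  by apply: (lker0P h0); apply: (lker0P f0).
rewrite -[LHS]comp_lfun1r.
have <- : ((f \o h) \o (h^-1 \o f^-1))%VF = \1%VF.
  by rewrite -comp_lfunA lker0_compVKf// lker0_compfV.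
by rewrite lker0_compKf.
Qed.

Lemma lker0_comp V (f h : 'End(V)) :
  lker f == 0%VS -> lker h == 0%VS -> lker (f \o h)%VF == 0%VS.
Proof.
move=> f0 h0; apply/lker0P => u v; rewrite !comp_lfunE => E.
by apply: (lker0P h0); apply: (lker0P f0).
Qed.

Lemma lker0_inv V (f : 'End(V)) : lker f == 0%VS -> lker f^-1%VF == 0%VS.
Proof. by move=> f0; apply/lker0P; exact: can_inj (lker0_lfunVK f0). Qed.

Lemma lker0_id V : lker (\1%VF : 'End(V)) == 0%VS.
Proof. by apply/lker0P => u v; rewrite !id_lfunE. Qed.

Lemma inv_lfunE V (f h : 'End(V)) : lker f == 0%VS -> (f \o h = \1)%VF -> f^-1%VF = h.
Proof. by move=> f0 E; rewrite -[LHS]comp_lfun1r -E lker0_compKf. Qed.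

Lemma inv_lfun1 V : (\1%VF : 'End(V))^-1%VF = \1%VF.
Proof. by apply: inv_lfunE; [exact: lker0_id|rewrite comp_lfun1l]. Qed.

Lemma lker0_left_inverse V (f h : 'End(V)) : (h \o f = \1)%VF -> lker f == 0%VS.
Proof.
by move=> E; apply/lker0P => u v fuv; rewrite -[u]id_lfunE -[v]id_lfunE -E !comp_lfunE fuv.
Qed.

Definition trilin V1 V2 V3 W (f : V1 -> V2 -> V3 -> W) :
    'Hom(V1, 'Hom(V2, 'Hom(V3, W))) :=
  linfun (fun x => bilin (f x)).

Lemma trilinE V1 V2 V3 W (f : V1 -> V2 -> V3 -> W) :
  (forall x y, linear (f x y)) -> (forall x z, linear (fun y => f x y z)) ->
  (forall y z, linear (fun x => f x y z)) ->
  forall x y z, trilin f x y z = f x y z.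
Proof.
move=> l3 l2 l1 x y z; rewrite /trilin linfunE; first exact: bilinE.
move=> k u v; apply: lfun2P => a b.
by rewrite !lfunEs !bilinE// l1.
Qed.

End LfunCalculus.

(** Vector identities are compared coordinate by coordinate, with the coordinates of brackets and of
    values of linear maps as atoms for [ring]. *)
Ltac vring := apply: vcoordP => ?; rewrite !(vcoordD, vcoordN, vcoordZ, vcoord0); ring.
Ltac vlinear := move=> ? ? ?; rewrite ?lfunEs; vring.

(** * The crossed modules Aut and SAut *)

Section AutAlgebra.
Variables (R : realType) (g0 g1 : vectType R) (g : lie2_algebra g0 g1).
Local Notation d := (gdiff g).
Local Notation "[ x , y ]" := (br00 g x y).
Local Notation T := (triple g0 g1).
Implicit Types A B C : T.

Lemma aut0_mul2E B A x y :
  (aut0_mul B A).2 x y = B.2 (A.1.1 x) (A.1.1 y) + B.1.2 (A.2 x y).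
Proof. by rewrite /aut0_mul /= bilinE// => ?; vlinear. Qed.

Lemma aut0_mul11 B A : (aut0_mul B A).1.1 = (B.1.1 \o A.1.1)%VF.
Proof. by []. Qed.

Lemma aut0_mul12 B A : (aut0_mul B A).1.2 = (B.1.2 \o A.1.2)%VF.
Proof. by []. Qed.

Definition aut0_mulE := (aut0_mul2E, aut0_mul11, aut0_mul12).

Lemma triple_eq A B : A.1.1 = B.1.1 -> A.1.2 = B.1.2 ->
  (forall x y, A.2 x y = B.2 x y) -> A = B.
Proof.
by case: A B => [[A0 A1] A2] [[B0 B1] B2] /= -> -> /lfun2P ->.
Qed.

(** No invertibility enters: triples form a monoid on the whole vector space, as the translation of
    charts in [group_submanifold] requires. *)
Lemma aut0_mulA C B A : aut0_mul C (aut0_mul B A) = aut0_mul (aut0_mul C B) A.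
Proof.
apply: triple_eq => [||x y]; rewrite !aut0_mulE ?comp_lfunA//.
by rewrite !lfunEs addrA.
Qed.

Lemma aut0_mul1r A : aut0_mul A (aut0_one g0 g1) = A.
Proof.
apply: triple_eq => [||x y]; rewrite !aut0_mulE /= ?comp_lfun1r//.
by rewrite !lfunEs addr0.
Qed.

Lemma aut0_mul1l A : aut0_mul (aut0_one g0 g1) A = A.
Proof.
apply: triple_eq => [||x y]; rewrite !aut0_mulE /= ?comp_lfun1l//.
by rewrite !lfunEs add0r.
Qed.

Definition aut0_dom : set T := [set A : T | lker A.1.1 == 0%VS /\ lker A.1.2 == 0%VS].

(** The third component is the solution [w] of [A.2 (A0^-1 x) (A0^-1 y) + A1 (w x y) = 0], the
    vanishing of the third component of the product. *)
Definition aut0_inv A : T :=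
  (A.1.1^-1%VF, A.1.2^-1%VF,
   bilin (fun x y => - A.1.2^-1%VF (A.2 (A.1.1^-1%VF x) (A.1.1^-1%VF y)))).

Lemma aut0_inv2E A x y :
  (aut0_inv A).2 x y = - A.1.2^-1%VF (A.2 (A.1.1^-1%VF x) (A.1.1^-1%VF y)).
Proof. by rewrite /aut0_inv /= bilinE// => ?; vlinear. Qed.

Lemma aut0_mulV A : aut0_dom A -> aut0_mul A (aut0_inv A) = aut0_one g0 g1.
Proof.
move=> [A0 A1]; apply: triple_eq => [||x y]; rewrite !aut0_mulE ?lker0_compfV//.
by rewrite aut0_inv2E /= !lfunEs lker0_lfunVK// subrr.
Qed.

Lemma aut0_mulVl A : aut0_dom A -> aut0_mul (aut0_inv A) A = aut0_one g0 g1.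
Proof.
move=> [A0 A1]; apply: triple_eq => [||x y]; rewrite !aut0_mulE ?lker0_compVf//.
by rewrite aut0_inv2E /= !lfunEs !lker0_lfunK// addNr.
Qed.

Lemma aut0_dom_one : aut0_dom (aut0_one g0 g1).
Proof. by split; exact: lker0_id. Qed.

Lemma aut0_dom_mul A B : aut0_dom A -> aut0_dom B -> aut0_dom (aut0_mul A B).
Proof. by move=> [a b] [e f]; split; exact: lker0_comp. Qed.

Lemma aut0_dom_inv A : aut0_dom A -> aut0_dom (aut0_inv A).
Proof. by move=> [a b]; split; exact: lker0_inv. Qed.

(* The structure of [g] pulled back along [A]. Writing [A_2(z, [x, y])] rather
   than [- A_2([x, y], z)] in [pull_l3] makes the pullback functorial without
   assuming [A_2] skew-symmetric. *)
Definition pull_d A (a : g1) : g0 := A.1.1^-1%VF (d (A.1.2 a)).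
Definition pull00 A (x y : g0) : g0 :=
  A.1.1^-1%VF ([A.1.1 x, A.1.1 y] + d (A.2 x y)).
Definition pull01 A (x : g0) (a : g1) : g1 :=
  A.1.2^-1%VF (br01 g (A.1.1 x) (A.1.2 a) + A.2 x (pull_d A a)).
Definition pull_l3 A (x y z : g0) : g1 :=
  A.1.2^-1%VF (cyc (fun x y z => br01 g (A.1.1 x) (A.2 y z)) x y z
    + l3 g (A.1.1 x) (A.1.1 y) (A.1.1 z)
    + cyc (fun x y z => A.2 z (pull00 A x y)) x y z).
Definition pull_sym A (x y : g0) : g1 := A.1.2^-1%VF (A.2 x y + A.2 y x).
(** The factor [A1^-1] is essential: the third component of a product [AB] contains [A1 (B.2 x y)],
    which involves [A1] besides [A.2]. After normalisation the rule becomes affine in [pull_hom A]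
    alone. On invertible triples its vanishing means [A.2 = 0], the extra equation for
    strictness. *)
Definition pull_hom A (x y : g0) : g1 := A.1.2^-1%VF (A.2 x y).

Lemma pull_d_mul A B a : aut0_dom A -> aut0_dom B ->
  pull_d (aut0_mul A B) a = B.1.1^-1%VF (pull_d A (B.1.2 a)).
Proof. by move=> [A0 A1] [B0 B1]; rewrite /pull_d !aut0_mulE comp_lfun_inv// !lfunEs. Qed.

Lemma pull00_mul A B x y : aut0_dom A -> aut0_dom B ->
  pull00 (aut0_mul A B) x y =
  B.1.1^-1%VF (pull00 A (B.1.1 x) (B.1.1 y) + pull_d A (B.2 x y)).
Proof.
move=> [A0 A1] [B0 B1]; rewrite /pull00 /pull_d !aut0_mulE comp_lfun_inv//.
by rewrite !lfunEs addrA.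
Qed.

Lemma pull01_mul A B x a : aut0_dom A -> aut0_dom B ->
  pull01 (aut0_mul A B) x a =
  B.1.2^-1%VF (pull01 A (B.1.1 x) (B.1.2 a) + B.2 x (pull_d (aut0_mul A B) a)).
Proof.
move=> dA dB; have [A0 A1] := dA; have [B0 B1] := dB.
have E : pull_d A (B.1.2 a) = B.1.1 (pull_d (aut0_mul A B) a).
  by rewrite pull_d_mul// lker0_lfunVK.
rewrite /pull01 E; set P := pull_d _ _; rewrite !aut0_mulE comp_lfun_inv//.
by rewrite !lfunEs lker0_lfunK// addrA.
Qed.

(** Apply [A1] to both sides. By [E], the terms [A.2 z (pull00 A x y)] at arguments moved by [B0]
    split into a part belonging to the product and a part with [pull_d A (B.2 x y)]. The latter
    cancels the correction term of [pull01 A (B0 z) (B.2 x y)]. *)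
Lemma pull_l3_mul A B x y z : aut0_dom A -> aut0_dom B ->
  pull_l3 (aut0_mul A B) x y z =
  B.1.2^-1%VF (cyc (fun x y z => pull01 A (B.1.1 x) (B.2 y z)) x y z
    + pull_l3 A (B.1.1 x) (B.1.1 y) (B.1.1 z)
    + cyc (fun x y z => B.2 z (pull00 (aut0_mul A B) x y)) x y z).
Proof.
move=> dA dB; have [A0 A1] := dA; have [B0 B1] := dB.
have E u v : pull00 A (B.1.1 u) (B.1.1 v) =
    B.1.1 (pull00 (aut0_mul A B) u v) - pull_d A (B.2 u v).
  by rewrite pull00_mul// lker0_lfunVK// addrK.
have E01 u a : A.1.2 (pull01 A u a) =
    br01 g (A.1.1 u) (A.1.2 a) + A.2 u (pull_d A a) by rewrite lker0_lfunVK.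
have E3 u v w : A.1.2 (pull_l3 A u v w) =
    cyc (fun x y z => br01 g (A.1.1 x) (A.2 y z)) u v w
    + l3 g (A.1.1 u) (A.1.1 v) (A.1.1 w)
    + cyc (fun x y z => A.2 z (pull00 A x y)) u v w by rewrite lker0_lfunVK.
rewrite {1}/pull_l3 !aut0_mul12 comp_lfun_inv// [LHS]comp_lfunE; congr (_^-1%VF _).
apply: (canLR (lker0_lfunK A1)).
rewrite /cyc !aut0_mul2E !aut0_mul11 !comp_lfunE !lfD !E01 E3 /cyc !E !lfD !lfN.
vring.
Qed.

Lemma pull_sym_mul A B x y : aut0_dom A -> aut0_dom B ->
  pull_sym (aut0_mul A B) x y =
  B.1.2^-1%VF (pull_sym A (B.1.1 x) (B.1.1 y) + (B.2 x y + B.2 y x)).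
Proof.
move=> [A0 A1] [B0 B1]; rewrite /pull_sym !aut0_mulE comp_lfun_inv//.
by rewrite !lfunEs !lker0_lfunK//; vring.
Qed.

Lemma pull_hom_mul A B x y : aut0_dom A -> aut0_dom B ->
  pull_hom (aut0_mul A B) x y =
  B.1.2^-1%VF (pull_hom A (B.1.1 x) (B.1.1 y) + B.2 x y).
Proof.
move=> [A0 A1] [B0 B1]; rewrite /pull_hom !aut0_mulE comp_lfun_inv//.
by rewrite !lfunEs !lker0_lfunK.
Qed.

Definition preserves A : Prop :=
  [/\ forall a, pull_d A a = d a, forall x y, pull00 A x y = [x, y],
      forall x a, pull01 A x a = br01 g x a,
      forall x y z, pull_l3 A x y z = l3 g x y z
    & forall x y, pull_sym A x y = 0].

(** Multiplying each pullback equation by [A0] or [A1] gives back a defining identity. For the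
    identity on [l_3], skewness of [A.2], encoded by [pull_sym], turns [A.2 z [x, y]] into [- A.2
    [x, y] z]. *)
Lemma aut0_setE A : aut0_set g A <-> aut0_dom A /\ preserves A.
Proof.
rewrite /aut0_set /=; split.
  move=> [/lker0_bijective A0 /lker0_bijective A1 sA dA [H00 H01 H3]].
  have dE a : pull_d A a = d a.
    apply: (lker0P A0); rewrite /pull_d lker0_lfunVK//.
    by have /lfunP/(_ a) := dA; rewrite !comp_lfunE.
  have E00 x y : pull00 A x y = [x, y].
    apply: (lker0P A0); rewrite /pull00 lker0_lfunVK//.
    by rewrite -H00 addrC subrK.
  split => //; split => //.
  - move=> x a; apply: (lker0P A1); rewrite /pull01 lker0_lfunVK// dE.
    by rewrite -H01 addrC subrK.
  - move=> x y z; apply: (lker0P A1); rewrite /pull_l3 lker0_lfunVK//.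
    rewrite H3 /cyc !E00 (sA z [x, y]) (sA x [y, z]) (sA y [z, x]); vring.
  - by move=> x y; rewrite /pull_sym (sA x y) addNr lf0.
move=> [[A0 A1] [Hd H00 H01 H3 Hs]].
have sA : skew2 A.2.
  move=> x y; apply/eqP; rewrite -addr_eq0; apply/eqP.
  by apply: (lker0P (lker0_inv A1)); rewrite lf0; exact: Hs.
have dE a : d (A.1.2 a) = A.1.1 (d a) by rewrite -(Hd a) /pull_d lker0_lfunVK.
split; [exact/lker0_bijective|exact/lker0_bijective|by []| |split].
- by apply/lfunP => a; rewrite !comp_lfunE dE.
- by move=> x y; rewrite -(H00 x y) /pull00 lker0_lfunVK// addrC addKr.
- by move=> x a; rewrite -(H01 x a) /pull01 lker0_lfunVK// Hd addrC addKr.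
- move=> x y z; rewrite -(H3 x y z) /pull_l3 lker0_lfunVK// /cyc !H00.
  by rewrite (sA z [x, y]) (sA x [y, z]) (sA y [z, x]); vring.
Qed.

(** An equivalence rather than an implication, so that it yields inverses as well as products: take
    [B] to be the inverse of [A]. *)
Lemma preserves_mul A B : aut0_dom A -> preserves A -> aut0_dom B ->
  preserves (aut0_mul A B) <-> preserves B.
Proof.
move=> dA [Hd H00 H01 H3 Hs] dB; have [B0 B1] := dB.
have Ed a : pull_d (aut0_mul A B) a = pull_d B a by rewrite pull_d_mul// Hd.
have E00 x y : pull00 (aut0_mul A B) x y = pull00 B x y.
  by rewrite pull00_mul// H00 Hd.
have E01 x a : pull01 (aut0_mul A B) x a = pull01 B x a.
  by rewrite pull01_mul// H01 Ed.
have E3 x y z : pull_l3 (aut0_mul A B) x y z = pull_l3 B x y z.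
  by rewrite pull_l3_mul// H3 /cyc !H01 !E00.
have Es x y : pull_sym (aut0_mul A B) x y = pull_sym B x y.
  by rewrite pull_sym_mul// Hs add0r.
by split=> -[h1 h2 h3 h4 h5]; split=> *; rewrite -?(Ed, E00, E01, E3, Es)//
   ?(Ed, E00, E01, E3, Es).
Qed.

Lemma preserves_one : preserves (aut0_one g0 g1).
Proof.
split; rewrite /pull_d /pull00 /pull01 /pull_l3 /pull_sym /cyc /= ?inv_lfun1.
- by move=> a; rewrite !lfunEs.
- by move=> x y; rewrite !lfunEs addr0.
- by move=> x a; rewrite !lfunEs addr0.
- by move=> x y z; rewrite !lfunEs !addr0 !add0r.
- by move=> x y; rewrite !lfunEs addr0.
Qed.

Lemma aut0_is_group : is_group (Aut0 g).
Proof.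
split => /=.
- by apply/aut0_setE; split; [exact: aut0_dom_one|exact: preserves_one].
- move=> A B /aut0_setE[dA pA] /aut0_setE[dB pB]; apply/aut0_setE.
  by split; [exact: aut0_dom_mul|apply/preserves_mul].
- by move=> *; exact: aut0_mulA.
- by move=> A _; rewrite aut0_mul1l aut0_mul1r.
- move=> A /aut0_setE[dA pA]; exists (aut0_inv A).
  split; [|exact: aut0_mulV|exact: aut0_mulVl].
  have dV := aut0_dom_inv dA; apply/aut0_setE; split => //.
  by apply/(preserves_mul dA pA dV); rewrite aut0_mulV//; exact: preserves_one.
Qed.

End AutAlgebra.

(** * Curves with vanishing derivative at the origin *)

Section VanishingDerivative.
Variable R : realType.
Implicit Types V W : vectType R.

Definition stationary V (c : R -> V) : Prop := is_vderive c 0 0.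

Lemma stationaryD V (c c' : R -> V) :
  stationary c -> stationary c' -> stationary (fun s => c s + c' s).
Proof. by move=> H H'; apply: is_vderive_eq (is_vderiveD H H') _; rewrite addr0. Qed.

Lemma stationary_cst V (v : V) : stationary (fun=> v).
Proof. exact: is_vderive_cst. Qed.

Lemma stationary_lfun V W (f : 'Hom(V, W)) c :
  stationary c -> stationary (fun s => f (c s)).
Proof. by move=> H; apply: is_vderive_eq (is_vderive_lfun f H) _; rewrite lf0. Qed.

Lemma stationary_app V W (f : R -> 'Hom(V, W)) w :
  stationary f -> stationary (fun s => f s w).
Proof. by move=> H; apply: is_vderive_eq (is_vderive_app1 w H) _; rewrite zero_lfunE. Qed.

Lemma stationary_near V (c c' : R -> V) : (\forall s \near (0 : R), c s = c' s) ->
  stationary c -> stationary c'.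
Proof. exact: is_vderive_near. Qed.

Lemma stationary_subr V (c : R -> V) v : stationary (fun s => c s - v) <-> stationary c.
Proof.
split=> H; last exact: stationaryD H (stationary_cst _).
apply: is_vderive_ext (stationaryD H (stationary_cst v)) => s.
by rewrite subrK.
Qed.

Lemma stationary_pair V W (c : R -> V * W) :
  stationary c <-> stationary (fun s => (c s).1) /\ stationary (fun s => (c s).2).
Proof.
split=> [H|[H1 H2]]; first by split; [exact: is_vderive_fst H|exact: is_vderive_snd H].
by apply: is_vderive_ext (is_vderive_pair H1 H2) => s; case: (c s).
Qed.

Lemma stationary_pointwise V W (f : R -> 'Hom(V, W)) :
  stationary f <-> forall w, stationary (fun s => f s w).
Proof.
split=> [H w|H]; first exact: stationary_app.
by apply: is_vderive_pointwise => w; rewrite zero_lfunE; exact: H.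
Qed.

(** The product rules for pullbacks hold on invertible elements only. A line through the unit
    remains invertible for small parameters, which is all that a derivative at 0 sees. *)
Lemma near_line V (Om : set V) e X : vopen Om -> Om e ->
  \forall s \near (0 : R), Om (s *: X + e).
Proof.
move=> oOm Oe; pose c (s : R) := v2r (s *: X + e).
have dc : is_vderive (fun s => s *: X + e) 0 (X + 0).
  by apply: is_vderiveD; [exact: is_vderive_id|exact: is_vderive_cst].
have cc : {for (0 : R), continuous c}.
  apply: differentiable_continuous; apply/derivable1_diffP.
  by case: dc.
have : \forall s \near (0 : R), Om (r2v (c s)).
  apply: (cc [set x | Om (r2v x)]); apply: open_nbhs_nbhs; split; first exact: oOm.
  by rewrite /c /= v2rK scale0r add0r.
by apply: filterS => s; rewrite /c v2rK.
Qed.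

End VanishingDerivative.

Definition lfunLs := (lfD, lfZ, @add_lfunE, @scale_lfunE).

Ltac smooth_tac oU := repeat first
  [ exact: smooth_on_cst | exact: (smooth_on_id oU) | assumption
  | apply: (smooth_on_app oU) | apply: (smooth_onD oU) | apply: (smooth_onN oU)
  | apply: (smooth_on_comp_lfun oU) | apply: (smooth_on_pair oU)
  | apply: (smooth_on_fst oU) | apply: (smooth_on_snd oU) ].

(** * The Lie groups Aut^0 and SAut^0 *)

Section AutManifold.
Variables (R : realType) (g0 g1 : vectType R) (g : lie2_algebra g0 g1).
Local Notation d := (gdiff g).
Local Notation T := (triple g0 g1).
Local Notation dom := (@aut0_dom R g0 g1).
Implicit Types A B : T.

Lemma aut0_dom_open : vopen dom.
Proof.
have oT := @vopenT R T.
have H1 : vopen [set A : T | lker A.1.1 == 0%VS].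
  by apply: vopen_lker0; smooth_tac oT.
have H2 : vopen [set A : T | lker A.1.2 == 0%VS].
  by apply: vopen_lker0; smooth_tac oT.
exact: (openI H1 H2).
Qed.
Let oU := aut0_dom_open.

Lemma smooth_inv0 : smooth_on dom (fun A => A.1.1^-1%VF).
Proof. by apply: (smooth_on_inv_lfun oU) => [A []//|]; smooth_tac oU. Qed.

Lemma smooth_inv1 : smooth_on dom (fun A => A.1.2^-1%VF).
Proof. by apply: (smooth_on_inv_lfun oU) => [A []//|]; smooth_tac oU. Qed.

Lemma smooth_pull_d a : smooth_on dom (fun A => pull_d g A a).
Proof. have := smooth_inv0; rewrite /pull_d => H; smooth_tac oU. Qed.

Lemma smooth_pull00 x y : smooth_on dom (fun A => pull00 g A x y).
Proof. have := smooth_inv0; rewrite /pull00 => H; smooth_tac oU. Qed.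

Lemma smooth_pull01 x a : smooth_on dom (fun A => pull01 g A x a).
Proof.
have := smooth_inv1; have := smooth_pull_d a; rewrite /pull01 => H1 H2.
smooth_tac oU.
Qed.

Lemma smooth_pull_l3 x y z : smooth_on dom (fun A => pull_l3 g A x y z).
Proof.
have := smooth_inv1; have := smooth_pull00 x y; have := smooth_pull00 y z.
have := smooth_pull00 z x; rewrite /pull_l3 /cyc => H1 H2 H3 H4.
smooth_tac oU.
Qed.

Lemma smooth_pull_sym x y : smooth_on dom (fun A => pull_sym A x y).
Proof. have := smooth_inv1; rewrite /pull_sym => H; smooth_tac oU. Qed.

Lemma smooth_pull_hom x y : smooth_on dom (fun A => pull_hom A x y).
Proof. have := smooth_inv1; rewrite /pull_hom => H; smooth_tac oU. Qed.

Lemma pull_d_linear A : linear (pull_d g A).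
Proof. by move=> k u v; rewrite /pull_d !lfunLs. Qed.

Lemma pull00_linear A x : linear (pull00 g A x).
Proof. by move=> k u v; rewrite /pull00 !lfunLs; vring. Qed.

Lemma pull00_linearl A y : linear (fun x => pull00 g A x y).
Proof. by move=> k u v; rewrite /pull00 !lfunLs; vring. Qed.

Lemma pull01_linear A x : linear (pull01 g A x).
Proof. by move=> k u v; rewrite /pull01 pull_d_linear !lfunLs; vring. Qed.

Lemma pull01_linearl A y : linear (fun x => pull01 g A x y).
Proof. by move=> k u v; rewrite /pull01 !lfunLs; vring. Qed.

Lemma pull_l3_linear3 A x y : linear (fun z => pull_l3 g A x y z).
Proof.
move=> k u v; rewrite /pull_l3 /cyc pull00_linear pull00_linearl !lfunLs; vring.
Qed.

Lemma pull_l3_linear2 A x z : linear (fun y => pull_l3 g A x y z).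
Proof.
move=> k u v; rewrite /pull_l3 /cyc pull00_linear pull00_linearl !lfunLs; vring.
Qed.

Lemma pull_l3_linear1 A y z : linear (fun x => pull_l3 g A x y z).
Proof.
move=> k u v; rewrite /pull_l3 /cyc pull00_linear pull00_linearl !lfunLs; vring.
Qed.

Lemma pull_sym_linear A x : linear (pull_sym A x).
Proof. by move=> k u v; rewrite /pull_sym !lfunLs; vring. Qed.

Lemma pull_sym_linearl A y : linear (fun x => pull_sym A x y).
Proof. by move=> k u v; rewrite /pull_sym !lfunLs; vring. Qed.

Lemma pull_hom_linear A x : linear (pull_hom A x).
Proof. by move=> k u v; rewrite /pull_hom !lfunLs; vring. Qed.

Lemma pull_hom_linearl A y : linear (fun x => pull_hom A x y).
Proof. by move=> k u v; rewrite /pull_hom !lfunLs; vring. Qed.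

Local Notation W := ('Hom(g1, g0) * 'Hom(g0, 'Hom(g0, g0)) *
  'Hom(g0, 'Hom(g1, g1)) * 'Hom(g0, 'Hom(g0, 'Hom(g0, g1))) *
  'Hom(g0, 'Hom(g0, g1)))%type.

(** The map cutting out Aut^0 inside the invertible triples; skewness of [A.2] is an equation here
    too, since the ambient space allows arbitrary bilinear third components. *)
Definition defect A : W :=
  (linfun (pull_d g A) - d, bilin (pull00 g A) - br00 g,
   bilin (pull01 g A) - br01 g, trilin (pull_l3 g A) - l3 g, bilin (pull_sym A)).

Let E_d A a : linfun (pull_d g A) a = pull_d g A a.
Proof. exact: linfunE (pull_d_linear A) a. Qed.
Let E00 A x y : bilin (pull00 g A) x y = pull00 g A x y.
Proof. exact: bilinE (pull00_linear A) (pull00_linearl A) x y. Qed.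
Let E01 A x y : bilin (pull01 g A) x y = pull01 g A x y.
Proof. exact: bilinE (pull01_linear A) (pull01_linearl A) x y. Qed.
Let E3 A x y z : trilin (pull_l3 g A) x y z = pull_l3 g A x y z.
Proof.
exact: trilinE (pull_l3_linear3 A) (pull_l3_linear2 A) (pull_l3_linear1 A) x y z.
Qed.
Let Es A x y : bilin (pull_sym A) x y = pull_sym A x y.
Proof. exact: bilinE (pull_sym_linear A) (pull_sym_linearl A) x y. Qed.
Let Eh A x y : bilin (pull_hom A) x y = pull_hom A x y.
Proof. exact: bilinE (pull_hom_linear A) (pull_hom_linearl A) x y. Qed.

Lemma defect0 A : defect A = 0 <-> preserves g A.
Proof.
split=> [[/subr0_eq H1 /subr0_eq H2 /subr0_eq H3 /subr0_eq H4 H5]|[H1 H2 H3 H4 H5]].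
  split.
  - by move=> a; rewrite -H1 E_d.
  - by move=> x y; rewrite -H2 E00.
  - by move=> x y; rewrite -H3 E01.
  - by move=> x y z; rewrite -H4 E3.
  - by move=> x y; rewrite -Es H5 !zero_lfunE.
rewrite /defect; congr (_, _, _, _, _).
- by apply/eqP; rewrite subr_eq0; apply/eqP/lfunP => a; rewrite E_d H1.
- by apply/eqP; rewrite subr_eq0; apply/eqP/lfun2P => x y; rewrite E00 H2.
- by apply/eqP; rewrite subr_eq0; apply/eqP/lfun2P => x y; rewrite E01 H3.
- apply/eqP; rewrite subr_eq0; apply/eqP/lfun2P => x y; apply/lfunP => z.
  by rewrite E3 H4.
- by apply/lfun2P => x y; rewrite Es H5 !zero_lfunE.
Qed.

Lemma smooth_bilin (V U1 U2 U3 : vectType R) (Om : set V) (f : V -> U1 -> U2 -> U3) : vopen Om ->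
  (forall q x y, bilin (f q) x y = f q x y) ->
  (forall x y, smooth_on Om (fun q => f q x y)) -> smooth_on Om (fun q => bilin (f q)).
Proof.
move=> oOm fE H; apply: smooth_on_lfun => // x; apply: smooth_on_lfun => // y.
by apply: smooth_on_ext (H x y) => // q _; rewrite fE.
Qed.

Lemma smooth_defect : smooth_on dom defect.
Proof.
have H1 : smooth_on dom (fun A => linfun (pull_d g A)).
  by apply: (smooth_on_lfun oU) => a; exact: smooth_on_ext (smooth_pull_d a).
have H2 := smooth_bilin oU E00 smooth_pull00.
have H3 := smooth_bilin oU E01 smooth_pull01.
have H4 : smooth_on dom (fun A => trilin (pull_l3 g A)).
  apply: (smooth_on_lfun oU) => x; apply: (smooth_on_lfun oU) => y.
  apply: (smooth_on_lfun oU) => z.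
  exact: smooth_on_ext (smooth_pull_l3 x y z).
have H5 := smooth_bilin oU Es smooth_pull_sym.
by rewrite /defect; smooth_tac oU.
Qed.

Lemma stationary_defect (c : R -> T) : stationary (fun s => defect (c s)) <->
  [/\ forall a, stationary (fun s => pull_d g (c s) a),
      forall x y, stationary (fun s => pull00 g (c s) x y),
      forall x a, stationary (fun s => pull01 g (c s) x a),
      forall x y z, stationary (fun s => pull_l3 g (c s) x y z)
    & forall x y, stationary (fun s => pull_sym (c s) x y)].
Proof.
split=> [/stationary_pair[/stationary_pair[/stationary_pair[/stationary_pair[
    /stationary_subr H1 /stationary_subr H2] /stationary_subr H3]
    /stationary_subr H4] H5]|[H1 H2 H3 H4 H5]].
  split.
  - by move=> a; apply: is_vderive_ext (stationary_app a H1) => s; exact: E_d.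
  - move=> x y; apply: is_vderive_ext (stationary_app y (stationary_app x H2)) => s.
    exact: E00.
  - move=> x y; apply: is_vderive_ext (stationary_app y (stationary_app x H3)) => s.
    exact: E01.
  - move=> x y z.
    apply: is_vderive_ext (stationary_app z (stationary_app y (stationary_app x H4))) => s.
    exact: E3.
  - move=> x y; apply: is_vderive_ext (stationary_app y (stationary_app x H5)) => s.
    exact: Es.
apply/stationary_pair; split; first (apply/stationary_pair; split;
  first (apply/stationary_pair; split; first (apply/stationary_pair; split))).
- apply/stationary_subr/stationary_pointwise => a.
  by apply: is_vderive_ext (H1 a) => s; rewrite E_d.
- apply/stationary_subr/stationary_pointwise => x; apply/stationary_pointwise => y.
  by apply: is_vderive_ext (H2 x y) => s; rewrite E00.
- apply/stationary_subr/stationary_pointwise => x; apply/stationary_pointwise => y.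
  by apply: is_vderive_ext (H3 x y) => s; rewrite E01.
- apply/stationary_subr/stationary_pointwise => x; apply/stationary_pointwise => y.
  apply/stationary_pointwise => z.
  by apply: is_vderive_ext (H4 x y z) => s; rewrite E3.
- apply/stationary_pointwise => x; apply/stationary_pointwise => y.
  by apply: is_vderive_ext (H5 x y) => s; rewrite Es.
Qed.

(** Linearity in the left factor makes right translation its own derivative and sends the line
    [s *: X + 1] to the line [s *: tr X + B]. *)
Lemma aut0_mul_linear B : linear (fun A : T => aut0_mul A B).
Proof.
move=> k A C; apply: triple_eq => [/=|/=|x y].
- by rewrite comp_lfunDl comp_lfunZl.
- by rewrite comp_lfunDl comp_lfunZl.
- have E2 (C1 C2 : T) u v : (k *: C1 + C2).2 u v = k *: C1.2 u v + C2.2 u v.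
    by rewrite !add_lfunE !scale_lfunE.
  have E1 (C1 C2 : T) w : (k *: C1 + C2).1.2 w = k *: C1.1.2 w + C2.1.2 w.
    by rewrite add_lfunE scale_lfunE.
  by rewrite aut0_mul2E !E2 E1 !aut0_mul2E; vring.
Qed.

Lemma smooth_aut0_mul (V : vectType R) (Om : set V) (f h : V -> T) : vopen Om ->
  smooth_on Om f -> smooth_on Om h -> smooth_on Om (fun p => aut0_mul (f p) (h p)).
Proof.
move=> oOm Hf Hh; rewrite /aut0_mul; apply: (smooth_on_pair oOm).
  by smooth_tac oOm.
apply: (smooth_bilin oOm) => [p x y|x y]; last by smooth_tac oOm.
by have := aut0_mul2E (f p) (h p) x y.
Qed.

Section RightTranslation.
Variables (B : T) (dB : dom B).

Let tr : 'End(T) := linfun (fun A : T => aut0_mul A B).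
Let trE A : tr A = aut0_mul A B.
Proof. exact: linfunE (aut0_mul_linear B) A. Qed.

Lemma lker0_right_translation : lker tr == 0%VS.
Proof.
apply: (@lker0_left_inverse _ _ _ (linfun (fun A : T => aut0_mul A (aut0_inv B)))).
apply/lfunP => A; rewrite comp_lfunE id_lfunE trE (linfunE (aut0_mul_linear _)).
by rewrite -aut0_mulA aut0_mulV// aut0_mul1r.
Qed.

Lemma right_translation_line s X :
  s *: tr X + B = aut0_mul (s *: X + aut0_one g0 g1) B.
Proof. by rewrite trE aut0_mul_linear aut0_mul1l. Qed.

Lemma near_dom X : \forall s \near (0 : R), dom (s *: X + aut0_one g0 g1).
Proof. exact: near_line oU (@aut0_dom_one _ _ _). Qed.

Lemma stationary_translate (V : vectType R) X (u w : T -> V) :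
  (forall A, dom A -> w (aut0_mul A B) = u A) ->
  stationary (fun s => u (s *: X + aut0_one g0 g1)) ->
  stationary (fun s => w (s *: tr X + B)).
Proof.
move=> uw; apply: stationary_near.
by apply: filterS (near_dom X) => s ds; rewrite right_translation_line uw.
Qed.

(** The product rules are triangular: the one for [pull01] contains [pull_d] of the product, and the
    one for [pull_l3] contains [pull00] of the product. Stationarity of these two is therefore
    obtained beforehand. *)
Lemma stationary_translate_defect X :
  stationary (fun s => defect (s *: X + aut0_one g0 g1)) ->
  stationary (fun s => defect (s *: tr X + B)).
Proof.
move=> /stationary_defect[H1 H2 H3 H4 H5].
have K1 a : stationary (fun s => pull_d g (s *: tr X + B) a).
  apply: (stationary_translate (w := fun A => pull_d g A a)) => [A dA|].
    exact: pull_d_mul.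
  by apply: stationary_lfun; exact: H1.
have K2 x y : stationary (fun s => pull00 g (s *: tr X + B) x y).
  apply: (stationary_translate (w := fun A => pull00 g A x y)) => [A dA|].
    exact: pull00_mul.
  by apply: stationary_lfun; apply: stationaryD; [exact: H2|exact: H1].
have C1 a : stationary (fun s => pull_d g (aut0_mul (s *: X + aut0_one g0 g1) B) a).
  by apply: is_vderive_ext (K1 a) => s; rewrite right_translation_line.
have C2 x y : stationary (fun s => pull00 g (aut0_mul (s *: X + aut0_one g0 g1) B) x y).
  by apply: is_vderive_ext (K2 x y) => s; rewrite right_translation_line.
apply/stationary_defect; split => //.
- move=> x a; apply: (stationary_translate (w := fun A => pull01 g A x a)) => [A dA|].
    exact: pull01_mul.
  apply: stationary_lfun; apply: stationaryD; first exact: H3.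
  exact: stationary_lfun.
- move=> x y z; apply: (stationary_translate (w := fun A => pull_l3 g A x y z)) => [A dA|].
    exact: pull_l3_mul.
  apply: stationary_lfun; apply: stationaryD; last first.
    by rewrite /cyc; do 2?[apply: stationaryD]; apply: stationary_lfun.
  apply: stationaryD; last exact: H4.
  by rewrite /cyc; do 2?[apply: stationaryD]; exact: H3.
- move=> x y; apply: (stationary_translate (w := fun A => pull_sym A x y)) => [A dA|].
    exact: pull_sym_mul.
  by apply: stationary_lfun; apply: stationaryD; [exact: H5|exact: stationary_cst].
Qed.

Lemma stationary_translate_pull_hom X :
  stationary (fun s => bilin (pull_hom (s *: X + aut0_one g0 g1))) ->
  stationary (fun s => bilin (pull_hom (s *: tr X + B))).
Proof.
move=> H; apply/stationary_pointwise => x; apply/stationary_pointwise => y.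
have K u v : stationary (fun s => pull_hom (s *: X + aut0_one g0 g1) u v).
  by apply: is_vderive_ext (stationary_app v (stationary_app u H)) => s; exact: Eh.
have K2 : stationary (fun s => pull_hom (s *: tr X + B) x y).
  apply: (stationary_translate (w := fun A => pull_hom A x y)) => [A dA|].
    exact: pull_hom_mul.
  by apply: stationary_lfun; apply: stationaryD; [exact: K|exact: stationary_cst].
by apply: is_vderive_ext K2 => s; rewrite Eh.
Qed.

End RightTranslation.

Lemma aut0_submanifold : is_submanifold (aut0_set g).
Proof.
apply: (group_submanifold (G := Aut0 g) (Om := dom) (F := defect)) => //=.
- exact: aut0_is_group.
- by move=> A B C; rewrite aut0_mulA.
- exact: aut0_mul1r.
- move=> B; apply: smooth_aut0_mul; [exact: vopenT|exact/smooth_on_id/vopenT|].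
  exact: smooth_on_cst.
- exact: smooth_defect.
- by move=> A; rewrite defect0; exact: aut0_setE.
- move=> B dB; exists (linfun (fun A : T => aut0_mul A B)).
    exact: lker0_right_translation.
  by move=> X; exact: stationary_translate_defect.
Qed.

Lemma pull_hom0 A : dom A -> (bilin (pull_hom A) = 0 <-> A.2 = 0).
Proof.
move=> [A0 A1]; split=> [H|A20]; apply/lfun2P => x y.
  apply: (lker0P (lker0_inv A1)); rewrite !zero_lfunE lf0.
  by rewrite -[LHS]Eh H !zero_lfunE.
by rewrite Eh /pull_hom A20 !zero_lfunE lf0.
Qed.

Lemma saut0_mul A B : gset (SAut0 g) A -> gset (SAut0 g) B ->
  gset (SAut0 g) (aut0_mul A B).
Proof.
move=> [GA A2] [GB B2]; split.
  by have [_ GM _ _ _] := aut0_is_group g; exact: GM.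
by apply/lfun2P => x y; rewrite aut0_mul2E A2 B2 !zero_lfunE lf0 addr0.
Qed.

Lemma aut0_set_inv A : aut0_set g A -> aut0_set g (aut0_inv A).
Proof.
move=> /aut0_setE[dA pA]; have dV := aut0_dom_inv dA; apply/aut0_setE; split => //.
by apply/(preserves_mul dA pA dV); rewrite aut0_mulV//; exact: preserves_one.
Qed.

Lemma saut0_inv A : gset (SAut0 g) A -> gset (SAut0 g) (aut0_inv A).
Proof.
move=> [GA A2]; split; first exact: aut0_set_inv.
by apply/lfun2P => x y; rewrite aut0_inv2E A2 !zero_lfunE lf0 oppr0.
Qed.

Lemma saut0_is_group : is_group (SAut0 g).
Proof.
have [G1 GM GA GI GV] := aut0_is_group g.
split => /=.
- by split.
- by move=> A B HA HB; exact: saut0_mul.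
- by move=> *; exact: aut0_mulA.
- by move=> A _; rewrite aut0_mul1l aut0_mul1r.
- move=> A HA; exists (aut0_inv A); have [/aut0_setE[dA _] _] := HA.
  by split; [exact: saut0_inv|exact: aut0_mulV|exact: aut0_mulVl].
Qed.

Lemma saut0_submanifold : is_submanifold (gset (SAut0 g)).
Proof.
apply: (group_submanifold (G := SAut0 g) (Om := dom)
  (F := fun A => (defect A, bilin (pull_hom A)))) => //=.
- exact: saut0_is_group.
- by move=> A B C; rewrite aut0_mulA.
- exact: aut0_mul1r.
- move=> B; apply: smooth_aut0_mul; [exact: vopenT|exact/smooth_on_id/vopenT|].
  exact: smooth_on_cst.
- apply: (smooth_on_pair oU); first exact: smooth_defect.
  exact: (smooth_bilin oU Eh smooth_pull_hom).
- move=> A; split=> [[/aut0_setE[dA pA] A2]|[dA E]].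
    by split=> //; congr pair; [exact/defect0|exact/pull_hom0].
  have /defect0 pA := congr1 fst E; have A2 := congr1 snd E.
  by split; [exact/aut0_setE|exact/pull_hom0].
- move=> B dB; exists (linfun (fun A : T => aut0_mul A B)).
    exact: lker0_right_translation.
  move=> X /stationary_pair[H1 H2]; apply/stationary_pair; split.
    exact: stationary_translate_defect.
  exact: stationary_translate_pull_hom.
Qed.

Lemma aut0_ginv A : aut0_set g A -> ginv (Aut0 g) A = aut0_inv A.
Proof.
move=> GA; have /aut0_setE[dA _] := GA.
apply: (ginv_eq (aut0_is_group g)) => //; first exact: aut0_set_inv.
  exact: aut0_mulV.
exact: aut0_mulVl.
Qed.

Lemma saut0_ginv A : gset (SAut0 g) A -> ginv (SAut0 g) A = aut0_inv A.
Proof.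
move=> GA; have [/aut0_setE[dA _] _] := GA.
apply: (ginv_eq saut0_is_group) => //; first exact: saut0_inv.
  exact: aut0_mulV.
exact: aut0_mulVl.
Qed.

Lemma smooth_aut0_inv : smooth_on dom (@aut0_inv R g0 g1).
Proof.
have := smooth_inv0; have := smooth_inv1 => H0 H1.
rewrite /aut0_inv; apply: (smooth_on_pair oU); first by smooth_tac oU.
apply: (smooth_bilin oU) => [A x y|x y]; first by have := aut0_inv2E A x y.
by smooth_tac oU.
Qed.

Lemma smooth_on_submanifoldT (V V' : vectType R) (M : set V) (f : V -> V') :
  smooth_on setT f -> smooth_on_submanifold M f.
Proof.
by move=> Hf p _; exists setT, f; split => //; exact: vopenT.
Qed.

Lemma smooth_aut0_mul_pair :
  smooth_on setT (fun p : (T * T)%type => aut0_mul p.1 p.2).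
Proof.
have oT := @vopenT R (T * T)%type.
by apply: (smooth_aut0_mul oT); smooth_tac oT.
Qed.

Lemma aut0_lie_group : is_lie_group (Aut0 g).
Proof.
split; [exact: aut0_is_group|exact: aut0_submanifold| | ].
  exact: smooth_on_submanifoldT smooth_aut0_mul_pair.
move=> A /aut0_setE[dA _]; exists dom, (@aut0_inv R g0 g1).
by split => // [|x _ /aut0_ginv ->//]; exact: smooth_aut0_inv.
Qed.

Lemma saut0_lie_group : is_lie_group (SAut0 g).
Proof.
split; [exact: saut0_is_group|exact: saut0_submanifold| | ].
  exact: smooth_on_submanifoldT smooth_aut0_mul_pair.
move=> A [/aut0_setE[dA _] _]; exists dom, (@aut0_inv R g0 g1).
by split => // [|x _ /saut0_ginv ->//]; exact: smooth_aut0_inv.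
Qed.

End AutManifold.

(** * The group Aut^{-1} and its boundary map *)

Section Aut1Algebra.
Variables (R : realType) (g0 g1 : vectType R) (g : lie2_algebra g0 g1).
Local Notation d := (gdiff g).
Local Notation "[ x , y ]" := (br00 g x y).
Local Notation br := (br01 g).
Local Notation H := 'Hom(g0, g1).
Local Notation "s * t" := (aut1_mul g s t).
Local Notation P0 t := ((aut_bd g t).1.1).
Local Notation P1 t := ((aut_bd g t).1.2).
Implicit Types s t : H.

Lemma P0E t x : P0 t x = x + d (t x).
Proof. by rewrite /= add_lfunE id_lfunE comp_lfunE. Qed.

Lemma P1E t a : P1 t a = a + t (d a).
Proof. by rewrite /= add_lfunE id_lfunE comp_lfunE. Qed.

Lemma aut1_mulE s t x : (s * t) x = s x + t x + s (d (t x)).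
Proof. by rewrite /aut1_mul !add_lfunE !comp_lfunE. Qed.

Lemma aut_bd2E t x y :
  (aut_bd g t).2 x y = t [x, y] - br x (t y) + br y (t x) + br (d (t y)) (t x).
Proof.
rewrite /aut_bd /= bilinE ?/br10 ?opprK//.
- by move=> u k v w; rewrite !lfunLs; vring.
- by move=> u k v w; rewrite !lfunLs; vring.
Qed.

Lemma br_peiffer a b : br (d a) b = - br (d b) a.
Proof. by rewrite gdiff_peiffer. Qed.

Lemma br00_dr x a : [x, d a] = d (br x a).
Proof. by rewrite gdiff_br. Qed.

Lemma br00_dl x a : [d a, x] = - d (br x a).
Proof. by rewrite br00_skew gdiff_br. Qed.

(** Removes [l_3] from any expression in which one of its arguments is a boundary. *)
Lemma l3_jacobi x y a : l3 g x y (d a) = - br [x, y] a + br x (br y a) - br y (br x a).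
Proof.
by rewrite -[LHS]opprK -(jacobi001 g x y a) /br10 !lfN; vring.
Qed.

(** Valid for all [s] and [t], not only for units; this is what allows units to be recognised
    through the invertibility of their boundary. *)
Lemma aut_bd_mul s t : aut_bd g (s * t) = aut0_mul (aut_bd g s) (aut_bd g t).
Proof.
apply: triple_eq => [||x y].
- by apply/lfunP => x; rewrite aut0_mul11 comp_lfunE !P0E aut1_mulE !lfD; vring.
- by apply/lfunP => x; rewrite aut0_mul12 comp_lfunE !P1E aut1_mulE !lfD; vring.
rewrite aut0_mul2E !P0E P1E !aut_bd2E !aut1_mulE.
rewrite !(lfD, lfN, add_lfunE, opp_lfunE, br00_dr, br00_dl).
rewrite (br_peiffer (s y) (t x)) (br_peiffer (s (d (t y))) (t x)).
rewrite (br_peiffer (t x) (t y)) !lfN.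
vring.
Qed.

Lemma aut1_mulA r s t : r * (s * t) = r * s * t.
Proof. by apply/lfunP => x; rewrite !aut1_mulE !lfD; vring. Qed.

Lemma aut1_mul0r t : 0 * t = t.
Proof. by apply/lfunP => x; rewrite !aut1_mulE !zero_lfunE add0r addr0. Qed.

Lemma aut1_mulr0 t : t * 0 = t.
Proof. by apply/lfunP => x; rewrite !aut1_mulE !zero_lfunE !lf0 !addr0. Qed.

Lemma aut_bd0 : aut_bd g 0 = aut0_one g0 g1.
Proof.
apply: triple_eq => [||x y].
- by apply/lfunP => x; rewrite P0E zero_lfunE lf0 addr0 id_lfunE.
- by apply/lfunP => x; rewrite P1E zero_lfunE addr0 id_lfunE.
- by rewrite aut_bd2E /= !(zero_lfunE, lf0) oppr0 !addr0.
Qed.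

(** An open condition on [I + d t] and [I + t d]; [aut1_setE] identifies it with being a unit. *)
Definition aut1_dom : set H := [set t : H | aut0_dom (aut_bd g t)].

(** From [s * t = 0], that is [s (I + d t) = - t]. *)
Definition aut1_inv t : H := - (t \o (P0 t)^-1)%VF.

Lemma aut1_mulV t : aut1_dom t -> t * aut1_inv t = 0.
Proof.
move=> [t0 t1]; apply/lfunP => x; rewrite aut1_mulE zero_lfunE.
rewrite /aut1_inv !opp_lfunE !comp_lfunE !lfN.
have E := lker0_lfunVK t0 x; set y := (_^-1%VF x) in E *.
by rewrite -[in t x]E P0E lfD; vring.
Qed.

Lemma aut1_mulVl t : aut1_dom t -> aut1_inv t * t = 0.
Proof.
move=> [t0 t1]; apply/lfunP => x; rewrite aut1_mulE zero_lfunE.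
rewrite /aut1_inv !opp_lfunE !comp_lfunE addrAC -opprD -lfD -lfD -P0E.
by rewrite lker0_lfunK// addNr.
Qed.

Lemma aut1_dom0 : aut1_dom 0.
Proof. by rewrite /aut1_dom /= aut_bd0; exact: aut0_dom_one. Qed.

Lemma aut1_setE t : aut1_set g t <-> aut1_dom t.
Proof.
split=> [[s [ts st]]|dt]; last first.
  by exists (aut1_inv t); rewrite aut1_mulV// aut1_mulVl.
have E : aut0_mul (aut_bd g s) (aut_bd g t) = aut0_one g0 g1.
  by rewrite -aut_bd_mul st aut_bd0.
split; [apply: (@lker0_left_inverse _ _ _ (P0 s))|apply: (@lker0_left_inverse _ _ _ (P1 s))].
  by rewrite -aut0_mul11 E.
by rewrite -aut0_mul12 E.
Qed.

Lemma aut1_dom_mul s t : aut1_dom s -> aut1_dom t -> aut1_dom (s * t).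
Proof. by rewrite /aut1_dom /= aut_bd_mul => ds dt; exact: aut0_dom_mul. Qed.

Lemma aut1_dom_inv t : aut1_dom t -> aut1_dom (aut1_inv t).
Proof. by move=> dt; apply/aut1_setE; exists t; rewrite aut1_mulV// aut1_mulVl. Qed.

Lemma aut1_is_group : is_group (Aut1 g).
Proof.
split => /=.
- by apply/aut1_setE; exact: aut1_dom0.
- by move=> s t /aut1_setE ds /aut1_setE dt; apply/aut1_setE; exact: aut1_dom_mul.
- by move=> *; exact: aut1_mulA.
- by move=> t _; rewrite aut1_mul0r aut1_mulr0.
- move=> t /aut1_setE dt; exists (aut1_inv t); split.
  + by apply/aut1_setE; exact: aut1_dom_inv.
  + exact: aut1_mulV.
  + exact: aut1_mulVl.
Qed.

Lemma aut1_ginv t : aut1_dom t -> ginv (Aut1 g) t = aut1_inv t.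
Proof.
move=> dt; apply: (ginv_eq aut1_is_group); [exact/aut1_setE|..].
- exact/aut1_setE/aut1_dom_inv.
- exact: aut1_mulV.
- exact: aut1_mulVl.
Qed.

Lemma aut_bd_aut0 t : aut1_dom t -> aut0_set g (aut_bd g t).
Proof.
move=> [t0 t1].
have E2 := aut_bd2E t.
split; [exact/lker0_bijective|exact/lker0_bijective| | |split].
- move=> x y; rewrite !E2 (br_peiffer (t x) (t y)) (br00_skew g x y) lfN; vring.
- by apply/lfunP => a; rewrite !comp_lfunE P0E P1E lfD.
- move=> x y; rewrite !P0E E2 !(lfD, lfN, add_lfunE).
  by rewrite !br00_dr !br00_dl (br_peiffer (t x) (t y)) lfN; vring.
- move=> x a; rewrite P0E !P1E E2 -br00_dr !(lfD, lfN, add_lfunE).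
  by rewrite (br_peiffer a (t x)) (br_peiffer (t (d a)) (t x)); vring.
- move=> x y z.
  (* The plain terms [l_3(x, y, z)] cancel. Every other occurrence of [l_3] either lies under [d],
     where the Jacobi identity removes it, or has a boundary argument, where [l3_jacobi] does; what
     remains is matched by the Peiffer identity. *)
  rewrite /cyc !P0E P1E !E2.
  have l3c u v w : l3 g u v w = l3 g v w u by rewrite l3_skew12 -l3_skew23.
  have l3d : d (l3 g x y z) = - ([[x, y], z] + [[y, z], x] + [[z, x], y]).
    by rewrite jacobi000 opprK.
  rewrite !(lfD, lfN, add_lfunE, opp_lfunE) l3d !lfN !lfD.
  rewrite (l3c (d (t x)) y z) -(l3c z x (d (t y))) -(l3c z (d (t x)) (d (t y))).
  rewrite !l3_jacobi !br00_dr !br00_dl !lfN !opp_lfunE.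
  rewrite (br_peiffer (br z (t x)) (t y)) (br_peiffer (br y (t x)) (t z)).
  rewrite (br_peiffer (br x (t y)) (t z)) (br_peiffer (br (d (t x)) (t y)) (t z)).
  rewrite ?(br_peiffer (t z) (t x)) ?(br_peiffer (t z) (t y)) ?(br_peiffer (t y) (t x)) !lfN.
  vring.
Qed.

End Aut1Algebra.

(** * The action and the crossed module axioms *)

Section AutCrossedModule.
Variables (R : realType) (g0 g1 : vectType R) (g : lie2_algebra g0 g1).
Local Notation d := (gdiff g).
Local Notation "[ x , y ]" := (br00 g x y).
Local Notation br := (br01 g).
Local Notation T := (triple g0 g1).
Local Notation H := 'Hom(g0, g1).
Local Notation "s * t" := (aut1_mul g s t).
Local Notation P0 t := ((aut_bd g t).1.1).
Local Notation P1 t := ((aut_bd g t).1.2).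
Implicit Types (s t : H) (A B : T).

Lemma aut_actE A t x : aut_act A t x = A.1.2 (t (A.1.1^-1%VF x)).
Proof. by rewrite /aut_act !comp_lfunE. Qed.

Lemma aut0_comm A a : aut0_set g A -> A.1.1 (d a) = d (A.1.2 a).
Proof. by move=> [_ _ _ /lfunP/(_ a)]; rewrite !comp_lfunE. Qed.

Lemma aut_act_mul A s t : aut0_set g A ->
  aut_act A (s * t) = aut_act A s * aut_act A t.
Proof.
move=> GA; have /aut0_setE[[A0 A1] _] := GA; apply/lfunP => x.
by rewrite aut1_mulE !aut_actE aut1_mulE -aut0_comm// lker0_lfunK// !lfD.
Qed.

Lemma aut_act_comp A B t : aut0_set g A -> aut0_set g B ->
  aut_act (aut0_mul A B) t = aut_act A (aut_act B t).
Proof.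
move=> /aut0_setE[[A0 A1] _] /aut0_setE[[B0 B1] _]; apply/lfunP => x.
by rewrite !aut_actE aut0_mul11 aut0_mul12 comp_lfun_inv// !comp_lfunE.
Qed.

Lemma aut_act_one t : aut_act (aut0_one g0 g1) t = t.
Proof. by apply/lfunP => x; rewrite aut_actE /= inv_lfun1 !id_lfunE. Qed.

(** Equivariance of the boundary, multiplied by [A] on the right: in this form no third component of
    an inverse has to be expanded. *)
Lemma aut_bd_act A t : aut0_set g A ->
  aut0_mul (aut_bd g (aut_act A t)) A = aut0_mul A (aut_bd g t).
Proof.
move=> GA; have /aut0_setE[[A0 A1] _] := GA.
have [_ _ sA _ [H00 H01 _]] := GA.
have tE x : aut_act A t (A.1.1 x) = A.1.2 (t x) by rewrite aut_actE lker0_lfunK.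
apply: triple_eq => [||x y].
- by apply/lfunP => x; rewrite !aut0_mul11 !comp_lfunE !P0E tE lfD aut0_comm.
- by apply/lfunP => a; rewrite !aut0_mul12 !comp_lfunE !P1E -aut0_comm// tE lfD.
rewrite !aut0_mul2E P1E aut_bd2E !tE.
have -> : [A.1.1 x, A.1.1 y] = A.1.1 [x, y] - d (A.2 x y).
  by rewrite -(H00 x y) opprB addrC subrK.
have E u a : br (A.1.1 u) (A.1.2 a) = A.1.2 (br u a) - A.2 u (d a).
  by rewrite -(H01 u a) opprB addrC subrK.
rewrite -aut0_comm// !E !P0E aut_bd2E !lfD !lfN tE.
by rewrite !(lfD, lfN, add_lfunE) (sA (d (t x)) y) (sA (d (t x)) (d (t y))); vring.
Qed.

Lemma aut_bd_actE A t : aut0_set g A -> aut_bd g (aut_act A t) =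
  aut0_mul (aut0_mul A (aut_bd g t)) (aut0_inv A).
Proof.
move=> GA; have /aut0_setE[dA _] := GA.
by rewrite -aut_bd_act// -aut0_mulA aut0_mulV// aut0_mul1r.
Qed.

Lemma aut_act_dom A t : aut0_set g A -> aut1_dom g t -> aut1_dom g (aut_act A t).
Proof.
move=> GA dt; rewrite /aut1_dom /= aut_bd_actE//.
have /aut0_setE[dA _] := GA.
by apply: aut0_dom_mul; [exact: aut0_dom_mul|exact: aut0_dom_inv].
Qed.

(** The Peiffer identity is first checked as an equality with [s * t] after multiplication by [s] on
    the right, where the inverse in the action cancels. *)
Lemma aut_act_bd s t : aut1_dom g s -> aut_act (aut_bd g s) t = s * t * aut1_inv g s.
Proof.
move=> ds; have [s0 s1] := ds.
have E : aut_act (aut_bd g s) t * s = s * t.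
  apply/lfunP => x; rewrite !aut1_mulE !aut_actE addrAC -!lfD -P0E lker0_lfunK//.
  by rewrite P1E; vring.
by rewrite -E -aut1_mulA aut1_mulV// aut1_mulr0.
Qed.

Lemma aut_bd_inv t : aut1_dom g t -> aut_bd g (aut1_inv g t) = aut0_inv (aut_bd g t).
Proof.
move=> dt; rewrite -[LHS]aut0_mul1l -(aut0_mulVl dt) -aut0_mulA -aut_bd_mul.
by rewrite aut1_mulV// aut_bd0 aut0_mul1r.
Qed.

Lemma saut1_setE t : gset (SAut1 g) t <-> aut1_dom g t /\ (aut_bd g t).2 = 0.
Proof.
have E x y : (aut_bd g t).2 x y = t [x, y] -
    (br x (t y) + br10 g (t x) y + br10 g (t x) (d (t y))).
  by rewrite aut_bd2E /br10; vring.
split=> [[/aut1_setE dt H]|[dt H]]; split=> //.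
- by apply/lfun2P => x y; rewrite E H subrr !zero_lfunE.
- exact/aut1_setE.
- by move=> x y; apply/eqP; rewrite -subr_eq0 -E H !zero_lfunE.
Qed.

Lemma saut1_bd t : gset (SAut1 g) t <-> aut1_dom g t /\ gset (SAut0 g) (aut_bd g t).
Proof.
rewrite saut1_setE; split=> [[dt t2]|[dt [_ t2]]] //.
by split=> //; split=> //; exact: aut_bd_aut0.
Qed.

Lemma saut1_mul s t : gset (SAut1 g) s -> gset (SAut1 g) t -> gset (SAut1 g) (s * t).
Proof.
move=> /saut1_bd[ds Hs] /saut1_bd[dt Ht]; apply/saut1_bd; rewrite aut_bd_mul.
by split; [exact: aut1_dom_mul|exact: saut0_mul].
Qed.

Lemma saut1_inv t : gset (SAut1 g) t -> gset (SAut1 g) (aut1_inv g t).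
Proof.
move=> /saut1_bd[dt Ht]; apply/saut1_bd; rewrite aut_bd_inv//.
by split; [exact: aut1_dom_inv|exact: saut0_inv].
Qed.

Lemma saut1_act A t : gset (SAut0 g) A -> gset (SAut1 g) t ->
  gset (SAut1 g) (aut_act A t).
Proof.
move=> HA /saut1_bd[dt Ht]; have [GA _] := HA; apply/saut1_bd.
split; first exact: aut_act_dom.
rewrite aut_bd_actE//; apply: saut0_mul; first exact: saut0_mul.
exact: saut0_inv.
Qed.

Lemma saut1_is_group : is_group (SAut1 g).
Proof.
split => /=.
- by apply/saut1_setE; rewrite aut_bd0; split=> //; exact: aut1_dom0.
- by move=> s t; exact: saut1_mul.
- by move=> *; exact: aut1_mulA.
- by move=> t _; rewrite aut1_mul0r aut1_mulr0.
- move=> t Ht; have /saut1_bd[dt _] := Ht; exists (aut1_inv g t).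
  by split; [exact: saut1_inv|exact: aut1_mulV|exact: aut1_mulVl].
Qed.

Lemma saut1_ginv t : gset (SAut1 g) t -> ginv (SAut1 g) t = aut1_inv g t.
Proof.
move=> Ht; have /saut1_bd[dt _] := Ht; apply: (ginv_eq saut1_is_group) => //.
- exact: saut1_inv.
- exact: aut1_mulV.
- exact: aut1_mulVl.
Qed.

Lemma smooth_aut_bd (V : vectType R) (Om : set V) (f : V -> H) : vopen Om ->
  smooth_on Om f -> smooth_on Om (fun q => aut_bd g (f q)).
Proof.
move=> oOm Hf; rewrite /aut_bd; apply: (smooth_on_pair oOm).
  by smooth_tac oOm.
apply: (smooth_bilin oOm) => [q x y|x y]; first by rewrite [LHS]aut_bd2E /br10 !opprK.
rewrite /br10; smooth_tac oOm.
Qed.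

Lemma smooth_aut1_mul (V : vectType R) (Om : set V) (f h : V -> H) : vopen Om ->
  smooth_on Om f -> smooth_on Om h -> smooth_on Om (fun q => f q * h q).
Proof. by move=> oOm Hf Hh; rewrite /aut1_mul; smooth_tac oOm. Qed.

Lemma aut1_dom_open : vopen (aut1_dom g).
Proof.
apply: (vopen_preimage (@aut0_dom_open R g0 g1)).
by apply: (smooth_aut_bd (@vopenT _ _)); exact/smooth_on_id/vopenT.
Qed.

Lemma smooth_aut1_inv : smooth_on (aut1_dom g) (aut1_inv g).
Proof.
have oD := aut1_dom_open; have Hb := smooth_aut_bd oD (smooth_on_id oD).
have H1 : smooth_on (aut1_dom g) (fun t => (P0 t)^-1%VF).
  by apply: (smooth_on_inv_lfun oD) => [t []//|]; smooth_tac oD.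
rewrite /aut1_inv; smooth_tac oD.
Qed.

(** The derivative of right translation by [t]: the linear part of [s |-> s + t + s d t] is
    composition with [I + d t]. *)
Definition aut1_translation t : 'End(H) := linfun (fun s : H => (s \o P0 t)%VF).

Lemma aut1_translationE t s : aut1_translation t s = (s \o P0 t)%VF.
Proof. exact: linfunE (rmul_linear _) s. Qed.

Lemma aut1_translation_line t (e : R) s :
  e *: aut1_translation t s + t = (e *: s + 0) * t.
Proof.
apply/lfunP => x; rewrite aut1_mulE addr0 [LHS]add_lfunE scale_lfunE.
by rewrite aut1_translationE comp_lfunE P0E !scale_lfunE lfD; vring.
Qed.

Lemma lker0_aut1_translation t : aut1_dom g t -> lker (aut1_translation t) == 0%VS.
Proof.
move=> [t0 _]; apply: (@lker0_left_inverse _ _ _ (linfun (fun s : H => (s \o (P0 t)^-1)%VF))).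
apply/lfunP => s; rewrite comp_lfunE id_lfunE aut1_translationE.
by rewrite (linfunE (rmul_linear _)) lker0_compfK.
Qed.

(** The group is the whole open set [aut1_dom], hence the zero set there of the constant map 0. *)
Lemma aut1_submanifold : is_submanifold (aut1_set g).
Proof.
apply: (group_submanifold (W := H) (G := Aut1 g) (Om := aut1_dom g) (F := fun=> 0)) => //=.
- exact: aut1_is_group.
- by move=> *; rewrite aut1_mulA.
- exact: aut1_mulr0.
- move=> t; apply: (smooth_aut1_mul (@vopenT _ _)); first exact/smooth_on_id/vopenT.
  exact: smooth_on_cst.
- exact: aut1_dom_open.
- exact: smooth_on_cst.
- by move=> t; rewrite aut1_setE; split=> [|[]].
- move=> t dt; exists (aut1_translation t); first exact: lker0_aut1_translation.
  by move=> s _; exact: is_vderive_cst.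
Qed.

(** Since the boundary is multiplicative, the rule [pull_hom_mul] pulls back along it, and
    [pull_hom] of the boundary has the required transport of kernels. *)
Lemma saut1_submanifold : is_submanifold (gset (SAut1 g)).
Proof.
have oD := aut1_dom_open.
apply: (group_submanifold (G := SAut1 g) (Om := aut1_dom g)
  (F := fun t => bilin (pull_hom (aut_bd g t)))) => //=.
- exact: saut1_is_group.
- by move=> *; rewrite aut1_mulA.
- exact: aut1_mulr0.
- move=> t; apply: (smooth_aut1_mul (@vopenT _ _)); first exact/smooth_on_id/vopenT.
  exact: smooth_on_cst.
- apply: (smooth_bilin oD) => [t x y|x y].
    exact: bilinE (pull_hom_linear _) (pull_hom_linearl _) x y.
  have Hp : smooth_on (@aut0_dom R g0 g1) (fun A => pull_hom A x y).
    exact: smooth_pull_hom.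
  apply: (smooth_on_comp (f := aut_bd g) (h := fun A => pull_hom A x y) oD
    (@aut0_dom_open R g0 g1)) => //.
  exact: smooth_aut_bd oD (smooth_on_id oD).
- move=> t; have /= := saut1_setE t => ->.
  by split=> -[dt t2]; split=> //; exact/(pull_hom0 dt).
- move=> t dt; exists (aut1_translation t); first exact: lker0_aut1_translation.
  move=> X H0; apply/stationary_pointwise => x; apply/stationary_pointwise => y.
  have bE A u v : bilin (pull_hom A) u v = pull_hom A u v.
    exact: bilinE (pull_hom_linear _) (pull_hom_linearl _) u v.
  have K u v : stationary (fun e => pull_hom (aut_bd g (e *: X + 0)) u v).
    by apply: is_vderive_ext (stationary_app v (stationary_app u H0)) => e; exact: bE.
  have K2 : stationary (fun e : R => (P1 t)^-1%VF
      (pull_hom (aut_bd g (e *: X + 0)) (P0 t x) (P0 t y) + (aut_bd g t).2 x y)).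
    by apply: stationary_lfun; apply: stationaryD; [exact: K|exact: stationary_cst].
  apply: stationary_near K2.
  apply: filterS (near_line X oD (aut1_dom0 g)) => e de.
  by rewrite bE aut1_translation_line aut_bd_mul pull_hom_mul.
Qed.

Lemma smooth_aut1_mul_pair :
  smooth_on setT (fun p : (H * H)%type => p.1 * p.2).
Proof.
have oT := @vopenT R (H * H)%type.
by apply: (smooth_aut1_mul oT); smooth_tac oT.
Qed.

Lemma aut1_lie_group : is_lie_group (Aut1 g).
Proof.
split; [exact: aut1_is_group|exact: aut1_submanifold| | ].
  exact: smooth_on_submanifoldT smooth_aut1_mul_pair.
move=> t /aut1_setE dt; exists (aut1_dom g), (aut1_inv g).
split=> //; [exact: aut1_dom_open|exact: smooth_aut1_inv|].
by move=> s ds _; rewrite aut1_ginv.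
Qed.

Lemma saut1_lie_group : is_lie_group (SAut1 g).
Proof.
split; [exact: saut1_is_group|exact: saut1_submanifold| | ].
  exact: smooth_on_submanifoldT smooth_aut1_mul_pair.
move=> t /saut1_bd[dt _]; exists (aut1_dom g), (aut1_inv g).
split=> //; [exact: aut1_dom_open|exact: smooth_aut1_inv|].
by move=> s ds Hs; rewrite saut1_ginv.
Qed.

Lemma aut_act_smooth (M : set (T * H)) :
  (forall p, M p -> aut0_set g p.1) ->
  smooth_on_submanifold M (fun p : (T * H)%type => aut_act p.1 p.2).
Proof.
move=> MA p Mp; have /aut0_setE[dp _] := MA p Mp.
pose U := [set p : (T * H)%type | aut0_dom p.1].
have oT := @vopenT R (T * H)%type.
have oU : vopen U.
  apply: (vopen_preimage (f := fun p : (T * H)%type => p.1) (@aut0_dom_open R g0 g1)).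
  by smooth_tac oT.
exists U, (fun p : (T * H)%type => aut_act p.1 p.2); split => //.
have H1 : smooth_on U (fun p : (T * H)%type => p.1.1.1^-1%VF).
  by apply: (smooth_on_inv_lfun oU) => [q []//|]; smooth_tac oU.
by rewrite /aut_act; smooth_tac oU.
Qed.

Lemma aut_lie_xmod : is_lie_xmod (Aut g).
Proof.
split; [exact: aut1_lie_group|exact: aut0_lie_group|split|split|split] => /=.
- by move=> t /aut1_setE; exact: aut_bd_aut0.
- by move=> s t _ _; exact: aut_bd_mul.
- apply: smooth_on_submanifoldT; apply: (smooth_aut_bd (@vopenT _ _)).
  exact/smooth_on_id/vopenT.
- by move=> A t GA /aut1_setE dt; apply/aut1_setE; exact: aut_act_dom.
- by move=> t _; exact: aut_act_one.
- by move=> A B t GA GB _; exact: aut_act_comp.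
- by move=> A s t GA _ _; exact: aut_act_mul.
- by apply: aut_act_smooth => p [].
- by move=> A t GA _; rewrite aut_bd_actE// aut0_ginv.
- by move=> s t /aut1_setE ds _; rewrite aut_act_bd// aut1_ginv.
Qed.

Lemma saut_lie_xmod : is_lie_xmod (SAut g).
Proof.
split; [exact: saut1_lie_group|exact: saut0_lie_group|split|split|split] => /=.
- by move=> t /saut1_bd[].
- by move=> s t _ _; exact: aut_bd_mul.
- apply: smooth_on_submanifoldT; apply: (smooth_aut_bd (@vopenT _ _)).
  exact/smooth_on_id/vopenT.
- by move=> A t GA Ht; exact: saut1_act.
- by move=> t _; exact: aut_act_one.
- by move=> A B t [GA _] [GB _] _; exact: aut_act_comp.
- by move=> A s t [GA _] _ _; exact: aut_act_mul.
- by apply: aut_act_smooth => p [[]].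
- by move=> A t GA _; have [GA' _] := GA; rewrite aut_bd_actE// saut0_ginv.
- by move=> s t Hs _; have /saut1_bd[ds _] := Hs; rewrite aut_act_bd// saut1_ginv.
Qed.

Lemma saut_sub_lie_xmod : is_sub_lie_xmod (SAut g) (Aut g).
Proof.
split; [exact: saut_lie_xmod|exact: aut_lie_xmod| | |by []].
- by split=> //= t [].
- by split=> //= A [].
Qed.

End AutCrossedModule.

(** * The crossed modules Der and SDer *)

Section DerCrossedModule.
Variables (R : realType) (g0 g1 : vectType R) (g : lie2_algebra g0 g1).
Local Notation d := (gdiff g).
Local Notation "[ x , y ]" := (br00 g x y).
Local Notation br := (br01 g).
Local Notation T := (triple g0 g1).
Implicit Types X Y Z : T.

Lemma lie_derE X (w : 'Hom(g0, 'Hom(g0, g1))) x y :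
  lie_der X w x y = X.1.2 (w x y) - w (X.1.1 x) y - w x (X.1.1 y).
Proof.
by rewrite /lie_der bilinE// => u k v z; rewrite !lfunLs; vring.
Qed.

Lemma der0_br11E X Y x : (der0_br X Y).1.1 x = X.1.1 (Y.1.1 x) - Y.1.1 (X.1.1 x).
Proof. by rewrite /= add_lfunE opp_lfunE !comp_lfunE. Qed.

Lemma der0_br12E X Y x : (der0_br X Y).1.2 x = X.1.2 (Y.1.2 x) - Y.1.2 (X.1.2 x).
Proof. by rewrite /= add_lfunE opp_lfunE !comp_lfunE. Qed.

Lemma der0_br2E X Y x y : (der0_br X Y).2 x y =
  X.1.2 (Y.2 x y) - Y.2 (X.1.1 x) y - Y.2 x (X.1.1 y) -
  (Y.1.2 (X.2 x y) - X.2 (Y.1.1 x) y - X.2 x (Y.1.1 y)).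
Proof. by rewrite /= !add_lfunE !opp_lfunE !lie_derE. Qed.

Definition der0_brE := (der0_br11E, der0_br12E, der0_br2E).

Lemma triple_eqP X Y : (forall x, X.1.1 x = Y.1.1 x) -> (forall a, X.1.2 a = Y.1.2 a) ->
  (forall x y, X.2 x y = Y.2 x y) -> X = Y.
Proof. by move=> /lfunP E0 /lfunP E1; apply: triple_eq. Qed.

Lemma tripleL11 (k : R) X Y x : (k *: X + Y).1.1 x = k *: X.1.1 x + Y.1.1 x.
Proof. by rewrite add_lfunE scale_lfunE. Qed.

Lemma tripleL12 (k : R) X Y x : (k *: X + Y).1.2 x = k *: X.1.2 x + Y.1.2 x.
Proof. by rewrite add_lfunE scale_lfunE. Qed.

Lemma tripleL2 (k : R) X Y x y : (k *: X + Y).2 x y = k *: X.2 x y + Y.2 x y.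
Proof. by rewrite !add_lfunE !scale_lfunE. Qed.

Definition tripleLE := (tripleL11, tripleL12, tripleL2).

Lemma der0_setE X : der0_set g X <->
  [/\ skew2 X.2, forall a, X.1.1 (d a) = d (X.1.2 a),
      forall x y, d (X.2 x y) = X.1.1 [x, y] - [X.1.1 x, y] - [x, X.1.1 y],
      forall x a, X.1.2 (br x a) = X.2 x (d a) + br (X.1.1 x) a + br x (X.1.2 a)
    & forall x y z, X.1.2 (l3 g x y z) =
        cyc (fun x y z => X.2 x [y, z] + br x (X.2 y z) + l3 g (X.1.1 x) y z) x y z].
Proof.
split=> -[H1 H2 H3 H4 H5]; split=> //.
- by move=> a; have /lfunP/(_ a) := H2; rewrite !comp_lfunE.
- by move=> x a; rewrite H4; vring.
- by apply/lfunP => a; rewrite !comp_lfunE.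
- by move=> x a; rewrite H4; vring.
Qed.

Lemma der0_set0 : der0_set g 0.
Proof.
apply/der0_setE; split=> /=.
- by move=> x y; rewrite !zero_lfunE oppr0.
- by move=> a; rewrite !zero_lfunE lf0.
- by move=> x y; rewrite !(zero_lfunE, lf0) !subr0.
- by move=> x a; rewrite !(zero_lfunE, lf0) !addr0.
- by move=> x y z; rewrite /cyc !(zero_lfunE, lf0) !addr0.
Qed.

Lemma der0_set_lin k X Y : der0_set g X -> der0_set g Y -> der0_set g (k *: X + Y).
Proof.
move=> /der0_setE[X1 X2 X3 X4 X5] /der0_setE[Y1 Y2 Y3 Y4 Y5]; apply/der0_setE.
split.
- by move=> x y; rewrite !tripleLE (X1 x) (Y1 x); vring.
- by move=> a; rewrite !tripleLE X2 Y2 !lfunLs.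
- by move=> x y; rewrite !tripleLE !lfunLs X3 Y3; vring.
- by move=> x a; rewrite !tripleLE !lfunLs X4 Y4; vring.
- by move=> x y z; rewrite /cyc !tripleLE !lfunLs X5 Y5 /cyc; vring.
Qed.

Lemma l3_rot x y z : l3 g x y z = l3 g y z x.
Proof. by rewrite l3_skew12 -l3_skew23. Qed.

Lemma der0_br_closed X Y : der0_set g X -> der0_set g Y -> der0_set g (der0_br X Y).
Proof.
move=> /der0_setE[X1 X2 X3 X4 X5] /der0_setE[Y1 Y2 Y3 Y4 Y5]; apply/der0_setE.
split.
- move=> x y; rewrite !der0_brE (X1 x y) (Y1 x y) (X1 (Y.1.1 x)) (X1 x (Y.1.1 y)).
  by rewrite (Y1 (X.1.1 x)) (Y1 x (X.1.1 y)) !lfN; vring.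
- by move=> a; rewrite !der0_brE X2 Y2 X2 Y2 lfD lfN.
- move=> x y; rewrite !der0_brE !(lfD, lfN) -X2 -Y2 !X3 !Y3 !(lfD, lfN).
  by rewrite !(add_lfunE, opp_lfunE); vring.
- move=> x a; rewrite !der0_brE X2 Y2 X4 Y4 !(lfD, lfN, add_lfunE, opp_lfunE).
  by rewrite !X4 !Y4; vring.
- move=> x y z; rewrite /cyc !der0_brE X5 Y5 /cyc !(lfD, lfN, add_lfunE, opp_lfunE).
  rewrite !X4 !Y4 !X5 !Y5 /cyc !X3 !Y3 !(lfD, lfN, add_lfunE, opp_lfunE).
  (* Values of [l_3] are atoms for [vring], so the mixed terms in [X] and [Y] are brought to a
     common cyclic order. *)
  rewrite (l3_rot (X.1.1 z) (Y.1.1 x) y) (l3_rot (X.1.1 x) (Y.1.1 y) z).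
  rewrite (l3_rot (X.1.1 y) (Y.1.1 z) x) -(l3_rot (Y.1.1 x) (X.1.1 y) z).
  rewrite -(l3_rot (Y.1.1 y) (X.1.1 z) x) -(l3_rot (Y.1.1 z) (X.1.1 x) y).
  vring.
Qed.

Lemma der0_br_lin k X Y Z : der0_br (k *: X + Y) Z = k *: der0_br X Z + der0_br Y Z.
Proof.
apply: triple_eqP => [x|x|x y]; rewrite !tripleLE !der0_brE !tripleLE !lfunLs; vring.
Qed.

Lemma der0_brxx X : der0_br X X = 0.
Proof. by rewrite /der0_br !subrr. Qed.

Lemma der0_br_skew X Y : der0_br X Y = - der0_br Y X.
Proof. by rewrite /der0_br /=; congr (_, _, _); rewrite /= opprB. Qed.

Lemma der0_br_linr k X Y Z : der0_br Z (k *: X + Y) = k *: der0_br Z X + der0_br Z Y.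
Proof.
by rewrite der0_br_skew der0_br_lin opprD -scalerN -!der0_br_skew.
Qed.

Lemma der0_jacobi X Y Z :
  der0_br X (der0_br Y Z) + der0_br Y (der0_br Z X) + der0_br Z (der0_br X Y) = 0.
Proof.
have E11 U V x : (U + V : T).1.1 x = U.1.1 x + V.1.1 x by rewrite add_lfunE.
have E12 U V x : (U + V : T).1.2 x = U.1.2 x + V.1.2 x by rewrite add_lfunE.
have E2 U V x y : (U + V : T).2 x y = U.2 x y + V.2 x y by rewrite !add_lfunE.
apply: triple_eqP => [x|x|x y].
- by rewrite !E11 !der0_brE !(lfD, lfN) zero_lfunE; vring.
- by rewrite !E12 !der0_brE !(lfD, lfN) zero_lfunE; vring.
- rewrite !E2 !der0_br2E !der0_brE !(lfD, lfN, add_lfunE, opp_lfunE) !zero_lfunE.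
  vring.
Qed.

Lemma der0_is_lie_algebra : is_lie_algebra (xl0 (Der g)).
Proof.
split=> /=.
- by split; [exact: der0_set0|move=> k X Y; exact: der0_set_lin].
- exact: der0_br_closed.
- by move=> k X Y Z _ _ _; rewrite der0_br_lin der0_br_linr.
- by move=> X _; exact: der0_brxx.
- by move=> X Y Z _ _ _; exact: der0_jacobi.
Qed.

End DerCrossedModule.

(** * The boundary of Der and the strict sub-crossed module *)

Section DerBoundary.
Variables (R : realType) (g0 g1 : vectType R) (g : lie2_algebra g0 g1).
Local Notation d := (gdiff g).
Local Notation "[ x , y ]" := (br00 g x y).
Local Notation br := (br01 g).
Local Notation T := (triple g0 g1).
Local Notation H := 'Hom(g0, g1).
Implicit Types (s t : H) (X Y Z : T).

Lemma der1_brE s t x : der1_br g s t x = s (d (t x)) - t (d (s x)).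
Proof. by rewrite /der1_br add_lfunE opp_lfunE !comp_lfunE. Qed.

Lemma der1_is_lie_algebra : is_lie_algebra (xl1 (Der g)).
Proof.
split=> //=.
- move=> k s t u _ _ _; split; apply/lfunP => x.
    by rewrite !(der1_brE, add_lfunE, scale_lfunE, lfD, lfZ); vring.
  by rewrite !(der1_brE, add_lfunE, scale_lfunE, lfD, lfZ); vring.
- by move=> s _; rewrite /der1_br subrr.
- move=> s t u _ _ _; apply/lfunP => x.
  by rewrite !(der1_brE, add_lfunE, lfD, lfN) zero_lfunE; vring.
Qed.

Lemma der_bd11E t x : (der_bd g t).1.1 x = d (t x).
Proof. by rewrite /= comp_lfunE. Qed.

Lemma der_bd12E t a : (der_bd g t).1.2 a = t (d a).
Proof. by rewrite /= comp_lfunE. Qed.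

Lemma der_bd2E t x y : (der_bd g t).2 x y = t [x, y] - br x (t y) + br y (t x).
Proof.
by rewrite /der_bd /= bilinE ?/br10 ?opprK// => u k v w; rewrite !lfunLs; vring.
Qed.

Definition der_bdE := (der_bd11E, der_bd12E, der_bd2E).

Lemma der_bd_der0 t : der0_set g (der_bd g t).
Proof.
apply/der0_setE; split.
- by move=> x y; rewrite !der_bdE (br00_skew g x y) lfN; vring.
- by move=> a; rewrite !der_bdE.
- by move=> x y; rewrite !der_bdE !(lfD, lfN) !br00_dr !br00_dl; vring.
- by move=> x a; rewrite !der_bdE !br00_dr (br_peiffer g a (t x)); vring.
- move=> x y z; rewrite /cyc !der_bdE.
  have -> : d (l3 g x y z) = - ([[x, y], z] + [[y, z], x] + [[z, x], y]).
    by rewrite jacobi000 opprK.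
  (* Each remaining [l_3] has a boundary argument, rotated into last place so that [l3_jacobi]
     applies. *)
  rewrite (l3_rot g (d (t x))) (l3_rot g (d (t y))) (l3_rot g (d (t z))) !l3_jacobi.
  rewrite !(br00_skew g x [y, z]) !(br00_skew g y [z, x]) !(br00_skew g z [x, y]).
  rewrite !(lfD, lfN); vring.
Qed.

Lemma der_bd_lin k s t : der_bd g (k *: s + t) = k *: der_bd g s + der_bd g t.
Proof.
apply: triple_eqP => [x|x|x y]; rewrite !tripleLE !der_bdE;
  rewrite !(add_lfunE, scale_lfunE, lfD, lfZ); vring.
Qed.

Lemma der_bd_br s t : der_bd g (der1_br g s t) = der0_br (der_bd g s) (der_bd g t).
Proof.
apply: triple_eqP => [x|x|x y]; rewrite !der0_brE !der_bdE !der1_brE.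
- by rewrite lfD lfN.
- by [].
rewrite !(lfD, lfN) !br00_dr !br00_dl !(lfD, lfN).
rewrite (br_peiffer g (t y) (s x)) (br_peiffer g (t x) (s y)).
vring.
Qed.

Lemma der_actE X t x : der_act X t x = X.1.2 (t x) - t (X.1.1 x).
Proof. by rewrite /der_act add_lfunE opp_lfunE !comp_lfunE. Qed.

Lemma der_act_bd s t : der_act (der_bd g s) t = der1_br g s t.
Proof. by apply/lfunP => x; rewrite der_actE !der_bdE der1_brE. Qed.

Lemma der_bd_act X t : der0_set g X -> der_bd g (der_act X t) = der0_br X (der_bd g t).
Proof.
move=> /der0_setE[X1 X2 X3 X4 X5].
apply: triple_eqP => [x|x|x y]; rewrite !der0_brE !der_bdE !der_actE.
- by rewrite lfD lfN X2.
- by rewrite X2.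
rewrite !(lfD, lfN) !X4 X3 !(lfD, lfN) (X1 (d (t x)) y).
vring.
Qed.

Lemma der_is_lie_algebra_xmod : is_lie_algebra_xmod (Der g).
Proof.
split; [exact: der1_is_lie_algebra|exact: der0_is_lie_algebra|split|split|split] => /=.
- by move=> t _; exact: der_bd_der0.
- by move=> k s t _ _; exact: der_bd_lin.
- by move=> s t _ _; exact: der_bd_br.
- by [].
- move=> k X s t _ _ _; apply/lfunP => x.
  by rewrite !(der_actE, add_lfunE, scale_lfunE, lfD, lfZ); vring.
- move=> k X Y t _ _ _; apply/lfunP => x.
  by rewrite [RHS]add_lfunE scale_lfunE !der_actE !tripleLE !(lfD, lfZ); vring.
- move=> X s t /der0_setE[_ X2 _ _ _] _ _; apply/lfunP => x.
  by rewrite [RHS]add_lfunE !der_actE !der1_brE !der_actE !(lfD, lfN) -!X2; vring.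
- move=> X Y t _ _ _; apply/lfunP => x.
  by rewrite [RHS]add_lfunE opp_lfunE !der_actE !der0_brE !(lfD, lfN); vring.
- by move=> X t GX _; exact: der_bd_act.
- by move=> s t _ _; exact: der_act_bd.
Qed.

Lemma sder1_setE t : lset (xl1 (SDer g)) t <-> (der_bd g t).2 = 0.
Proof.
have E x y : (der_bd g t).2 x y = t [x, y] - (br x (t y) + br10 g (t x) y).
  by rewrite der_bd2E /br10; vring.
split=> [H0|H0 x y].
  by apply/lfun2P => x y; rewrite E H0 subrr !zero_lfunE.
by apply/eqP; rewrite -subr_eq0 -E H0 !zero_lfunE.
Qed.

Lemma der0_br2_strict X Y : X.2 = 0 -> Y.2 = 0 -> (der0_br X Y).2 = 0.
Proof.
move=> X2 Y2; apply/lfun2P => x y.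
by rewrite der0_br2E X2 Y2 !(zero_lfunE, lf0) !subr0.
Qed.

Lemma triple2_lin k X Y : X.2 = 0 -> Y.2 = 0 -> (k *: X + Y).2 = 0.
Proof. by move=> X2 Y2; rewrite /= X2 Y2 scaler0 addr0. Qed.

Lemma sder_sub_lie_algebra_xmod : is_sub_lie_algebra_xmod (SDer g) (Der g).
Proof.
have [[[_ A1] A2 A3 A4 A5] [[B0 B1] B2 B3 B4 B5] [C1 C2 C3] [D1 D2 D3 D4 D5] [E1 E2]] :=
  der_is_lie_algebra_xmod.
have bd0 : der_bd g 0 = 0.
  apply: triple_eqP => [x|x|x y]; rewrite !der_bdE !(zero_lfunE, lf0)//.
  by rewrite oppr0 !addr0.
split; [split|exact: der_is_lie_algebra_xmod|by []|by split=> // X []|by []].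
- split.
  + split; first by apply/sder1_setE; rewrite bd0.
    move=> k s t /sder1_setE Hs /sder1_setE Ht; apply/sder1_setE.
    by rewrite der_bd_lin; exact: triple2_lin.
  + move=> s t /sder1_setE Hs /sder1_setE Ht; apply/sder1_setE.
    by rewrite der_bd_br; exact: der0_br2_strict.
  + by move=> k s t u _ _ _; exact: A3.
  + by move=> s _; exact: A4.
  + by move=> s t u _ _ _; exact: A5.
- split.
  + split; first by split.
    by move=> k X Y [GX X2] [GY Y2]; split; [exact: B1|exact: triple2_lin].
  + by move=> X Y [GX X2] [GY Y2]; split; [exact: B2|exact: der0_br2_strict].
  + by move=> k X Y Z [GX _] [GY _] [GZ _]; exact: B3.
  + by move=> X [GX _]; exact: B4.
  + by move=> X Y Z [GX _] [GY _] [GZ _]; exact: B5.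
- split.
  + by move=> t /sder1_setE Ht; split=> //; exact: der_bd_der0.
  + by move=> k s t _ _; exact: C2.
  + by move=> s t _ _; exact: C3.
- split.
  + move=> X t [GX X2] /sder1_setE Ht; apply/sder1_setE.
    by rewrite der_bd_act//; exact: der0_br2_strict.
  + by move=> k X s t [GX _] _ _; exact: D2.
  + by move=> k X Y t [GX _] [GY _] _; exact: D3.
  + by move=> X s t [GX _] _ _; exact: D4.
  + by move=> X Y t [GX _] [GY _] _; exact: D5.
- split; first by move=> X t [GX _] _; exact: E1.
  by move=> s t _ _; exact: E2.
Qed.

End DerBoundary.

(** * Differentiation *)

Section OneParameterSubgroups.
Variable R : realType.
Implicit Types V W : vectType R.

Lemma Ck_dilate (W : normedModType R) k (f : R -> W) (a : R) :
  Ck k f setT -> Ck k (fun s => f (a * s)) setT.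
Proof.
have dm s : is_derive s (1 : R) (fun s => a * s) a.
  rewrite (_ : (fun s => a * s) = a \*: id)//.
  by apply: is_derive_eq; rewrite scaler1.
elim: k f => [|k IH] f.
  move=> cf s _; apply: continuous_comp; last exact: cf.
  apply: differentiable_continuous; apply/derivable1_diffP.
  by case: (dm s).
move=> [df Df].
have dd s : differentiable (fun s : R => a * s) s.
  by apply/derivable1_diffP; case: (dm s).
split=> [s _|v]; first by apply: differentiable_comp => //; exact: df.
have oT : open (setT : set R) by exact: openT.
apply: (Ck_ext oT _ (IH _ (Df (a * v)))) => s _.
rewrite /derive; congr (lim _); apply/funext => A /=.
congr (nbhs _ _); apply/funext => h /=.
have E : h *: (a * v) + a * s = a * (h *: v + s).
  by rewrite -[h *: (a * v)]/(h * (a * v)) -[h *: v]/(h * v); ring.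
by rewrite E.
Qed.

(** Combined with [c (s + t) = c s * c t], this reduces the derivative of a one-parameter subgroup
    at any time to its derivative at 0. *)
Lemma is_vderive_shift V (c : R -> V) t v :
  is_vderive (fun s => c (s + t)) 0 v -> is_vderive c t v.
Proof.
move=> H; have E : 1 * t + - t = 0 by rewrite mul1r subrr.
rewrite -E in H; have := is_vderive_affine H; rewrite scale1r.
by apply: is_vderive_ext => s; rewrite mul1r subrK.
Qed.

Lemma is_vderive_shiftr V (c : R -> V) t u v :
  is_vderive c (t + u) v -> is_vderive (fun s => c (s + u)) t v.
Proof.
move=> H; rewrite -[t in t + u]mul1r in H.
have := is_vderive_affine H; rewrite scale1r; apply: is_vderive_ext => s.
by rewrite mul1r.
Qed.

Lemma is_vderive_dilate V (c : R -> V) (a : R) v :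
  is_vderive c 0 v -> is_vderive (fun s => c (a * s)) 0 (a *: v).
Proof.
move=> H; have E : a * 0 + 0 = 0 by rewrite mulr0 addr0.
rewrite -E in H; have := is_vderive_affine H.
by apply: is_vderive_ext => s; rewrite addr0.
Qed.

Lemma is_vderive_opp V (c : R -> V) v :
  is_vderive c 0 v -> is_vderive (fun s => c (- s)) 0 (- v).
Proof.
move=> /(is_vderive_dilate (-1)); rewrite scaleN1r.
by apply: is_vderive_ext => s; rewrite mulN1r.
Qed.

Lemma one_parameter_dilate V (G : group_data V) X c (a : R) :
  is_one_parameter_subgroup G X c ->
  is_one_parameter_subgroup G (a *: X) (fun s => c (a * s)).
Proof.
move=> [Gc cD Cc dc]; split.
- by move=> t; exact: Gc.
- by move=> s t; rewrite mulrDr cD.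
- by move=> k; exact: Ck_dilate (Cc k).
- exact: is_vderive_dilate.
Qed.

Lemma one_parameter0 V (G : group_data V) X c : is_group G ->
  is_one_parameter_subgroup G X c -> c 0 = gone G.
Proof.
move=> [G1 GM GA GI GV] [Gc cD _ _]; have [y [Gy _ yc]] := GV _ (Gc 0).
have := GA y (c 0) (c 0) Gy (Gc 0) (Gc 0).
by rewrite -cD addr0 yc (GI _ (Gc 0)).1.
Qed.

(** [lexp] evaluates some one-parameter subgroup at time 1. Uniqueness makes the choice irrelevant,
    and dilation of time turns [c] into the subgroup of [t *: X]. *)
Lemma lexp_one_parameter V (G : group_data V) X c :
  (forall Y c1 c2, is_one_parameter_subgroup G Y c1 ->
     is_one_parameter_subgroup G Y c2 -> c1 =1 c2) ->
  is_one_parameter_subgroup G X c -> forall t, lexp G (t *: X) = c t.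
Proof.
move=> uniq Hc t; rewrite /lexp; set P := [set x | _].
have : P (xget (gone G) P).
  by apply: xgetPex; exists (c (t * 1)); exists (fun s => c (t * s)) => //;
     exact: one_parameter_dilate.
move=> [c' Hc' ->]; rewrite (uniq _ _ _ Hc' (one_parameter_dilate t Hc)).
by rewrite mulr1.
Qed.

End OneParameterSubgroups.

(** * One-parameter subgroups and Lie algebra of SAut^0 *)

Section StrictOneParameter.
Variables (R : realType) (g0 g1 : vectType R) (g : lie2_algebra g0 g1).
Local Notation d := (gdiff g).
Local Notation "[ x , y ]" := (br00 g x y).
Local Notation br := (br01 g).
Local Notation T := (triple g0 g1).
Implicit Types (s t : R) (X Y Z : T).

Lemma sder0_setE X : lset (xl0 (SDer g)) X <->
  [/\ X.2 = 0, forall a, X.1.1 (d a) = d (X.1.2 a),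
      forall x y, X.1.1 [x, y] = [X.1.1 x, y] + [x, X.1.1 y],
      forall x a, X.1.2 (br x a) = br (X.1.1 x) a + br x (X.1.2 a)
    & forall x y z, X.1.2 (l3 g x y z) =
        l3 g (X.1.1 x) y z + l3 g x (X.1.1 y) z + l3 g x y (X.1.1 z)].
Proof.
split=> [[/der0_setE[H1 H2 H3 H4 H5] X2]|[X2 H2 H3 H4 H5]].
  split=> //.
  - move=> x y; have := H3 x y; rewrite X2 !zero_lfunE lf0 => /esym/eqP.
    by rewrite subr_eq0 subr_eq addrC => /eqP.
  - by move=> x a; rewrite H4 X2 !zero_lfunE add0r.
  - move=> x y z; rewrite H5 /cyc X2 !(zero_lfunE, lf0) !add0r.
    by rewrite (l3_rot g x (X.1.1 y)) (l3_rot g x y) (l3_rot g y); vring.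
split=> //; apply/der0_setE; split=> //.
- by move=> x y; rewrite X2 !zero_lfunE oppr0.
- by move=> x y; rewrite X2 !zero_lfunE lf0 H3; vring.
- by move=> x a; rewrite X2 !zero_lfunE H4 add0r.
- move=> x y z; rewrite H5 /cyc X2 !(zero_lfunE, lf0) !add0r.
  by rewrite (l3_rot g x (X.1.1 y)) (l3_rot g x y) (l3_rot g y); vring.
Qed.

Lemma saut0_setE (A : T) : gset (SAut0 g) A <->
  [/\ A.2 = 0, aut0_dom A, forall a, A.1.1 (d a) = d (A.1.2 a),
      forall x y, A.1.1 [x, y] = [A.1.1 x, A.1.1 y] &
   [/\ forall x a, A.1.2 (br x a) = br (A.1.1 x) (A.1.2 a)
    & forall x y z, A.1.2 (l3 g x y z) = l3 g (A.1.1 x) (A.1.1 y) (A.1.1 z)]].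
Proof.
split=> [[GA A2]|[A2 dA Hd H00 [H01 H3]]].
  have /aut0_setE[dA _] := GA; have [_ _ _ _ [H00 H01 H3]] := GA; split=> //.
  - by move=> a; exact: aut0_comm.
  - move=> x y; have := H00 x y; rewrite A2 !zero_lfunE lf0 => /eqP.
    by rewrite subr_eq0 => /eqP.
  - split.
    + move=> x a; have := H01 x a; rewrite A2 !zero_lfunE => /eqP.
      by rewrite subr_eq0 => /eqP.
    + by move=> x y z; have := H3 x y z; rewrite /cyc A2 !(zero_lfunE, lf0) !add0r.
have [A0 A1] := dA; split=> //; split; rewrite ?A2.
- exact/lker0_bijective.
- exact/lker0_bijective.
- by move=> x y; rewrite !zero_lfunE oppr0.
- by apply/lfunP => a; rewrite !comp_lfunE.
split.
- by move=> x y; rewrite H00 !zero_lfunE lf0 subrr.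
- by move=> x a; rewrite H01 !zero_lfunE subrr.
- by move=> x y z; rewrite /cyc H3 !(zero_lfunE, lf0) !add0r.
Qed.

(** The curve [(exp (t X_0), exp (t X_1), 0)], obtained as a single linear flow on the space of
    triples. *)
Definition flow0 X : R -> T :=
  linear_flow (linfun (fun C : T => ((X.1.1 \o C.1.1)%VF, (X.1.2 \o C.1.2)%VF, 0) : T))
    (aut0_one g0 g1).

Lemma flow0_field_linear X :
  linear (fun C : T => ((X.1.1 \o C.1.1)%VF, (X.1.2 \o C.1.2)%VF, 0) : T).
Proof.
move=> k C D; congr (_, _, _); rewrite /= ?comp_lfunDr ?comp_lfunZr//.
by rewrite scaler0 addr0.
Qed.

Lemma flow00 X : flow0 X 0 = aut0_one g0 g1.
Proof. exact: linear_flow0. Qed.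

Lemma flow0_derive X t : is_vderive (flow0 X) t
  ((X.1.1 \o (flow0 X t).1.1)%VF, (X.1.2 \o (flow0 X t).1.2)%VF, 0).
Proof.
have := linear_flow_derive (linfun (fun C : T =>
  ((X.1.1 \o C.1.1)%VF, (X.1.2 \o C.1.2)%VF, 0) : T)) (aut0_one g0 g1) t.
by rewrite (linfunE (flow0_field_linear X)).
Qed.

Lemma flow0_derive0 X t : is_vderive (fun s => (flow0 X s).1.1) t
  (X.1.1 \o (flow0 X t).1.1)%VF.
Proof. exact: is_vderive_fst (is_vderive_fst (flow0_derive X t)). Qed.

Lemma flow0_derive1 X t : is_vderive (fun s => (flow0 X s).1.2) t
  (X.1.2 \o (flow0 X t).1.2)%VF.
Proof. exact: is_vderive_snd (is_vderive_fst (flow0_derive X t)). Qed.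

Lemma flow02 X t : (flow0 X t).2 = 0.
Proof.
have <- : (flow0 X 0).2 = 0 by rewrite flow00.
apply: (is_vderive0_cst (c := fun s => (flow0 X s).2)) => s.
exact: is_vderive_snd (flow0_derive X s).
Qed.

Lemma lmul_ode_unique (V : vectType R) (N : 'End(V)) (c c' : R -> 'End(V)) :
  (forall t, is_vderive c t (N \o c t)%VF) ->
  (forall t, is_vderive c' t (N \o c' t)%VF) -> c 0 = c' 0 -> c =1 c'.
Proof.
move=> Hc Hc' E.
have LE f : linfun (fun f : 'End(V) => (N \o f)%VF) f = (N \o f)%VF.
  exact: linfunE (lmul_linear _) f.
apply: (@linear_ode_unique _ _ (linfun (fun f : 'End(V) => (N \o f)%VF)) 0) => //.
  by move=> t; rewrite add0r LE.
by move=> t; rewrite add0r LE.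
Qed.

(** In each of the first two components both sides, as functions of [s], solve the equation
    [C' = X_i C] with the same value at 0. *)
Lemma flow0D X s t : flow0 X (s + t) = aut0_mul (flow0 X s) (flow0 X t).
Proof.
apply: triple_eq; last first.
- by move=> x y; rewrite flow02 aut0_mul2E !flow02 !(zero_lfunE, lf0) addr0.
- rewrite aut0_mul12.
  apply: (lmul_ode_unique (N := X.1.2) (c := fun s => (flow0 X (s + t)).1.2)
    (c' := fun s => ((flow0 X s).1.2 \o (flow0 X t).1.2)%VF)).
  + by move=> u; exact: (is_vderive_shiftr (flow0_derive1 X (u + t))).
  + move=> u; apply: is_vderive_eq (is_vderive_comp (flow0_derive1 X u)
      (is_vderive_cst _ _)) _.
    by rewrite comp_lfun0r addr0 comp_lfunA.
  + by rewrite add0r flow00 comp_lfun1l.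
- rewrite aut0_mul11.
  apply: (lmul_ode_unique (N := X.1.1) (c := fun s => (flow0 X (s + t)).1.1)
    (c' := fun s => ((flow0 X s).1.1 \o (flow0 X t).1.1)%VF)).
  + by move=> u; exact: (is_vderive_shiftr (flow0_derive0 X (u + t))).
  + move=> u; apply: is_vderive_eq (is_vderive_comp (flow0_derive0 X u)
      (is_vderive_cst _ _)) _.
    by rewrite comp_lfun0r addr0 comp_lfunA.
  + by rewrite add0r flow00 comp_lfun1l.
Qed.

Lemma flow0N X t : aut0_mul (flow0 X (- t)) (flow0 X t) = aut0_one g0 g1.
Proof. by rewrite -flow0D addNr flow00. Qed.

Lemma flow0_dom X t : aut0_dom (flow0 X t).
Proof.
split; [apply: (@lker0_left_inverse _ _ _ (flow0 X (- t)).1.1)|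
        apply: (@lker0_left_inverse _ _ _ (flow0 X (- t)).1.2)].
  by rewrite -aut0_mul11 flow0N.
by rewrite -aut0_mul12 flow0N.
Qed.

Lemma flow0_inv X t : aut0_inv (flow0 X t) = flow0 X (- t).
Proof.
rewrite -[LHS]aut0_mul1l -(flow0N X t) -aut0_mulA aut0_mulV ?aut0_mul1r//.
exact: flow0_dom.
Qed.

(** Each identity is tested on a difference governed by [X_0] or [X_1], according to the space where
    it takes its values: the derivation identity rewrites the derivative of the difference as that
    endomorphism applied to it. *)
Lemma flow0_saut0 X t : lset (xl0 (SDer g)) X -> gset (SAut0 g) (flow0 X t).
Proof.
move=> /sder0_setE[X2 Hd H00 H01 H3]; apply/saut0_setE.
have D0 x s : is_vderive (fun s => (flow0 X s).1.1 x) s (X.1.1 ((flow0 X s).1.1 x)).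
  by apply: is_vderive_eq (is_vderive_app1 x (flow0_derive0 X s)) _; rewrite comp_lfunE.
have D1 x s : is_vderive (fun s => (flow0 X s).1.2 x) s (X.1.2 ((flow0 X s).1.2 x)).
  by apply: is_vderive_eq (is_vderive_app1 x (flow0_derive1 X s)) _; rewrite comp_lfunE.
have I0 x : (flow0 X 0).1.1 x = x by rewrite flow00 id_lfunE.
have I1 x : (flow0 X 0).1.2 x = x by rewrite flow00 id_lfunE.
split; [exact: flow02|exact: flow0_dom| | |split].
- move=> a; apply/eqP; rewrite -subr_eq0; apply/eqP.
  apply: (linear_ode_unique0 (N := X.1.1)
    (c := fun s => (flow0 X s).1.1 (d a) - d ((flow0 X s).1.2 a))).
    move=> s; apply: is_vderive_eq (is_vderiveB (D0 _ s) (is_vderive_lfun d (D1 a s))) _.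
    by rewrite lfD lfN Hd.
  by rewrite I0 I1 subrr.
- move=> x y; apply/eqP; rewrite -subr_eq0; apply/eqP.
  apply: (linear_ode_unique0 (N := X.1.1)
    (c := fun s => (flow0 X s).1.1 [x, y] - [(flow0 X s).1.1 x, (flow0 X s).1.1 y])).
    move=> s; apply: is_vderive_eq (is_vderiveB (D0 _ s)
      (is_vderive_app (is_vderive_lfun (br00 g) (D0 x s)) (D0 y s))) _.
    by rewrite lfD lfN H00.
  by rewrite !I0 subrr.
- move=> x a; apply/eqP; rewrite -subr_eq0; apply/eqP.
  apply: (linear_ode_unique0 (N := X.1.2)
    (c := fun s => (flow0 X s).1.2 (br x a) - br ((flow0 X s).1.1 x) ((flow0 X s).1.2 a))).
    move=> s; apply: is_vderive_eq (is_vderiveB (D1 _ s)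
      (is_vderive_app (is_vderive_lfun br (D0 x s)) (D1 a s))) _.
    by rewrite lfD lfN H01.
  by rewrite !I0 !I1 subrr.
- move=> x y z; apply/eqP; rewrite -subr_eq0; apply/eqP.
  apply: (linear_ode_unique0 (N := X.1.2)
    (c := fun s => (flow0 X s).1.2 (l3 g x y z) -
      l3 g ((flow0 X s).1.1 x) ((flow0 X s).1.1 y) ((flow0 X s).1.1 z))).
    move=> s; apply: is_vderive_eq (is_vderiveB (D1 _ s)
      (is_vderive_app (is_vderive_app (is_vderive_lfun (l3 g) (D0 x s)) (D0 y s))
         (D0 z s))) _.
    by rewrite lfD lfN H3 add_lfunE.
  by rewrite !I0 !I1 subrr.
Qed.

Lemma flow0_smooth X k (A : set R) : open A -> Ck k (fun t => v2r (flow0 X t)) A.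
Proof.
move=> oA; apply: (smooth_curve_linear_ode (L := id) (w0 := 0) k
  (flow0_field_linear X)) => // t.
by rewrite add0r; exact: flow0_derive.
Qed.

Lemma flow0_derive_at0 X : X.2 = 0 -> is_vderive (flow0 X) 0 X.
Proof.
move=> X2; apply: is_vderive_eq (flow0_derive X 0) _.
by apply: triple_eq; rewrite flow00 /= ?comp_lfun1r// X2.
Qed.

Lemma flow0_one_parameter X : lset (xl0 (SDer g)) X ->
  is_one_parameter_subgroup (SAut0 g) X (flow0 X).
Proof.
move=> HX; have /sder0_setE[X2 _ _ _ _] := HX; split.
- by move=> t; exact: flow0_saut0.
- by move=> s t; exact: flow0D.
- by move=> k; apply: flow0_smooth; exact: openT.
- exact: flow0_derive_at0.
Qed.

(** Differentiating [c (s + t) = c s * c t] at [s = 0] gives linear equations for the first two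
    components; membership in the group makes the third one vanish. *)
Lemma saut0_one_parameter_unique X c1 c2 :
  is_one_parameter_subgroup (SAut0 g) X c1 ->
  is_one_parameter_subgroup (SAut0 g) X c2 -> c1 =1 c2.
Proof.
have ode c : is_one_parameter_subgroup (SAut0 g) X c ->
    [/\ c 0 = aut0_one g0 g1, forall t, (c t).2 = 0,
      forall t, is_vderive (fun s => (c s).1.1) t (X.1.1 \o (c t).1.1)%VF
    & forall t, is_vderive (fun s => (c s).1.2) t (X.1.2 \o (c t).1.2)%VF].
  move=> Hc; have c0 := one_parameter0 (saut0_is_group g) Hc.
  have [Gc cD _ dc] := Hc.
  have D t : is_vderive c t (aut0_mul X (c t)).
    apply: is_vderive_shift.
    apply: is_vderive_ext (is_vderive_linear (aut0_mul_linear (c t)) dc) => s.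
    by rewrite cD.
  split=> // t; first by have [] := Gc t.
    exact: is_vderive_fst (is_vderive_fst (D t)).
  exact: is_vderive_snd (is_vderive_fst (D t)).
move=> /ode[c10 c12 D10 D11] /ode[c20 c22 D20 D21] t.
apply: triple_eq; last by move=> x y; rewrite c12 c22.
  apply: (lmul_ode_unique (N := X.1.1) (c := fun s => (c1 s).1.1)
    (c' := fun s => (c2 s).1.1)) => //.
  by rewrite c10 c20.
apply: (lmul_ode_unique (N := X.1.2) (c := fun s => (c1 s).1.2)
  (c' := fun s => (c2 s).1.2)) => //.
by rewrite c10 c20.
Qed.

Lemma saut0_lexp X t : lset (xl0 (SDer g)) X -> lexp (SAut0 g) (t *: X) = flow0 X t.
Proof.
move=> HX; apply: lexp_one_parameter (flow0_one_parameter HX) t.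
exact: saut0_one_parameter_unique.
Qed.

Lemma near_curve_in (V : vectType R) (M : set V) p c : smooth_curve_in M p c ->
  \forall t \near (0 : R), M (c t).
Proof.
by move=> [_ [e e0 [_ H0]]]; apply/nbhs_ballP; exists e.
Qed.

Lemma is_vderive_near_eq (V : vectType R) (c c' : R -> V) v v' :
  (\forall t \near (0 : R), c t = c' t) ->
  is_vderive c 0 v -> is_vderive c' 0 v' -> v = v'.
Proof. by move=> /is_vderive_near H1 /H1; exact: is_vderive_unique. Qed.

(** The flow provides a curve for every strict derivation. Conversely, the two sides of each
    defining identity agree along a curve in the group for small times, so their derivatives at 0
    agree, and these are the derivation identities. *)
Lemma saut0_tangent : lset (xl0 (SDer g)) =
  tangent_space (gset (SAut0 g)) (gone (SAut0 g)).
Proof.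
apply/seteqP; split=> X.
  move=> HX; have /sder0_setE[X2 _ _ _ _] := HX.
  exists (flow0 X); last exact: flow0_derive_at0.
  split; first exact: flow00.
  exists 1 => //; split; first by move=> k; apply: flow0_smooth; exact: ball_open.
  by move=> t _; exact: flow0_saut0.
move=> [c Hc dc]; have nc := near_curve_in Hc; have [c0 _] := Hc.
have D0 x : is_vderive (fun s => (c s).1.1 x) 0 (X.1.1 x).
  exact: is_vderive_app1 (is_vderive_fst (is_vderive_fst dc)).
have D1 x : is_vderive (fun s => (c s).1.2 x) 0 (X.1.2 x).
  exact: is_vderive_app1 (is_vderive_snd (is_vderive_fst dc)).
have I0 x : (c 0).1.1 x = x by rewrite c0 /= id_lfunE.
have I1 x : (c 0).1.2 x = x by rewrite c0 /= id_lfunE.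
apply/sder0_setE; split.
- apply: is_vderive_near_eq (is_vderive_snd dc) (is_vderive_cst 0 _).
  by apply: filterS nc => t /saut0_setE[].
- move=> a; apply: is_vderive_near_eq (D0 _) (is_vderive_lfun d (D1 a)).
  by apply: filterS nc => t /saut0_setE[_ _ + _ _]; apply.
- move=> x y; apply: is_vderive_near_eq (D0 _) _; last first.
    apply: is_vderive_eq (is_vderive_app (is_vderive_lfun (br00 g) (D0 x)) (D0 y)) _.
    by rewrite !I0.
  by apply: filterS nc => t /saut0_setE[_ _ _ + _]; apply.
- move=> x a; apply: is_vderive_near_eq (D1 _) _; last first.
    apply: is_vderive_eq (is_vderive_app (is_vderive_lfun br (D0 x)) (D1 a)) _.
    by rewrite I0 I1.
  by apply: filterS nc => t /saut0_setE[_ _ _ _ [+ _]]; apply.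
- move=> x y z; apply: is_vderive_near_eq (D1 _) _; last first.
    apply: is_vderive_eq (is_vderive_app (is_vderive_app
      (is_vderive_lfun (l3 g) (D0 x)) (D0 y)) (D0 z)) _.
    by rewrite add_lfunE !I0.
  by apply: filterS nc => t /saut0_setE[_ _ _ _ [_ +]]; apply.
Qed.

Lemma saut0_is_lie_algebra_of : is_lie_algebra_of (SAut0 g) (xl0 (SDer g)).
Proof.
split; first exact: saut0_tangent.
move=> X Y HX HY; have /sder0_setE[X2 _ _ _ _] := HX; have /sder0_setE[Y2 _ _ _ _] := HY.
(* The inner derivative is [Ad (exp (t X)) Y], with the inverse of the flow at [t] written as the
   flow at [- t]. *)
exists (fun t => (((flow0 X t).1.1 \o Y.1.1 \o (flow0 X (- t)).1.1)%VF,
  ((flow0 X t).1.2 \o Y.1.2 \o (flow0 X (- t)).1.2)%VF, 0) : T).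
have DX := flow0_derive_at0 X2; have DY := flow0_derive_at0 Y2.
split.
  apply: (@nearW _ (nbhs (0 : R))) => t.
  apply: is_vderive_ext (_ : is_vderive (fun s =>
    (((flow0 X t).1.1 \o (flow0 Y s).1.1 \o (flow0 X (- t)).1.1)%VF,
     ((flow0 X t).1.2 \o (flow0 Y s).1.2 \o (flow0 X (- t)).1.2)%VF, 0) : T) 0 _).
    move=> s; rewrite !saut0_lexp// saut0_ginv; last exact: flow0_saut0.
    rewrite flow0_inv; apply: triple_eq => // x y.
    by rewrite !aut0_mul2E !flow02 !zero_lfunE !lf0 !addr0.
  apply: is_vderive_pair; last exact: is_vderive_cst.
  apply: is_vderive_pair.
    apply: (is_vderive_linear (f := fun C : 'End(g0) =>
      ((flow0 X t).1.1 \o C \o (flow0 X (- t)).1.1)%VF)).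
      by move=> k u v; rewrite comp_lfunDr comp_lfunDl comp_lfunZl comp_lfunZr.
    exact: is_vderive_fst (is_vderive_fst DY).
  apply: (is_vderive_linear (f := fun C : 'End(g1) =>
    ((flow0 X t).1.2 \o C \o (flow0 X (- t)).1.2)%VF)).
    by move=> k u v; rewrite comp_lfunDr comp_lfunDl comp_lfunZl comp_lfunZr.
  exact: is_vderive_snd (is_vderive_fst DY).
have DXN := is_vderive_opp DX.
have K0 := is_vderive_comp (is_vderive_comp (is_vderive_fst (is_vderive_fst DX))
  (is_vderive_cst Y.1.1 0)) (is_vderive_fst (is_vderive_fst DXN)).
have K1 := is_vderive_comp (is_vderive_comp (is_vderive_snd (is_vderive_fst DX))
  (is_vderive_cst Y.1.2 0)) (is_vderive_snd (is_vderive_fst DXN)).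
apply: is_vderive_eq (is_vderive_pair (is_vderive_pair K0 K1) (is_vderive_cst 0 0)) _.
apply: triple_eqP => [x|x|x y]; last first.
- by rewrite (der0_br2_strict X2 Y2).
- by rewrite der0_br12E /= oppr0 !flow00 /= !lfunEs; vring.
- by rewrite der0_br11E /= oppr0 !flow00 /= !lfunEs; vring.
Qed.

End StrictOneParameter.

(** * One-parameter subgroups of SAut^{-1} and the differentiated crossed module *)

Section StrictOneParameter1.
Variables (R : realType) (g0 g1 : vectType R) (g : lie2_algebra g0 g1).
Local Notation d := (gdiff g).
Local Notation "[ x , y ]" := (br00 g x y).
Local Notation br := (br01 g).
Local Notation H := 'Hom(g0, g1).
Local Notation "u * v" := (aut1_mul g u v).
Implicit Types (s t : R) (a b u : H).

Definition flow1_field a : 'End(H) := linfun (fun u : H => (a \o (d \o u))%VF).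

Lemma flow1_field_linear a : linear (fun u : H => (a \o (d \o u))%VF).
Proof. by move=> k u v; apply/lfunP => x; rewrite !lfunEs. Qed.

Lemma flow1_fieldE a u x : flow1_field a u x = a (d (u x)).
Proof. by rewrite (linfunE (flow1_field_linear a)) !comp_lfunE. Qed.

(** Differentiating [c (s + t) = c s * c t] at [s = 0] gives [c' = a + a d c]: the affine term comes
    from the product [s + t + s d t], whose unit is 0. *)
Definition is_flow1 a (c : R -> H) :=
  c 0 = 0 /\ forall t, is_vderive c t (a + flow1_field a (c t)).

Lemma flow1_exists a : exists c, is_flow1 a c.
Proof. by have [c c0 Hc] := affine_ode_solution (flow1_field a) a 0; exists c. Qed.

Lemma flow1_unique a c c' : is_flow1 a c -> is_flow1 a c' -> c =1 c'.
Proof. by move=> [c0 Hc] [c0' Hc']; apply: linear_ode_unique Hc Hc' _; rewrite c0. Qed.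

Lemma is_vderive_aut1_mul c c' t a b :
  is_vderive c t a -> is_vderive c' t b ->
  is_vderive (fun s => c s * c' s) t
    (a + b + ((a \o (d \o c' t)) + (c t \o (d \o b)))%VF).
Proof.
move=> Hc Hc'; rewrite /aut1_mul; apply: is_vderiveD; first exact: is_vderiveD.
apply: is_vderive_eq (is_vderive_comp Hc (is_vderive_comp (is_vderive_cst d t) Hc')) _.
by rewrite comp_lfun0l add0r.
Qed.

(** As functions of [s], both sides solve the same affine equation and equal [c t] at [s = 0]. *)
Lemma flow1D a c s t : is_flow1 a c -> c (s + t) = c s * c t.
Proof.
move=> [c0 Hc]; apply: (linear_ode_unique (N := flow1_field a) (w := a)
  (c := fun s => c (s + t)) (c' := fun s => c s * c t)).
- by move=> u; exact: (is_vderive_shiftr (Hc (u + t))).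
- move=> u; apply: is_vderive_eq (is_vderive_aut1_mul (Hc u) (is_vderive_cst (c t) u)) _.
  apply/lfunP => x; rewrite !add_lfunE !comp_lfunE !add_lfunE !flow1_fieldE.
  by rewrite aut1_mulE !(zero_lfunE, lfD, lf0); vring.
- by rewrite add0r c0 aut1_mul0r.
Qed.

Lemma flow1_dom a c t : is_flow1 a c -> aut1_dom g (c t).
Proof.
move=> Hc; apply/aut1_setE; exists (c (- t)).
by rewrite -!(flow1D _ _ Hc) addNr subrr; case: Hc => ->.
Qed.

Lemma flow1_inv a c t : is_flow1 a c -> aut1_inv g (c t) = c (- t).
Proof.
move=> Hc; rewrite -[RHS](aut1_mulr0 g) -(aut1_mulV (flow1_dom t Hc)) aut1_mulA.
by rewrite -(flow1D _ _ Hc) addNr; case: Hc => -> _; rewrite aut1_mul0r.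
Qed.

Lemma sder1E a : lset (xl1 (SDer g)) a <->
  forall x y, a [x, y] = br x (a y) - br y (a x).
Proof. by split=> Ha x y; rewrite Ha. Qed.

(** The third component of the boundary of [c], at fixed [x] and [y], solves the homogeneous
    equation with endomorphism [a \o d]; the identity for [a] and the Peiffer identity put its
    derivative in that form. *)
Lemma flow1_saut1 a c t : lset (xl1 (SDer g)) a -> is_flow1 a c ->
  gset (SAut1 g) (c t).
Proof.
move=> /sder1E Ha Hc; apply/saut1_setE; split; first exact: flow1_dom Hc.
have [c0 Dc] := Hc; apply/lfun2P => x y; rewrite !zero_lfunE.
have D1 z s : is_vderive (fun s => c s z) s (a z + a (d (c s z))).
  by apply: is_vderive_eq (is_vderive_app1 z (Dc s)) _; rewrite add_lfunE flow1_fieldE.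
apply: (linear_ode_unique0 (N := (a \o d)%VF) (c := fun s => (aut_bd g (c s)).2 x y)).
  move=> s; have D := is_vderiveD (is_vderiveD (is_vderiveB (D1 [x, y] s)
    (is_vderive_lfun (br x) (D1 y s))) (is_vderive_lfun (br y) (D1 x s)))
    (is_vderive_app (is_vderive_lfun br (is_vderive_lfun d (D1 y s))) (D1 x s)).
  apply: is_vderive_eq (is_vderive_ext _ D) _.
    by move=> u; rewrite aut_bd2E.
  rewrite comp_lfunE aut_bd2E !(lfD, lfN, add_lfunE) -!br00_dr !Ha.
  rewrite (br_peiffer g (a y) (c s x)) (br_peiffer g (a (d (c s y))) (c s x)).
  vring.
by rewrite c0 aut_bd0 /= !zero_lfunE.
Qed.

Lemma flow1_smooth a c k (A : set R) : is_flow1 a c -> open A ->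
  Ck k (fun t => v2r (c t)) A.
Proof.
move=> [c0 Hc] oA; apply: (smooth_curve_linear_ode (L := id) (w0 := a) k
  (flow1_field_linear a)) => // t.
by have := Hc t; rewrite /flow1_field (linfunE (flow1_field_linear a)).
Qed.

Lemma flow1_derive_at0 a c : is_flow1 a c -> is_vderive c 0 a.
Proof.
move=> [c0 Hc]; apply: is_vderive_eq (Hc 0) _.
by rewrite c0 linear0 addr0.
Qed.

Lemma flow1_one_parameter a c : lset (xl1 (SDer g)) a -> is_flow1 a c ->
  is_one_parameter_subgroup (SAut1 g) a c.
Proof.
move=> Ha Hc; split.
- by move=> t; exact: flow1_saut1 Hc.
- by move=> s t; exact: flow1D Hc.
- by move=> k; apply: (flow1_smooth k Hc); exact: openT.
- exact: flow1_derive_at0.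
Qed.

Lemma saut1_one_parameter_unique a c1 c2 :
  is_one_parameter_subgroup (SAut1 g) a c1 ->
  is_one_parameter_subgroup (SAut1 g) a c2 -> c1 =1 c2.
Proof.
have flow c : is_one_parameter_subgroup (SAut1 g) a c -> is_flow1 a c.
  move=> Hc; have c0 := one_parameter0 (saut1_is_group g) Hc.
  have [_ cD _ dc] := Hc; split=> // t; apply: is_vderive_shift.
  apply: is_vderive_eq (is_vderive_ext _ (is_vderive_aut1_mul dc (is_vderive_cst (c t) 0))) _.
    by move=> s; rewrite cD.
  apply/lfunP => x; rewrite !add_lfunE !comp_lfunE flow1_fieldE.
  by rewrite zero_lfunE !lf0 !addr0.
by move=> /flow H1 /flow H2; exact: flow1_unique H1 H2.
Qed.

Lemma saut1_lexp a c t : lset (xl1 (SDer g)) a -> is_flow1 a c ->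
  lexp (SAut1 g) (t *: a) = c t.
Proof.
move=> Ha Hc; apply: lexp_one_parameter (flow1_one_parameter Ha Hc) t.
exact: saut1_one_parameter_unique.
Qed.

Lemma saut1_tangent : lset (xl1 (SDer g)) =
  tangent_space (gset (SAut1 g)) (gone (SAut1 g)).
Proof.
apply/seteqP; split=> a.
  move=> Ha; have [c Hc] := flow1_exists a.
  exists c; last exact: flow1_derive_at0.
  split; first by case: Hc.
  exists 1 => //; split; first by move=> k; apply: (flow1_smooth k Hc); exact: ball_open.
  by move=> t _; exact: flow1_saut1 Hc.
move=> [c Hc dc]; have nc := near_curve_in Hc; have [c0 _] := Hc.
have D1 z : is_vderive (fun s => c s z) 0 (a z) by exact: is_vderive_app1.
apply/sder1E => x y; apply/eqP; rewrite -subr_eq0; apply/eqP.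
have D := is_vderiveD (is_vderiveD (is_vderiveB (D1 [x, y])
    (is_vderive_lfun (br x) (D1 y))) (is_vderive_lfun (br y) (D1 x)))
    (is_vderive_app (is_vderive_lfun br (is_vderive_lfun d (D1 y))) (D1 x)).
apply: is_vderive_near_eq (is_vderive_cst 0 0); last first.
  (* Since [c 0 = 0], the quadratic term has derivative 0 there, and only the linear condition of
     SDer^{-1} remains. *)
  apply: is_vderive_eq D _.
  by rewrite c0 !(zero_lfunE, lf0) !addr0; vring.
by apply: filterS nc => t /saut1_setE[_ E] /=; rewrite -aut_bd2E E !zero_lfunE.
Qed.

Lemma saut1_is_lie_algebra_of : is_lie_algebra_of (SAut1 g) (xl1 (SDer g)).
Proof.
split; first exact: saut1_tangent.
move=> a b Ha Hb; have [ca Hca] := flow1_exists a; have [cb Hcb] := flow1_exists b.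
have Da := flow1_derive_at0 Hca; have Db := flow1_derive_at0 Hcb.
have DaN := is_vderive_opp Da.
(* The derivative at [s = 0] of [ca t * cb s]; multiplying on the right by the constant [ca (- t)]
   adds the second term of the witness. *)
pose D t := b + (ca t \o (d \o b))%VF.
exists (fun t => D t + (D t \o (d \o ca (- t)))%VF); split.
  apply: (@nearW _ (nbhs (0 : R))) => t.
  apply: is_vderive_eq (is_vderive_ext _ (is_vderive_aut1_mul
    (is_vderive_aut1_mul (is_vderive_cst (ca t) 0) Db) (is_vderive_cst (ca (- t)) 0))) _.
    move=> s /=; rewrite (saut1_lexp t Ha Hca) (saut1_lexp s Hb Hcb) saut1_ginv.
      by rewrite (flow1_inv t Hca).
    exact: flow1_saut1 Hca.
  apply/lfunP => x; rewrite /D !(add_lfunE, comp_lfunE, zero_lfunE, lf0, lfD).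
  by vring.
have DD : is_vderive D 0 (a \o (d \o b))%VF.
  apply: is_vderive_eq (is_vderiveD (is_vderive_cst b 0)
    (is_vderive_comp Da (is_vderive_cst (d \o b)%VF 0))) _.
  by rewrite comp_lfun0r addr0 add0r.
apply: is_vderive_eq (is_vderiveD DD (is_vderive_comp DD
  (is_vderive_comp (is_vderive_cst d 0) DaN))) _.
have [ca0 _] := Hca.
apply/lfunP => x; rewrite /D oppr0 ca0 /= der1_brE.
by rewrite !(add_lfunE, opp_lfunE, comp_lfunE, zero_lfunE, lf0, lfD, lfN); vring.
Qed.

Lemma aut_bd_derive a c : c 0 = 0 -> is_vderive c 0 a ->
  is_vderive (fun t => aut_bd g (c t)) 0 (der_bd g a).
Proof.
move=> c0 dc; have D1 z : is_vderive (fun s => c s z) 0 (a z) by exact: is_vderive_app1.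
apply: (@is_vderive_pair _ _ _ (fun t => (aut_bd g (c t)).1) (fun t => (aut_bd g (c t)).2)
  0 (der_bd g a).1 (der_bd g a).2).
  apply: is_vderive_pair.
    apply: is_vderive_eq (is_vderiveD (is_vderive_cst \1%VF 0)
      (is_vderive_comp (is_vderive_cst d 0) dc)) _.
    by rewrite comp_lfun0l !add0r.
  apply: is_vderive_eq (is_vderiveD (is_vderive_cst \1%VF 0)
    (is_vderive_comp dc (is_vderive_cst d 0))) _.
  by rewrite comp_lfun0r addr0 add0r.
apply: is_vderive_pointwise => x; apply: is_vderive_pointwise => y.
have D := is_vderiveD (is_vderiveD (is_vderiveB (D1 [x, y])
    (is_vderive_lfun (br x) (D1 y))) (is_vderive_lfun (br y) (D1 x)))
    (is_vderive_app (is_vderive_lfun br (is_vderive_lfun d (D1 y))) (D1 x)).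
apply: is_vderive_eq (is_vderive_ext _ D) _; first by move=> s; rewrite aut_bd2E.
by rewrite der_bd2E c0 !(zero_lfunE, lf0) !addr0.
Qed.

Lemma saut_differentiation : is_differentiation_of (SAut g) (SDer g).
Proof.
split; [exact: saut1_is_lie_algebra_of|exact: saut0_is_lie_algebra_of| |].
  by move=> a c [c0 _] dc; exact: aut_bd_derive.
move=> X a HX Ha; have [c Hc] := flow1_exists a.
have /sder0_setE[X2 _ _ _ _] := HX.
have Dc := flow1_derive_at0 Hc; have DX := flow0_derive_at0 X2.
(* The action is linear in its second argument, so the inner derivative is the flow at [t] acting on
   [a]. *)
exists (fun t => ((flow0 X t).1.2 \o a \o (flow0 X (- t)).1.1)%VF); split.
  apply: (@nearW _ (nbhs (0 : R))) => t.
  apply: is_vderive_ext (_ : is_vderive (fun s =>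
    ((flow0 X t).1.2 \o c s \o (flow0 X (- t)).1.1)%VF) 0 _).
    by move=> s /=; rewrite (saut0_lexp t HX) (saut1_lexp s Ha Hc) /aut_act -flow0_inv.
  apply: (is_vderive_linear (f := fun u : H =>
    ((flow0 X t).1.2 \o u \o (flow0 X (- t)).1.1)%VF)) => // k u v.
  by rewrite comp_lfunDr comp_lfunDl comp_lfunZl comp_lfunZr.
have DXN := is_vderive_opp DX.
apply: is_vderive_eq (is_vderive_comp (is_vderive_comp (is_vderive_snd (is_vderive_fst DX))
  (is_vderive_cst a 0)) (is_vderive_fst (is_vderive_fst DXN))) _.
apply/lfunP => x; rewrite oppr0 !flow00 /= der_actE.
by rewrite !lfunEs; vring.
Qed.

End StrictOneParameter1.

Theorem lemma6p1 (R : realType) (g0 g1 : vectType R) (g : lie2_algebra g0 g1) :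
  is_sub_lie_xmod (SAut g) (Aut g) /\
  is_differentiation_of (SAut g) (SDer g) /\
  is_sub_lie_algebra_xmod (SDer g) (Der g).
Proof.
split; first exact: saut_sub_lie_xmod.
split; [exact: saut_differentiation|exact: sder_sub_lie_algebra_xmod].
Qed.
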